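(* Every complete Riemannian plane is quasi-isometric to a locally finite planar graph.
   Context: A complete Riemannian plane is a smooth surface homeomorphic to $\mathbb{R}^2$ equipped with a complete Riemannian metric, viewed as a metric space with its Riemannian distance. A graph is locally finite if every vertex has finite degree; it carries its shortest-path metric (edges of length 1). Metric spaces $X,Y$ are quasi-isometric if there is $f:X\to Y$ and constants $A\ge1$, $B,C\ge 0$ with $\frac1A d(x,x')-B\le d(f(x),f(x'))\le A d(x,x')+B$ for all $x,x'$ and every point of $Y$ within distance $C$ of $f(X)$. *)

(* Defs.v *)
From HB Require Import structures.
From mathcomp Require Import all_boot all_order all_algebra.
From mathcomp Require Import all_classical all_reals all_analysis.

Set Implicit Arguments.
Unset Strict Implicit.
Unset Printing Implicit Defensive.

Import Order.TTheory GRing.Theory Num.Theory.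
Import numFieldNormedType.Exports.

Local Open Scope classical_set_scope.
Local Open Scope ring_scope.

(* Only meaningful for open U: derivatives are two-sided. *)
Fixpoint Ck_on (R : realType) (V W : normedModType R) (k : nat)
    (U : set V) (f : V -> W) : Prop :=
  match k with
  | 0 => forall x, U x -> {for x, continuous f}
  | k'.+1 => (forall x, U x -> differentiable f x) /\
             (forall v : V, Ck_on k' U (fun x => 'D_v f x))
  end.

Definition smooth_on (R : realType) (V W : normedModType R)
    (U : set V) (f : V -> W) : Prop := forall k, Ck_on k U f.

Definition homeomorphic (X Y : topologicalType) : Prop :=
  exists (f : X -> Y) (g : Y -> X),
    [/\ cancel f g, cancel g f, continuous f & continuous g].

(* A C^oo atlas (not assumed maximal) with values in R^2.  The functions
   [coord i] and [param i] are total, but only their restrictions to [dom i]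
   and [coord i @` dom i] are meaningful. *)
Record smooth_atlas (R : realType) (M : topologicalType) := SmoothAtlas {
  chart : Type ;
  dom : chart -> set M ;
  coord : chart -> M -> 'rV[R]_2 ;
  param : chart -> 'rV[R]_2 -> M ;
  dom_cover : forall p, exists i, dom i p ;
  dom_open : forall i, open (dom i) ;
  cod_open : forall i, open (coord i @` dom i) ;
  coordK : forall i p, dom i p -> param i (coord i p) = p ;
  coord_continuous : forall i p, dom i p -> {for p, continuous (coord i)} ;
  param_continuous : forall i p, dom i p ->
    {for coord i p, continuous (param i)} ;
  transition_smooth : forall i j,
    smooth_on (coord i @` (dom i `&` dom j)) (coord j \o param i)
}.

Definition bilin (R : realType) (G : 'M[R]_2) (v w : 'rV[R]_2) : R :=
  (v *m G *m w^T) 0 0.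

(* [gram i x] is the matrix (g_{kl}) of the metric tensor in the chart i, at
   the point with coordinates x; [gram_compat] is the transformation law of
   covariant 2-tensors. *)
Record riemannian_metric (R : realType) (M : topologicalType)
    (A : smooth_atlas R M) := RiemannianMetric {
  gram : chart A -> 'rV[R]_2 -> 'M[R]_2 ;
  gram_smooth : forall i, smooth_on (coord i @` dom i) (gram i) ;
  gram_sym : forall i p, dom i p ->
    (gram i (coord i p))^T = gram i (coord i p) ;
  gram_posdef : forall i p, dom i p ->
    forall v, v != 0 -> 0 < bilin (gram i (coord i p)) v v ;
  gram_compat : forall i j p, dom i p -> dom j p ->
    forall v w : 'rV[R]_2,
      let x := coord i p in
      let tau : 'rV[R]_2 -> 'rV[R]_2 := coord j \o param i in
      bilin (gram i x) v w = bilin (gram j (tau x)) ('D_v tau x) ('D_w tau x)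
}.

Definition chart_at (R : realType) (M : topologicalType)
    (A : smooth_atlas R M) (p : M) : chart A := sval (cid (dom_cover A p)).

(* Piecewise C^1 curves on [0, 1], read in charts.  Off a finite set the curve
   is C^1; everywhere its velocity has one-sided limits, which (the curve being
   continuous) amounts to being C^1 on each closed piece of the subdivision. *)
Definition piecewise_C1 (R : realType) (M : topologicalType)
    (A : smooth_atlas R M) (c : R -> M) : Prop :=
  {within `[0, 1], continuous c} /\
  exists s : seq R,
    forall (t : R) (i : chart A), 0 <= t <= 1 -> dom i (c t) ->
      let u : R -> 'rV[R]_2 := coord i \o c in
      [/\ 0 < t < 1 -> t \notin s ->
            derivable u t 1 /\ {for t, continuous (derive1 u)},
          0 < t -> cvg (derive1 u x @[x --> t^'-]) &
          t < 1 -> cvg (derive1 u x @[x --> t^'+])].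

(* By [gram_compat], the choice of the chart is irrelevant wherever the curve
   is differentiable. *)
Definition speed (R : realType) (M : topologicalType) (A : smooth_atlas R M)
    (g : riemannian_metric A) (c : R -> M) (t : R) : R :=
  let i := chart_at A (c t) in
  let u : R -> 'rV[R]_2 := coord i \o c in
  Num.sqrt (bilin (gram g i (u t)) (derive1 u t) (derive1 u t)).

Definition curve_length (R : realType) (M : topologicalType)
    (A : smooth_atlas R M) (g : riemannian_metric A) (c : R -> M) : R :=
  \int[@lebesgue_measure R]_(t in `[0, 1]) speed g c t.

Definition riemannian_dist (R : realType) (M : topologicalType)
    (A : smooth_atlas R M) (g : riemannian_metric A) (p q : M) : R :=
  inf [set curve_length g c |
        c in [set c | [/\ piecewise_C1 A c, c 0 = p & c 1 = q]]].

Definition complete_dist (R : realType) (X : Type) (d : X -> X -> R) : Prop :=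
  forall u : nat -> X,
    (forall e, 0 < e ->
      exists N, forall m n, (N <= m)%N -> (N <= n)%N -> d (u m) (u n) < e) ->
    exists x, forall e, 0 < e ->
      exists N, forall n, (N <= n)%N -> d (u n) x < e.

Definition quasi_isometric (R : realType) (X Y : Type)
    (dX : X -> X -> R) (dY : Y -> Y -> R) : Prop :=
  exists (f : X -> Y) (A B C : R),
    [/\ 1 <= A, 0 <= B, 0 <= C,
        forall x x', A^-1 * dX x x' - B <= dY (f x) (f x') <= A * dX x x' + B &
        forall y, exists x, dY y (f x) <= C].

Record graph := Graph {
  vertex : Type ;
  adj : vertex -> vertex -> Prop ;
  adj_sym : forall u v, adj u v -> adj v u ;
  adj_irrefl : forall v, ~ adj v v
}.

Definition walk (G : graph) (n : nat) (u v : vertex G) : Prop :=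
  exists w : nat -> vertex G,
    [/\ w 0%N = u, w n = v & forall k, (k < n)%N -> adj (w k) (w k.+1)].

Definition connected_graph (G : graph) : Prop :=
  forall u v : vertex G, exists n, walk n u v.

Definition locally_finite_graph (G : graph) : Prop :=
  forall v : vertex G, finite_set [set w | adj v w].

(* Junk value 0 between distinct components: only used for connected graphs. *)
Definition graph_dist (R : realType) (G : graph) (u v : vertex G) : R :=
  inf [set n%:R | n in [set n | walk n u v]].

(* A drawing in R^2: each edge uv is an arc from [pos u] to [pos v], traversed
   backwards by [arc v u], whose interior contains no vertex and no point of
   another edge. *)
Definition planar_graph (R : realType) (G : graph) : Prop :=
  exists (pos : vertex G -> 'rV[R]_2)
         (arc : vertex G -> vertex G -> R -> 'rV[R]_2),
    [/\ injective pos,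
        forall u v, adj u v ->
          [/\ {within `[0, 1], continuous (arc u v)},
              {in `[0, 1] &, injective (arc u v)},
              arc u v 0 = pos u, arc u v 1 = pos v &
              forall t : R, 0 <= t <= 1 -> arc v u t = arc u v (1 - t)],
        forall u v w (t : R), adj u v -> 0 < t < 1 -> arc u v t <> pos w &
        forall u v u' v' (s t : R),
          adj u v -> adj u' v' -> 0 < s < 1 -> 0 < t < 1 ->
          arc u v s = arc u' v' t -> (u = u' /\ v = v') \/ (u = v' /\ v = u')].

(* Main.v *)
Require Import Defs.
From HB Require Import structures.
From mathcomp Require Import all_boot all_order all_algebra.
From mathcomp Require Import all_classical all_reals all_analysis.
From mathcomp Require Import measurable_realfun.
From mathcomp Require Import zify ring lra.

(** Transport the plane to R^2 by the homeomorphism, followed by a radial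
    stretching that makes every square of side 2 have diameter at most 1 for the
    Riemannian distance.  Points are then recorded by their cell in the grid Z^2;
    call a grid-connected set of cells small if its diameter is at most 3.  By
    Hopf-Rinow the balls are bounded, so the cells within distance 3 of a given
    one are finitely many, and a curve of length at most 1 runs through a small
    set.  The grid has no K5 minor; a buffered cop decomposition, in which each
    new supernode is built from at most three geodesic chains of small sets and
    then grown so as to absorb whatever comes close to the older supernodes,
    partitions the grid into connected clusters of bounded radius such that every
    small set is crossed by boundedly many steps from cluster to adjacent cluster.
    Contracting the clusters gives a graph quasi-isometric to the plane.  It is
    planar: a spanning tree of each cluster routes disjoint strands from its root
    to all of its boundary, without crossing inside the unit squares. *)

Set Implicit Arguments.
Unset Strict Implicit.
Unset Printing Implicit Defensive.

Import Order.TTheory GRing.Theory Num.Theory.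
Import numFieldNormedType.Exports.
Import Defs.

Local Open Scope classical_set_scope.

Local Notation Z2 := (int * int)%type.

(** * Connectivity and chains of small sets *)

Section Connectivity.
Variables (V : choiceType) (adj : V -> V -> Prop).

Inductive joined (D : set V) (x : V) : V -> Prop :=
| joined_refl : D x -> joined D x x
| joined_step y z : joined D x y -> adj y z -> D z -> joined D x z.

Definition connected_set (D : set V) := forall x y, D x -> D y -> joined D x y.

Definition K5_minor_free := ~ exists A : nat -> set V,
  [/\ forall i, (i < 5)%N -> connected_set (A i),
      forall i j x, (i < j < 5)%N -> A i x -> A j x -> False &
      forall i j, (i < j < 5)%N -> exists x y, [/\ A i x, A j y & adj x y]].

Definition first_hit (D T : set V) x t :=
  x = t \/ exists2 x', joined (D `\` T) x x' & adj x' t.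

Lemma joinedl D x y : joined D x y -> D x.
Proof. by elim. Qed.

Lemma joinedr D x y : joined D x y -> D y.
Proof. by elim. Qed.

Lemma joined_trans D x y z : joined D x y -> joined D y z -> joined D x z.
Proof. by move=> xy; elim=> // u v _ xu uv Dv; apply: joined_step xu uv Dv. Qed.

Lemma joined_adj D x y : D x -> D y -> adj x y -> joined D x y.
Proof. by move=> Dx Dy xy; apply: joined_step (joined_refl Dx) xy Dy. Qed.

Lemma joined_subset (D E : set V) x y : D `<=` E -> joined D x y -> joined E x y.
Proof.
move=> DE; elim=> [/DE|u v _ xu uv /DE Ev]; first exact: joined_refl.
exact: joined_step xu uv Ev.
Qed.

Lemma joined_in_component D x y : joined D x y -> joined (joined D x) x y.
Proof.
elim=> [Dx|u v xu xu' uv Dv]; first by apply/joined_refl/joined_refl.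
by apply: (joined_step xu' uv); apply: (joined_step xu uv Dv).
Qed.

Hypothesis adj_sym : forall x y, adj x y -> adj y x.

Lemma joined_sym D x y : joined D x y -> joined D y x.
Proof.
elim=> [|u v _ ux uv Dv]; first exact: joined_refl.
apply: (joined_trans _ ux); apply: joined_adj => //; last exact: adj_sym.
exact: joinedl ux.
Qed.

Lemma joined_eq D x y : joined D x y -> joined D x = joined D y.
Proof.
move=> xy; apply/seteqP; split=> z; apply: joined_trans => //.
exact: joined_sym.
Qed.

Lemma connected_component_set D x : connected_set (joined D x).
Proof.
move=> y z xy xz.
rewrite (joined_eq xy); apply: joined_in_component.
by apply: (joined_trans _ xz); apply: joined_sym.
Qed.

Lemma connected_from D o : (forall x, D x -> joined D o x) -> connected_set D.
Proof. by move=> Do x y /Do/joined_sym xo /Do; apply: joined_trans. Qed.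

Lemma joined_avoid_or_hit D (T : set V) x y : joined D x y ->
  joined (D `\` T) x y \/
  exists t t', [/\ (D `&` T) t, (D `&` T) t', first_hit D T x t & first_hit D T y t'].
Proof.
elim=> [Dx|u v xu [IH|[t [t' [Tt Tt' xt ut']]]] uv Dv].
- have [Tx|Tx] := pselect (T x); last by left; apply: joined_refl.
  by right; exists x, x; split=> //; left.
- have [Tv|Tv] := pselect (T v).
    by right; exists v, v; split=> //; [right; exists u|left].
  by left; apply: (joined_step IH uv).
- right; have [Tv|Tv] := pselect (T v); first by exists t, v; split=> //; left.
  have [Tu|Tu] := pselect (T u).
    exists t, u; split=> //; first by split=> //; apply: joinedr xu.
    by right; exists v; [apply: joined_refl|apply: adj_sym].
  exists t, t'; split=> //; right.
  case: ut' => [ut'|[u' uu' u't']]; first by case: Tt'; rewrite -ut'.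
  exists u' => //; apply: (joined_trans _ uu'); apply: joined_adj => //.
    by split=> //; apply: joinedr xu.
  exact: adj_sym.
Qed.

Lemma joined_exit D (T : set V) x y : joined D x y -> ~ T x -> T y ->
  exists x' t, [/\ joined (D `\` T) x x', adj x' t, D t & T t].
Proof.
move=> xy Tx Ty; case: (joined_avoid_or_hit T xy) => [/joinedr[]//|[t [t' [[Dt Tt] _]]]].
by case=> [xt|[x' xx' x't] _]; [move: Tx; rewrite xt|exists x', t].
Qed.

End Connectivity.

Section Chains.
Variables (V : choiceType) (adj close : V -> V -> Prop).

Local Notation joined := (joined adj).
Local Notation connected_set := (connected_set adj).

Definition small (K : set V) :=
  connected_set K /\ forall x y, K x -> K y -> close x y.

Definition small_step (D : set V) x y :=
  exists K, [/\ K `<=` D, small K, K x & K y].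

Fixpoint chain (D : set V) n x y :=
  if n is n'.+1 then exists2 z, chain D n' x z & small_step D z y else x = y.

Record geodesic (D : set V) n (p : nat -> V) (K : nat -> set V) : Prop := Geodesic {
  geodesic_set : forall j, (j < n)%N ->
    [/\ K j `<=` D, small (K j), K j (p j) & K j (p j.+1)] ;
  geodesic_chain : forall i j, (i <= j <= n)%N -> chain D (j - i) (p i) (p j) ;
  geodesic_dist : forall j z, (j < n)%N -> K j z ->
    chain D j.+1 (p 0) z /\ forall k, (k < j)%N -> ~ chain D k (p 0) z }.

Lemma small_subset (K L : set V) : small K -> L `<=` K -> connected_set L -> small L.
Proof. by move=> [_ cK] LK cL; split=> // x y /LK Kx /LK; apply: cK. Qed.

Lemma small_step_sym D x y : small_step D x y -> small_step D y x.
Proof. by move=> [K [KD sK Kx Ky]]; exists K. Qed.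

Lemma small_step_subset (D E : set V) x y :
  D `<=` E -> small_step D x y -> small_step E x y.
Proof. by move=> DE [K [KD sK Kx Ky]]; exists K; split=> // z /KD/DE. Qed.

Lemma small_step_close D x y : small_step D x y -> close x y.
Proof. by move=> [K [_ [_ cK] Kx Ky]]; apply: cK. Qed.

Lemma small_step_joined D x y : small_step D x y -> joined D x y.
Proof. by move=> [K [KD [cK _] Kx Ky]]; apply: joined_subset KD _; apply: cK. Qed.

Lemma chain_joined (D : set V) n x y : D x -> chain D n x y -> joined D x y.
Proof.
move=> Dx; elim: n y => [y <-|n IHn y [z /IHn xz /small_step_joined zy]].
  exact: joined_refl.
exact: joined_trans xz zy.
Qed.

Lemma chainr (D : set V) n x y : D x -> chain D n x y -> D y.
Proof. by move=> Dx xy; apply: joinedr (chain_joined Dx xy). Qed.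

Lemma chain_subset (D E : set V) n x y : D `<=` E -> chain D n x y -> chain E n x y.
Proof.
move=> DE; elim: n y => //= n IHn y [z /IHn xz zy].
by exists z => //; apply: small_step_subset zy.
Qed.

Lemma chain_trans D m n x y z : chain D m x y -> chain D n y z -> chain D (m + n) x z.
Proof.
move=> xy; elim: n z => [z <-|n IHn z [t /IHn yt tz]]; first by rewrite addn0.
by rewrite addnS; exists t.
Qed.

Lemma chain_step (D : set V) n x y z :
  chain D n x y -> small_step D y z -> chain D n.+1 x z.
Proof. by move=> xy yz; exists y. Qed.

Lemma chain_sym (D : set V) n x y : chain D n x y -> chain D n y x.
Proof.
elim: n y => [y ->//|n IHn y [z xz /small_step_sym yz]].
by have /chain_trans/(_ (IHn _ xz)) : chain D 1 y z by exists y.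
Qed.

Lemma chain_small_sets (D : set V) n x y : chain D n x y ->
  exists (p : nat -> V) (K : nat -> set V),
  [/\ p 0 = x, p n = y & forall j, (j < n)%N ->
      [/\ K j `<=` D, small (K j), K j (p j) & K j (p j.+1)]].
Proof.
elim: n y => [y <-|n IHn y [z xz [L [LD sL Lz Ly]]]].
  by exists (fun=> x), (fun=> setT).
have [p [K [p0 pn pK]]] := IHn _ xz.
exists (fun j => if (j <= n)%N then p j else y),
  (fun j => if (j < n)%N then K j else L).
rewrite leq0n ltnn; split=> // j; rewrite ltnS leq_eqVlt => /orP[/eqP->|jn].
  by rewrite eqxx !ltnn pn.
by rewrite jn orbT; apply: pK.
Qed.

Hypothesis close_refl : forall x, close x x.

Lemma small_set1 x : small [set x].
Proof. by split=> [y z /= -> ->|y z -> ->//]; apply: joined_refl. Qed.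

Lemma small_step_refl (D : set V) x : D x -> small_step D x x.
Proof. by move=> Dx; exists [set x]; split=> // [y ->//|]; apply: small_set1. Qed.

Lemma chain_leq (D : set V) m n x y :
  D x -> (m <= n)%N -> chain D m x y -> chain D n x y.
Proof.
move=> Dx /subnK <-; elim: (n - m)%N => // k IHk xy; rewrite addSn.
by exists y; [apply: IHk|apply: small_step_refl; apply: (chainr Dx xy)].
Qed.

Hypothesis adj_sym : forall x y, adj x y -> adj y x.
Hypothesis close_sym : forall x y, close x y -> close y x.
Hypothesis adj_close : forall x y, adj x y -> close x y.

Lemma small_step_adj (D : set V) x y : D x -> D y -> adj x y -> small_step D x y.
Proof.
move=> Dx Dy xy; exists [set x; y]; split; [by move=> z [->|->]|split|by left|by right].
  apply: (connected_from adj_sym (o := x)) => z [->|->].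
    by apply: joined_refl; left.
  by apply: joined_adj => //; [left|right].
by move=> u v [->|->] [->|->] //; [|apply: close_sym]; apply: adj_close.
Qed.

Lemma joined_chain (D : set V) x y : joined D x y -> exists n, chain D n x y.
Proof.
elim=> [Dx|u v xu [n IHn] uv Dv]; first by exists 0.
by exists n.+1; exists u => //; apply: small_step_adj => //; apply: joinedr xu.
Qed.

Lemma geodesic_exists (D : set V) x y : joined D x y ->
  exists n p K, [/\ p 0 = x, p n = y & geodesic D n p K].
Proof.
move=> xy; have Dx := joinedl xy.
have chain_ex : exists n, `[< chain D n x y >].
  by have [n xyn] := joined_chain xy; exists n; apply/asboolP.
case: (ex_minnP chain_ex) => n /asboolP xyn nmin.
have [p [K [p0 pn pK]]] := chain_small_sets xyn.
have chain_p i j : (i <= j <= n)%N -> chain D (j - i) (p i) (p j).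
  move=> /andP[/subnK <-]; rewrite addnK.
  elim: (j - i)%N => // k IHk kn; exists (p (k + i)%N); first exact/IHk/ltnW.
  by have [KD sK Kj Kj1] := pK (k + i)%N kn; exists (K (k + i)%N).
exists n, p, K; split=> //; split=> // j z jn Kz.
have [KD sK Kj Kj1] := pK _ jn; split.
  exists (p j); last by exists (K j).
  by have := chain_p 0 j; rewrite subn0; apply; rewrite leq0n ltnW.
move=> k kj; rewrite p0 => xz.
have : chain D (k.+1 + (n - j.+1)) x y.
  apply: (chain_trans (y := p j.+1)); first by exists z => //; exists (K j).
  by rewrite -pn; apply: chain_p; rewrite jn leqnn.
by move/asboolP/nmin; lia.
Qed.

End Chains.

Lemma chain_finite (V : choiceType) (adj close : V -> V -> Prop) (D : set V) n x :
  (forall y, finite_set [set z | close y z]) ->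
  finite_set [set y | chain adj close D n x y].
Proof.
move=> close_finite; elim: n => [|n IHn].
  by apply: sub_finite_set (finite_set1 x) => y /= ->.
apply: (@sub_finite_set _ _ (\bigcup_(z in [set z | chain adj close D n x z])
    [set y | close z y])); last exact: bigcup_finite.
by move=> y [z xz /small_step_close zy]; exists z.
Qed.

(** * Growing clusters by absorption *)

(* [asg x = Some (c, o)]: the vertex [x] lies in the cluster of center [o] of
   the supernode number [c]. *)
Definition assignment (V : Type) := V -> option (nat * V).

Section Assignments.
Variable V : Type.
Implicit Types asg : assignment V.

Definition extends asg asg' := forall x p, asg x = Some p -> asg' x = Some p.

Definition cluster asg c o : set V := [set x | asg x = Some (c, o)].

Lemma extends_trans asg1 asg2 asg3 :
  extends asg1 asg2 -> extends asg2 asg3 -> extends asg1 asg3.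
Proof. by move=> ext12 ext23 x p /ext12/ext23. Qed.

Lemma extends_None asg asg' x : extends asg asg' -> asg' x = None -> asg x = None.
Proof. by move=> ext; case E: (asg x) => [p|//]; rewrite (ext _ _ E). Qed.

Lemma cluster_extends asg asg' c o :
  extends asg asg' -> cluster asg c o `<=` cluster asg' c o.
Proof. by move=> ext x /ext. Qed.

Lemma extends_assigned asg asg' x p q :
  extends asg asg' -> asg x = Some q -> asg' x = Some p -> asg x = Some p.
Proof. by move=> ext xq; rewrite (ext _ _ xq) => -[<-]. Qed.

End Assignments.

Lemma extends_with (V : eqType) (asg : assignment V) x p :
  asg x = None -> extends asg [eta asg with x |-> Some p].
Proof. by move=> xN z q zq /=; case: eqP => // zx; rewrite zx xN in zq. Qed.

Section Absorption.
Variables (V : choiceType) (adj close : V -> V -> Prop).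
Hypothesis adj_sym : forall x y, adj x y -> adj y x.
Hypothesis close_refl : forall x, close x x.
Hypothesis close_sym : forall x y, close x y -> close y x.
Hypothesis adj_close : forall x y, adj x y -> close x y.
Local Notation joined := (joined adj).
Local Notation small := (small adj close).
Local Notation small_step := (small_step adj close).
Local Notation chain := (chain adj close).
Implicit Types asg : assignment V.

Variables (region : nat -> set V) (asg0 : assignment V).
Variables (eligible : V -> nat -> Prop) (radius : V -> nat -> nat) (rounds : nat).
Hypothesis cluster_joined : forall w c o,
  asg0 w = Some (c, o) -> joined (cluster asg0 c o) o w.
Hypothesis center_region : forall c o, asg0 o = Some (c, o) -> region c o.
Hypothesis candidates_finite : finite_set [set x | exists c o,
  [/\ eligible x c, asg0 o = Some (c, o) &
      chain (region c) (radius x c + 4 * rounds) o x]].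

Definition grown k asg := extends asg0 asg /\
  forall x c o, asg0 x = None -> asg x = Some (c, o) ->
  [/\ eligible x c, asg0 o = Some (c, o), chain (region c) (radius x c + 4 * k) o x &
      joined (cluster asg c o) o x].

Definition saturated k asg := forall x c o w,
  asg x = None -> eligible x c -> asg0 o = Some (c, o) -> asg w = Some (c, o) ->
  adj w x -> ~ chain (region c) (radius x c + 4 * k) o x.

(* [P] is a small set of free vertices that touches an old cluster, and [x] is
   near the centers of at most [rounds] clusters that may absorb it. *)
Record absorbable x (P : set V) : Prop := Absorbable {
  absorbable_mem : P x ;
  absorbable_small : small P ;
  absorbable_free : forall z, P z -> asg0 z = None ;
  absorbable_eligible : forall z c, P z -> eligible z c <-> eligible x c ;
  absorbable_uniform : forall z c, P z -> eligible x c ->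
    radius z c = radius x c /\ region c z ;
  absorbable_contact : exists z w c o, [/\ P z, adj z w, asg0 w = Some (c, o),
    eligible x c & chain (region c) (radius x c) o w] ;
  absorbable_few_centers : forall s : seq V, uniq s ->
    (forall o, o \in s -> exists c, [/\ asg0 o = Some (c, o), eligible x c &
       chain (region c) (radius x c + 4 * rounds + 2) o x]) -> (size s <= rounds)%N }.

Lemma center_assigned w c o : asg0 w = Some (c, o) -> asg0 o = Some (c, o).
Proof. by move/cluster_joined/joinedl. Qed.

Lemma chain_center_leq c o k l x : asg0 o = Some (c, o) -> (k <= l)%N ->
  chain (region c) k o x -> chain (region c) l o x.
Proof. by move=> oo; apply: chain_leq => //; apply: center_region. Qed.

Lemma grown_start : grown 0 asg0.
Proof. by split=> // x c o ->. Qed.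

Lemma grown_leq k l asg : (k <= l)%N -> grown k asg -> grown l asg.
Proof.
move=> kl [ext asgP]; split=> // x c o xN /(asgP _ _ _ xN)[el oo ox cx]; split=> //.
by apply: chain_center_leq ox => //; rewrite leq_add2l leq_mul2l kl orbT.
Qed.

Lemma grown_joined k asg w c o : grown k asg -> asg w = Some (c, o) ->
  joined (cluster asg c o) o w.
Proof.
move=> [ext asgP] wo; case E: (asg0 w) => [q|]; last by have [] := asgP _ _ _ E wo.
apply: joined_subset (cluster_extends ext) (cluster_joined _).
exact: extends_assigned E wo.
Qed.

Lemma grown_add k asg x c o w : grown k asg -> asg x = None -> eligible x c ->
  asg0 o = Some (c, o) -> asg w = Some (c, o) -> adj w x ->
  chain (region c) (radius x c + 4 * k) o x -> grown k [eta asg with x |-> Some (c, o)].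
Proof.
move=> gr xN el oo wo wx ox; have [ext asgP] := gr.
have ext' := extends_with (c, o) xN.
split=> [|z c' o' zN /=]; first exact: extends_trans ext'.
case: eqP => [->|_ /(asgP _ _ _ zN)[el' oo' oz cz]]; last first.
  by split=> //; apply: joined_subset cz; apply: cluster_extends.
move=> -[<- <-]; split=> //; apply: (joined_step (y := w)) => //; last by rewrite /cluster /= eqxx.
apply: joined_subset (cluster_extends ext') _; exact: grown_joined gr wo.
Qed.

Lemma saturation k asg : (k <= rounds)%N -> grown k asg ->
  exists asg', [/\ extends asg asg', grown k asg' & saturated k asg'].
Proof.
move=> k_rounds; have /finite_seqP[s sE] := candidates_finite.
have [n] := ubnP (count (fun x => asg x == None) s).
elim: n asg => // n IHn asg free_lt gr.
case: (pselect (saturated k asg)) => [|/existsNP[x]]; first by exists asg; split=> // x p.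
move=> /existsNP[c] /existsNP[ o] /existsNP[w].
move=> /not_implyP[xN /not_implyP[el /not_implyP[oo /not_implyP[wo /not_implyP[wx]]]]].
move=> /contrapT ox; have := grown_add gr xN el oo wo wx ox.
set asg' := [eta _ with _ |-> _] => gr'; have ext' : extends asg asg' by apply: extends_with.
have [|//|asg2 [ext2 gr2 sat2]] := IHn asg'; last first.
  by exists asg2; split=> //; apply: extends_trans ext' ext2.
rewrite -ltnS; apply: leq_trans free_lt; rewrite ltnS.
have xs : x \in s.
  suff : [set` s] x by [].
  rewrite -sE; exists c, o; split=> //; apply: chain_center_leq ox => //.
  by rewrite leq_add2l leq_mul2l k_rounds orbT.
have /permP count_s := perm_to_rem xs.
rewrite !count_s /= xN !eqxx /= add0n add1n ltnS.
by apply: sub_count => z /=; case: (z =P x).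
Qed.

Lemma saturated_tower : exists F : nat -> assignment V,
  [/\ forall j, (j <= rounds)%N -> grown j (F j),
      forall i j, (i <= j <= rounds)%N -> extends (F i) (F j) &
      forall j, (j <= rounds)%N -> saturated j (F j)].
Proof.
have /choice[next nextP] : forall s : nat * assignment V, exists asg',
    (s.1 <= rounds)%N -> grown s.1 s.2 ->
    [/\ extends s.2 asg', grown s.1 asg' & saturated s.1 asg'].
  move=> [k asg] /=; case: (pselect ((k <= rounds)%N /\ grown k asg)) => [[kr gr]|ngr].
    by have [asg' asg'P] := saturation kr gr; exists asg'.
  by exists asg => kr gr; case: ngr.
pose F := fix F k := next (k, if k is k'.+1 then F k' else asg0).
have grF k : (k <= rounds)%N -> grown k (F k).
  elim: k => [|k IHk] kr; first by have [] := nextP (0, asg0) kr grown_start.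
  by have [] := nextP (k.+1, F k) kr (grown_leq (leqnSn k) (IHk (ltnW kr))).
have stepF k : (k < rounds)%N -> extends (F k) (F k.+1).
  by move=> kr; have [] := nextP (k.+1, F k) kr (grown_leq (leqnSn k) (grF _ (ltnW kr))).
exists F; split=> [//|i j /andP[/subnKC<-]|[|k] kr].
- elim: (j - i)%N => [|k IHk]; first by rewrite addn0 => _ x.
  by rewrite addnS => kr; apply: extends_trans (IHk (ltnW kr)) (stepF _ kr).
- by have [] := nextP (0, asg0) kr grown_start.
- by have [] := nextP (k.+1, F k) kr (grown_leq (leqnSn k) (grF _ (ltnW kr))).
Qed.

Lemma boundary_exists k asg x P : grown k asg -> absorbable x P -> asg x = None ->
  exists w' w c o, [/\ P w', asg w' = None, adj w w', asg w = Some (c, o) &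
    [/\ eligible x c, asg0 o = Some (c, o) &
        chain (region c) (radius x c + 4 * k) o w]].
Proof.
move=> [ext asgP] absP xN; have Px := absorbable_mem absP.
have [z [w [c [ o [Pz zw wo el ow]]]]] := absorbable_contact absP.
have [zN|za] := pselect (asg z = None).
  exists z, w, c, o; split=> //; [exact: adj_sym|exact: ext|split=> //].
    exact: center_assigned wo.
  by apply: chain_center_leq ow; [exact: center_assigned wo|exact: leq_addr].
have [conP _] := absorbable_small absP.
have xT : ~ [set t | asg t <> None] x by rewrite /= xN.
have [w' [u [cw' w'u Pu /=]]] := joined_exit adj_sym (conP _ _ Px Pz) xT za.
case Eu: (asg u) => [[c' o']|//] _.
have [el' oo' ou _] := asgP _ _ _ (absorbable_free absP Pu) Eu.
have elx := (absorbable_eligible absP c' Pu).1 el'.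
have [Pw' nw'] := joinedr cw'.
exists w', u, c', o'; split=> //; [exact: contrapT|exact: adj_sym|split=> //].
by have [<-] := absorbable_uniform absP Pu elx.
Qed.

Lemma center_at_distance k asg x P : grown k asg -> saturated k asg ->
  absorbable x P -> asg x = None ->
  exists o c, [/\ asg0 o = Some (c, o), eligible x c,
    chain (region c) (radius x c + 4 * k + 2) o x &
    forall r, (r < radius x c + 4 * k)%N -> ~ chain (region c) r o x].
Proof.
move=> gr sat absP xN.
have [w' [w [c [ o [Pw' w'N ww' wo [el oo ow]]]]]] := boundary_exists gr absP xN.
have [radE Dw'] := absorbable_uniform absP Pw' el.
have far_w' : ~ chain (region c) (radius x c + 4 * k) o w'.
  rewrite -radE; apply: sat wo ww' => //.
  exact/(absorbable_eligible absP c Pw').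
have Do := center_region oo.
have w'x : small_step (region c) w' x.
  exists P; split=> //; [|exact: absorbable_small absP|exact: absorbable_mem absP].
  by move=> z Pz; have [] := absorbable_uniform absP Pz el.
exists o, c; split=> // [|r r_lt ox].
  by rewrite addn2; exists w' => //; exists w => //; apply: small_step_adj => //; apply: chainr ow.
apply: far_w'; apply: (@chain_leq _ _ _ close_refl _ r.+1) => //.
by exists x => //; apply: small_step_sym.
Qed.

(* If [x] stayed free through all the rounds, the centers found at the successive
   levels, being at distinct distances from [x], would be too numerous. *)
Lemma absorption : exists asg', grown rounds asg' /\
  forall x P, absorbable x P -> asg' x <> None.
Proof.
have [F [grF extF satF]] := saturated_tower.
exists (F rounds); split=> [|x P absP xN]; first exact: grF.
have /choice[center centerP] : forall j, exists o, (j <= rounds)%N -> exists c,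
    [/\ asg0 o = Some (c, o), eligible x c,
    chain (region c) (radius x c + 4 * j + 2) o x &
    forall r, (r < radius x c + 4 * j)%N -> ~ chain (region c) r o x].
  move=> j; case: (leqP j rounds) => jr; last by exists x.
  have xjN : F j x = None by apply: extends_None xN; apply: extF; rewrite jr leqnn.
  have [ o [c oP]] := center_at_distance (grF _ jr) (satF _ jr) absP xjN.
  by exists o => _; exists c.
have center_inj : {in iota 0 rounds.+1 &, injective center}.
  move=> i j; rewrite !mem_iota !add0n !ltnS /= => ir jr cij.
  wlog ij : i j ir jr cij / (i < j)%N => [W|].
    by case: (ltngtP i j) => // ij; [apply: W|symmetry; apply: W].
  have [c [oi _ near_i _]] := centerP _ ir; have [c' [oj _ _ far_j]] := centerP _ jr.
  move: oj; rewrite -cij oi => -[cE]; rewrite -cE -cij in far_j.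
  by case: (far_j (radius x c + 4 * i + 2)%N) => //; lia.
have : (size [seq center j | j <- iota 0 rounds.+1] <= rounds)%N.
  apply: (absorbable_few_centers absP) => [|o /mapP[j]].
    by rewrite map_inj_in_uniq ?iota_uniq.
  rewrite mem_iota add0n ltnS => /= jr ->; have [c [oo el ox _]] := centerP _ jr.
  by exists c; split=> //; apply: chain_center_leq ox => //; lia.
by rewrite size_map size_iota ltnn.
Qed.

End Absorption.

(** * Hops between clusters *)

Section Hops.
Variables (V : choiceType) (adj : V -> V -> Prop) (center : V -> V).
Hypothesis adj_sym : forall x y, adj x y -> adj y x.

Definition touch x y := center x = center y \/
  exists x' y', [/\ center x' = center x, center y' = center y & adj x' y'].

Fixpoint hops n x y :=
  if n is n'.+1 then exists2 z, hops n' x z & touch z y else center x = center y.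

Fixpoint crossing_bound l k := if k is k'.+1 then (crossing_bound l k').*2.+2 else l.

Lemma touch_sym x y : touch x y -> touch y x.
Proof.
move=> [xy|[x' [y' [xx' yy' xy']]]]; first by left.
by right; exists y', x'; split=> //; apply: adj_sym.
Qed.

Lemma touch_adj x y : adj x y -> touch x y.
Proof. by right; exists x, y. Qed.

Lemma hops1 x y : touch x y -> hops 1 x y.
Proof. by exists x. Qed.

Lemma hops_trans m n x y z : hops m x y -> hops n y z -> hops (m + n) x z.
Proof.
move=> xy; elim: n z => [z yz|n IHn z [t /IHn yt tz]]; last by rewrite addnS; exists t.
rewrite addn0; case: m xy => [/= ->//|m [t xt ty]]; exists t => //.
case: ty => [ty|[t' [y' [tt' yy' ty']]]]; first by left; rewrite ty.
by right; exists t', y'; rewrite -yz.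
Qed.

Lemma hops_sym n x y : hops n x y -> hops n y x.
Proof.
elim: n y => [y //|n IHn y [z /IHn xz /touch_sym/hops1 zy]].
exact: hops_trans zy xz.
Qed.

Lemma hops_leq m n x y : (m <= n)%N -> hops m x y -> hops n x y.
Proof.
move=> /subnKC <- xy; apply: hops_trans xy _.
by elim: (n - m)%N => // k IHk; exists y => //; left.
Qed.

Lemma leq_crossing_bound l j k :
  (j <= k)%N -> (crossing_bound l j <= crossing_bound l k)%N.
Proof.
move=> /subnKC <-; elim: (k - j)%N => [|d IHd]; first by rewrite addn0.
by rewrite addnS /= -addnn; lia.
Qed.

(* Each cluster of [S] need be crossed at most once, between its first and its
   last visit. *)
Lemma hops_crossing (P S : set V) l (cs : seq V) x y :
  (forall a b, joined adj (P `\` S) a b -> hops l a b) ->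
  joined adj (P `&` [set z | S z -> center z \in cs]) x y ->
  hops (crossing_bound l (size cs)) x y.
Proof.
move=> base; elim: cs x y => [|o cs IHcs] x y xy.
  by apply: base; apply: joined_subset xy => z [Pz /= zS]; split=> // /zS.
have avoid a b :
    joined adj ((P `&` [set z | S z -> center z \in o :: cs]) `\` [set z | center z = o]) a b ->
    hops (crossing_bound l (size cs)) a b.
  move=> ab; apply: IHcs; apply: joined_subset ab => z [[Pz /= zS] zo]; split=> // /zS.
  by rewrite inE => /orP[/eqP|].
case: (joined_avoid_or_hit adj_sym [set z | center z = o] xy) => [/avoid|].
  by apply: hops_leq; exact: (leq_crossing_bound l (leqnSn (size cs))).
have hit z t : first_hit adj (P `&` [set z | S z -> center z \in o :: cs])
      [set z | center z = o] z t -> hops (crossing_bound l (size cs)).+1 z t.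
  move=> [->|[z' zz' z't]]; first exact: (@hops_leq 0).
  by exists z'; [exact: avoid|exact: touch_adj].
move=> [t [t' [[_ to] [_ t'o] /hit xt /hit yt']]].
have {}yt' : hops (crossing_bound l (size cs)).+1 t y.
  by apply: hops_trans (_ : hops 0 t t') (hops_sym yt'); rewrite /= to t'o.
by have := hops_trans xt yt'; rewrite addSn addnS addnn.
Qed.

End Hops.

(** * Supernodes *)

Lemma sub_in_count (T : eqType) (p q : pred T) (s : seq T) :
  {in s, forall x, p x -> q x} -> (count p s <= count q s)%N.
Proof.
elim: s => //= x s IHs pq; apply: leq_add; last first.
  by apply: IHs => y ys; apply: pq; rewrite inE ys orbT.
by have := pq x (mem_head x s); case: (p x) (q x) => [] [] // /(_ isT).
Qed.

Lemma ltn_in_count (T : eqType) (p q : pred T) (s : seq T) x :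
  {in s, forall y, p y -> q y} -> x \in s -> q x -> ~~ p x -> (count p s < count q s)%N.
Proof.
move=> pq xs qx /negbTE px; have /permP count_s := perm_to_rem xs.
rewrite !count_s /= px qx add0n add1n ltnS; apply: sub_in_count => y /mem_rem.
exact: pq.
Qed.

Lemma size_by_color (T : eqType) (color : T -> nat) (l : seq nat) (m : nat) (s : seq T) :
  (forall x, x \in s -> color x \in l) ->
  (forall c, c \in l -> (count (fun x => color x == c) s <= m)%N) ->
  (size s <= size l * m)%N.
Proof.
elim: l s => [|c l IHl] s color_l count_le.
  by case: s color_l {count_le} => // x s /(_ x); rewrite mem_head => /(_ isT).
rewrite -(count_predC (fun x => color x == c)) /= mulSn leq_add ?count_le ?mem_head //.
rewrite -size_filter; apply: IHl => [x|d dl].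
  by rewrite mem_filter => /andP[/= /negPf cx /color_l]; rewrite inE cx.
rewrite count_filter; apply: leq_trans (count_le d _); last by rewrite inE dl orbT.
by apply: sub_count => x /= /andP[].
Qed.

Lemma size_window (s : seq nat) d : uniq s ->
  (forall a b, a \in s -> b \in s -> (b <= a + d)%N) -> (size s <= d.+1)%N.
Proof.
case: s => // a0 s us window.
have ex : exists a, a \in a0 :: s by exists a0; apply: mem_head.
case: (ex_minnP ex) => a aP amin; rewrite -(size_iota a d.+1).
apply: uniq_leq_size => // b bs; rewrite mem_iota amin //= addnS ltnS.
exact: window.
Qed.

Section Supernodes.
Variables (V : countType) (adj close : V -> V -> Prop).
Hypothesis adj_sym : forall x y, adj x y -> adj y x.
Hypothesis close_refl : forall x, close x x.
Hypothesis close_sym : forall x y, close x y -> close y x.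
Hypothesis adj_close : forall x y, adj x y -> close x y.
Hypothesis close_finite : forall x, finite_set [set y | close x y].
Hypothesis no_K5 : K5_minor_free adj.
Local Notation joined := (joined adj).
Local Notation connected_set := (connected_set adj).
Local Notation small := (small adj close).
Local Notation small_step := (small_step adj close).
Local Notation chain := (chain adj close).

(* The spacing of the centers on a skeleton dominates the total growth of a
   cluster, which is what keeps the number of centers near a point below
   [max_centers] while the rounds of absorption take place. *)
Variables (max_centers rounds growth spacing : nat).
Hypothesis max_centers_ge : (22 <= max_centers)%N.
Hypothesis rounds_ge : (3 * max_centers <= rounds)%N.
Hypothesis growth_ge : (4 * rounds + 4 <= growth)%N.
Hypothesis spacing_ge : (4 * growth <= spacing)%N.

Definition reach g := (2 * spacing + g * growth)%N.

Local Notation assignment := (assignment V).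
Implicit Types (asg : assignment) (region : nat -> set V).

Definition unassigned asg : set V := [set x | asg x = None].

Definition supernode asg i : set V := [set x | exists o, asg x = Some (i, o)].

Definition not_older asg i : set V :=
  [set x | forall j o, asg x = Some (j, o) -> (i <= j)%N].

Definition sees asg i u :=
  exists x y, [/\ supernode asg i x, adj x y & joined (unassigned asg) u y].

Definition territory asg i : set V :=
  [set x | supernode asg i x \/ unassigned asg x /\ sees asg i x].

Definition nears asg region i u := region i u /\ exists x y,
  [/\ territory asg i x, joined (unassigned asg) u y &
      small_step (region i `&` not_older asg i) x y].

Definition near_count asg region c u :=
  count (fun i => `[< nears asg region i u >]) (iota 0 c).

(* A partial partition into the supernodes of index below [n], each made of
   connected clusters; [region i] is the component that was free when the
   supernode [i] was created. *)
Record decomposition n asg region : Prop := Decomposition {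
  assigned_spec : forall x i o, asg x = Some (i, o) ->
    [/\ (i < n)%N, region i x, asg o = Some (i, o), joined (cluster asg i o) o x &
        chain (region i) (reach 3) o x] ;
  assigned_finite : finite_set [set x | asg x <> None] ;
  supernode_connected : forall i, connected_set (supernode asg i) ;
  region_closed : forall i x y,
    (i < n)%N -> region i x -> adj x y -> not_older asg i y -> region i y ;
  centers_bounded : forall i x (s : seq V), uniq s ->
    (forall o, o \in s -> asg o = Some (i, o) /\ chain (region i) (reach 4) o x) ->
    (size s <= max_centers)%N ;
  supernodes_adjacent : forall i j u, (i < j)%N -> sees asg i u -> sees asg j u ->
    exists x y, [/\ supernode asg i x, supernode asg j y & adj x y] ;
  contact_chain : forall u c y o y', asg y = Some (c, o) -> adj y y' ->
    joined (unassigned asg) u y' ->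
    chain (region c) (reach (3 - near_count asg region c u)) o y ;
  near_count_le3 : forall u c,
    unassigned asg u -> (c < n)%N -> (near_count asg region c u <= 3)%N }.

Definition buffered n asg region := decomposition n asg region /\
  forall i u, (i < n)%N -> unassigned asg u -> nears asg region i u -> sees asg i u.

Lemma leq_reach g h : (g <= h)%N -> (reach g <= reach h)%N.
Proof. by rewrite /reach => gh; rewrite leq_add2l leq_mul2r gh orbT. Qed.

Lemma unassigned_not_older asg i : unassigned asg `<=` not_older asg i.
Proof. by move=> x xN j o; rewrite (xN : asg x = None). Qed.

Lemma supernode_assigned asg i x : supernode asg i x -> unassigned asg x -> False.
Proof. by move=> [ o xo] /=; rewrite /unassigned /= xo. Qed.

Lemma cluster_supernode asg i o : cluster asg i o `<=` supernode asg i.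
Proof. by move=> x xo; exists o. Qed.

Lemma sees_joined asg i u v : joined (unassigned asg) u v -> sees asg i u -> sees asg i v.
Proof.
move=> uv [x [y [ix xy uy]]]; exists x, y; split=> //.
by apply: joined_trans uy; apply: joined_sym.
Qed.

Lemma near_count_gt0 asg region c i u :
  (i < c)%N -> nears asg region i u -> (0 < near_count asg region c u)%N.
Proof.
move=> ic iu; rewrite /near_count -has_count; apply/hasP; exists i; last exact/asboolP.
by rewrite mem_iota add0n ic.
Qed.

Lemma near_count_succ asg region c u :
  (near_count asg region c.+1 u <= (near_count asg region c u).+1)%N.
Proof.
rewrite /near_count -[c.+1]addn1 iotaD count_cat -[leqRHS]addn1 leq_add2l /= addn0.
exact: leq_b1.
Qed.

Section DecompositionTheory.
Variables (n : nat) (asg : assignment) (region : nat -> set V).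
Hypothesis dec : decomposition n asg region.

Lemma supernode_lt i x : supernode asg i x -> (i < n)%N.
Proof. by move=> [ o /(assigned_spec dec)[]]. Qed.

Lemma supernode_region i x : supernode asg i x -> region i x.
Proof. by move=> [ o /(assigned_spec dec)[]]. Qed.

Lemma sees_lt i u : sees asg i u -> (i < n)%N.
Proof. by move=> [x [y [/supernode_lt]]]. Qed.

Lemma center_region i o : asg o = Some (i, o) -> region i o.
Proof. by move/(assigned_spec dec)=> []. Qed.

Lemma assigned_joined x i o : asg x = Some (i, o) -> joined (cluster asg i o) o x.
Proof. by move/(assigned_spec dec)=> []. Qed.

Lemma chain_leq_center i o k l x : asg o = Some (i, o) -> (k <= l)%N ->
  chain (region i) k o x -> chain (region i) l o x.
Proof. by move=> oo; apply: chain_leq => //; apply: center_region. Qed.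

Lemma region_joined i u v :
  (i < n)%N -> joined (unassigned asg) u v -> region i u -> region i v.
Proof.
move=> ni uv Ru; elim: uv => // y z _ Ry yz uz.
exact: (region_closed dec ni Ry yz (unassigned_not_older _ uz)).
Qed.

Lemma sees_region i u : sees asg i u -> region i u.
Proof.
move=> iu; have ni := sees_lt iu; move: iu => [x [y [ix xy uy]]].
apply: (region_joined ni (joined_sym adj_sym uy)).
apply: (region_closed dec ni (supernode_region ix) xy).
by apply: unassigned_not_older; apply: joinedr uy.
Qed.

Lemma nears_joined i u v : (i < n)%N -> joined (unassigned asg) u v ->
  nears asg region i u -> nears asg region i v.
Proof.
move=> ni uv [Ru [x [y [ix uy xy]]]]; split; first exact: region_joined uv Ru.
by exists x, y; split=> //; apply: joined_trans uy; apply: joined_sym.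
Qed.

Lemma near_count_joined c u v : (c <= n)%N -> joined (unassigned asg) u v ->
  near_count asg region c u = near_count asg region c v.
Proof.
move=> cn uv; apply: eq_in_count => i; rewrite mem_iota add0n => /= ic.
have ni := leq_trans ic cn; apply: asbool_equiv_eq; split; apply: nears_joined => //.
exact: joined_sym.
Qed.

(* Four supernodes seen from one component would make up a K5 with it. *)
Lemma sees_le3 u (s : seq nat) : unassigned asg u -> uniq s ->
  (forall i, i \in s -> sees asg i u) -> (size s <= 3)%N.
Proof.
move=> uN us sP; rewrite leqNgt; apply/negP => s4.
have nthP i : (i < 4)%N -> sees asg (nth 0 s i) u.
  by move=> i4; apply/sP/mem_nth/(leq_trans i4).
have nth_neq i j : (i < j < 4)%N -> nth 0 s i <> nth 0 s j.
  move=> /andP[ij j4] /eqP; have [is_ js] : (i < size s)%N /\ (j < size s)%N by lia.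
  by rewrite nth_uniq // => /eqP; lia.
apply: no_K5; exists (fun i => if (i < 4)%N then supernode asg (nth 0 s i)
                               else joined (unassigned asg) u); split.
- move=> i _; case: ifP => _; first exact: (supernode_connected dec).
  exact: connected_component_set.
- move=> i j x /andP[ij j5]; have -> : (i < 4)%N by lia.
  case: ifP => [j4|_] ix; last by move/joinedr; apply: supernode_assigned ix.
  move: ix => [ o xo] [ o']; rewrite xo => -[E _].
  by apply: (nth_neq i j) => //; rewrite ij.
- move=> i j /andP[ij j5]; have i4 : (i < 4)%N by lia.
  rewrite i4; case: ifP => [j4|_]; last first.
    by have [x [y [ix xy uy]]] := nthP _ i4; exists x, y.
  have := nth_neq i j; rewrite ij j4 => /(_ isT).
  case: (ltngtP (nth 0 s i) (nth 0 s j)) => // lt _.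
    exact: (supernodes_adjacent dec lt (nthP _ i4) (nthP _ j4)).
  have [x [y [jx iy xy]]] := supernodes_adjacent dec lt (nthP _ j4) (nthP _ i4).
  by exists y, x; split=> //; apply: adj_sym.
Qed.

Lemma centers_seen_bounded u (s : seq V) : unassigned asg u -> uniq s ->
  (forall o, o \in s -> exists c,
     [/\ asg o = Some (c, o), sees asg c u & chain (region c) (reach 4) o u]) ->
  (size s <= 3 * max_centers)%N.
Proof.
move=> uN us sP; pose index o := if asg o is Some (c, _) then c else 0.
have : (size s <= size (undup (map index s)) * max_centers)%N.
  apply: (@size_by_color _ index) => [x xs|c]; first by rewrite mem_undup map_f.
  rewrite mem_undup => /mapP[ o0 _ cE]; rewrite -size_filter.
  apply: (centers_bounded dec (i := c) (x := u)); first exact: filter_uniq.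
  move=> o; rewrite mem_filter => /andP[/eqP oc os].
  by have [c' [oo _ ou]] := sP _ os; move: oc; rewrite /index oo => <-.
suff /leq_mul h : (size (undup (map index s)) <= 3)%N by move/leq_trans; apply; exact: h.
apply: (sees_le3 uN); first exact: undup_uniq.
move=> c; rewrite mem_undup => /mapP[ o os ->].
by have [c' [oo sc _]] := sP _ os; rewrite /index oo.
Qed.

End DecompositionTheory.

Section Extension.
Variables (n : nat) (asg asg' : assignment) (region region' : nat -> set V).
Hypothesis ext : extends asg asg'.

Lemma unassigned_extends : unassigned asg' `<=` unassigned asg.
Proof. by move=> x; apply: extends_None. Qed.

Lemma supernode_extends i : supernode asg i `<=` supernode asg' i.
Proof. by move=> x [ o /ext]; exists o. Qed.

Lemma not_older_extends i : not_older asg' i `<=` not_older asg i.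
Proof. by move=> x older j o /ext/older. Qed.

Hypothesis ext_territory :
  forall i x, (i < n)%N -> supernode asg' i x -> territory asg i x.
Hypothesis regionE : forall i, (i < n)%N -> region' i = region i.

Lemma sees_extends i u : (i < n)%N -> sees asg' i u -> sees asg i u.
Proof.
move=> ni [x [y [ix xy uy]]]; have uy' := joined_subset unassigned_extends uy.
case: (ext_territory ni ix) => [ix'|[xN xs]]; first by exists x, y.
apply: sees_joined xs; apply: joined_trans (joined_sym adj_sym uy').
by apply: joined_adj => //; apply: joinedr uy'.
Qed.

Lemma territory_extends i : (i < n)%N -> territory asg' i `<=` territory asg i.
Proof.
move=> ni x [/(ext_territory ni)//|[xN xs]]; right.
by split; [apply: unassigned_extends|apply: sees_extends].
Qed.

Lemma nears_extends i u : (i < n)%N -> nears asg' region' i u -> nears asg region i u.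
Proof.
move=> ni [Ru [x [y [ix uy xy]]]]; rewrite /nears -regionE //; split=> //.
exists x, y; split; [exact: territory_extends|exact: joined_subset unassigned_extends uy|].
by apply: small_step_subset xy => z [Rz oz]; split=> //; apply: not_older_extends.
Qed.

Lemma near_count_extends c u :
  (c <= n)%N -> (near_count asg' region' c u <= near_count asg region c u)%N.
Proof.
move=> cn; apply: sub_in_count => i; rewrite mem_iota add0n => /= ic.
by move=> /asboolP near_i; apply/asboolP; apply: nears_extends near_i; apply: leq_trans ic cn.
Qed.

End Extension.

(* One growth round: in every component which is close to the territory of some
   supernode without touching it, the vertices close to that territory are
   absorbed by the younger supernodes that the component sees. *)
Section GrowthRound.
Variables (n : nat) (asg : assignment) (region : nat -> set V).
Hypothesis dec : decomposition n asg region.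

Definition detached u : set nat :=
  [set i | [/\ (i < n)%N, nears asg region i u & ~ sees asg i u]].

Definition detached_index u := xget 0 (detached u).

Definition eligible x c := [/\ unassigned asg x, detached x !=set0,
  (detached_index x < c)%N & sees asg c x].

Definition contact_reach x c := reach (3 - near_count asg region c x).

Lemma detached_joined u v : joined (unassigned asg) u v -> detached u = detached v.
Proof.
move=> uv; have vu := joined_sym adj_sym uv.
apply/seteqP; split=> i [ni near_i unseen_i]; split=> //.
- exact: (nears_joined dec ni uv near_i).
- by move/(sees_joined vu).
- exact: (nears_joined dec ni vu near_i).
- by move/(sees_joined uv).
Qed.

Lemma detached_indexP u : detached u !=set0 -> detached u (detached_index u).
Proof. exact: xgetPex. Qed.

Lemma eligible_joined x z c : joined (unassigned asg) x z -> eligible x c ->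
  [/\ eligible z c, contact_reach z c = contact_reach x c & region c z].
Proof.
move=> xz [xN dx xc sc]; have cn := sees_lt dec sc.
rewrite /contact_reach (near_count_joined dec (ltnW cn) xz); split=> //.
  split; [exact: joinedr xz|by rewrite -(detached_joined xz)| |exact: sees_joined sc].
  by rewrite /detached_index -(detached_joined xz).
by apply: (sees_region dec); apply: sees_joined sc.
Qed.

Lemma contact_reach_le x c : (contact_reach x c <= reach 3)%N.
Proof. by apply: leq_reach; lia. Qed.

Lemma growth_candidates_finite : finite_set [set x | exists c o,
  [/\ eligible x c, asg o = Some (c, o) &
      chain (region c) (contact_reach x c + 4 * rounds) o x]].
Proof.
apply: (@sub_finite_set _ _ (\bigcup_(o in [set o | asg o <> None])
   \bigcup_(c in `I_n) [set x | chain (region c) (reach 3 + 4 * rounds) o x])).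
  move=> x [c [ o [_ oo ox]]]; exists o; first by rewrite /= oo.
  have [cn _ _ _ _] := assigned_spec dec oo.
  by exists c => //=; apply: (chain_leq_center dec oo _ ox); rewrite leq_add2r contact_reach_le.
apply: bigcup_finite => [|o _]; first exact: (assigned_finite dec).
by apply: bigcup_finite => [|c _]; [exact: finite_II|exact: chain_finite].
Qed.

Variable asg' : assignment.
Hypothesis asg'_grown : grown adj close region asg eligible contact_reach rounds asg'.
Hypothesis asg'_absorbs : forall x P,
  absorbable adj close region asg eligible contact_reach rounds x P -> asg' x <> None.

Let ext : extends asg asg' := asg'_grown.1.

Lemma grown_territory i x : supernode asg' i x -> territory asg i x.
Proof.
move=> [ o xo]; case E: (asg x) => [q|].
  by left; exists o; exact: extends_assigned E xo.
by right; split=> //; have [[_ _ _ si] _ _ _] := asg'_grown.2 _ _ _ E xo.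
Qed.

Let ext_territory i x (_ : (i < n)%N) := @grown_territory i x.

Lemma near_count_grown_le u c : (c <= n)%N ->
  (near_count asg' region c u <= near_count asg region c u)%N.
Proof. exact: near_count_extends. Qed.

Lemma grown_sees_lt i u : sees asg' i u -> (i < n)%N.
Proof. by move=> [x [y [/grown_territory[/(supernode_lt dec)//|[_ /(sees_lt dec)]]]]]. Qed.

Lemma grown_joined_extends u v :
  joined (unassigned asg') u v -> joined (unassigned asg) u v.
Proof. by apply: joined_subset; apply: unassigned_extends. Qed.

Lemma component_absorbable i y a L : unassigned asg y -> detached y i ->
  detached_index y = i -> small L -> L `<=` region i `&` not_older asg' i ->
  L y -> L a -> territory asg i a ->
  absorbable adj close region asg eligible contact_reach rounds y
    (joined (L `&` unassigned asg) y).
Proof.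
move=> yN dyi iE sL LW Ly La ta; pose P := joined (L `&` unassigned asg) y.
have PL z : P z -> L z /\ unassigned asg z by move/joinedr.
have P_joined z : P z -> joined (unassigned asg) y z by apply: joined_subset => t [].
have [ni _ unseen] := dyi.
split.
- exact: joined_refl.
- by apply: small_subset sL _ _; [move=> z /PL[]|apply: connected_component_set].
- by move=> z /PL[].
- move=> z c /P_joined yz; split; last by case/(eligible_joined yz).
  by case/(eligible_joined (joined_sym adj_sym yz)).
- by move=> z c /P_joined yz /(eligible_joined yz)[_ ].
- case: (joined_avoid_or_hit adj_sym [set z | asg z <> None] (sL.1 _ _ Ly La)).
    move=> ya; have {}ya : joined (unassigned asg) y a.
      by apply: joined_subset ya => z [_ /= /contrapT].
    case: unseen; case: ta => [ia|[_ ia]]; last by apply: sees_joined ia; apply: joined_sym.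
    by case: (supernode_assigned ia (joinedr ya)).
  move=> [t [_ [[Lt ta'] _ hit_t _]]]; case Et: (asg t) ta' => [[c o]|//] _.
  case: hit_t => [yt|[x' yx' x't]]; first by move: yN; rewrite /unassigned /= yt Et.
  have {}yx' : P x' by apply: joined_subset yx' => z [Lz /= /contrapT].
  have sc : sees asg c y.
    by exists t, x'; split; [exists o|exact: adj_sym|exact: P_joined].
  have [_ /(_ c o (ext Et))] := LW _ Lt.
  rewrite leq_eqVlt => /orP[/eqP ic|ic]; first by case: unseen; rewrite ic.
  exists x', t, c, o; split=> //; first by split=> //; [exists i|rewrite iE].
  exact: (contact_chain dec Et (adj_sym x't) (P_joined _ yx')).
- move=> s us sP; apply: leq_trans rounds_ge.
  apply: (centers_seen_bounded dec yN us) => o /sP[c [oo [_ _ _ sc] oy]].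
  exists c; split=> //; apply: (chain_leq_center dec oo _ oy).
  by have := contact_reach_le y c; rewrite /reach; lia.
Qed.

Lemma detached_index_not_nears u : unassigned asg' u -> detached u !=set0 ->
  ~ nears asg' region (detached_index u) u.
Proof.
move=> uN du [Ru [a [y [ta uy [L [LW sL La Ly]]]]]].
have uy' := grown_joined_extends uy; have yN := unassigned_extends ext (joinedr uy).
have iE : detached_index u = detached_index y by rewrite /detached_index (detached_joined uy').
have dy : detached y !=set0 by rewrite -(detached_joined uy').
have dyi := detached_indexP dy; have [ni _ _] := dyi; rewrite iE in ta LW.
have := territory_extends ext ext_territory ni ta => ta'.
exact: asg'_absorbs (component_absorbable yN dyi erefl sL LW Ly La ta') (joinedr uy).
Qed.

Lemma near_count_grown u c : unassigned asg' u -> detached u !=set0 ->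
  (detached_index u < c <= n)%N ->
  (near_count asg' region c u < near_count asg region c u)%N.
Proof.
move=> uN du /andP[ic cn]; have [_ near_u _] := detached_indexP du.
apply: (@ltn_in_count _ _ _ _ (detached_index u)).
- move=> i; rewrite mem_iota add0n => /= ic' /asboolP near_i; apply/asboolP.
  by apply: (nears_extends ext ext_territory _ _ near_i) => //; apply: leq_trans ic' cn.
- by rewrite mem_iota add0n ic.
- exact/asboolP.
- by apply/asboolP; apply: detached_index_not_nears.
Qed.

Lemma grown_assigned_spec x i o : asg' x = Some (i, o) ->
  [/\ (i < n)%N, region i x, asg' o = Some (i, o), joined (cluster asg' i o) o x &
      chain (region i) (reach 3) o x].
Proof.
move=> xo; case E: (asg x) => [q|].
  have [ni Rx oo cx ox] := assigned_spec dec (extends_assigned ext E xo).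
  by split=> //; [exact: ext|apply: joined_subset cx; apply: cluster_extends].
have [[xN dx ix si] oo ox cx] := asg'_grown.2 _ _ _ E xo.
split=> //; [exact: (sees_lt dec si)|exact: (sees_region dec si)|exact: ext|].
have [_ near_x _] := detached_indexP dx.
apply: (chain_leq_center dec oo _ ox); have := near_count_gt0 ix near_x.
by rewrite /contact_reach /reach; nia.
Qed.

Lemma grown_assigned_finite : finite_set [set x | asg' x <> None].
Proof.
have := growth_candidates_finite; set candidates := [set x | _] => cand_finite.
apply: (@sub_finite_set _ _ ([set x | asg x <> None] `|` candidates)).
  move=> x /=; case E: (asg x) => [p|] xa; [by left|right].
  case E': (asg' x) xa => [[c o]|//] _.
  by have [el oo ox _] := asg'_grown.2 _ _ _ E E'; exists c, o.
by rewrite finite_setU; split=> //; exact: (assigned_finite dec).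
Qed.

Lemma grown_supernode_connected i : connected_set (supernode asg' i).
Proof.
have to_center z o : asg' z = Some (i, o) ->
    asg o = Some (i, o) /\ joined (supernode asg' i) o z.
  move=> zo; have [_ _ _ cz _] := grown_assigned_spec zo.
  split; last by apply: joined_subset cz; exact: cluster_supernode.
  case E: (asg z) => [q|]; last by have [_ oo _ _] := asg'_grown.2 _ _ _ E zo.
  by have [] := assigned_spec dec (extends_assigned ext E zo).
move=> x y [ o /to_center[oo ox]] [ o' /to_center[oo' oy]].
apply: joined_trans (joined_sym adj_sym ox) _; apply: joined_trans oy.
apply: joined_subset (supernode_extends ext (i := i)) _.
by apply: (supernode_connected dec); [exists o|exists o'].
Qed.

Lemma grown_center i o : asg' o = Some (i, o) -> asg o = Some (i, o).
Proof.
move=> oo; case E: (asg o) => [q|]; first by rewrite -E; exact: extends_assigned E oo.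
by have [_ oo' _ _] := asg'_grown.2 _ _ _ E oo; rewrite E in oo'.
Qed.

Lemma grown_contact_chain u c y o y' : asg' y = Some (c, o) -> adj y y' ->
  joined (unassigned asg') u y' ->
  chain (region c) (reach (3 - near_count asg' region c u)) o y.
Proof.
move=> yo yy' uy'; have uN := joinedl uy'; have uN' := unassigned_extends ext uN.
have cn : (c < n)%N by apply: (@grown_sees_lt _ u); exists y, y'; split=> //; exists o.
have uy := grown_joined_extends uy'.
case E: (asg y) => [q|].
  have yo' := extends_assigned ext E yo; have [_ _ oo _ _] := assigned_spec dec yo'.
  apply: (chain_leq_center dec oo _ (contact_chain dec yo' yy' uy)); apply: leq_reach.
  by have := near_count_grown_le u (ltnW cn); lia.
have [[_ dy iy _] oo oy _] := asg'_grown.2 _ _ _ E yo.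
have yu : joined (unassigned asg) y u.
  apply: joined_sym => //; apply: (joined_trans uy).
  by apply: joined_adj => //; [exact: joinedr uy|exact: adj_sym].
have iE : detached_index y = detached_index u by rewrite /detached_index (detached_joined yu).
have du : detached u !=set0 by rewrite -(detached_joined yu).
have := @near_count_grown u c uN du; rewrite -iE iy (ltnW cn) => /(_ isT) count_lt.
have := near_count_le3 dec uN' cn => count_le3.
apply: (chain_leq_center dec oo _ oy).
by rewrite /contact_reach (near_count_joined dec (ltnW cn) yu) /reach; nia.
Qed.

Lemma grown_decomposition : decomposition n asg' region.
Proof.
split.
- exact: grown_assigned_spec.
- exact: grown_assigned_finite.
- exact: grown_supernode_connected.
- move=> i x y ni Rx xy oy; apply: (region_closed dec ni Rx xy).
  exact: (not_older_extends ext).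
- move=> i x s us sP; apply: (centers_bounded dec (i := i) (x := x) us) => o /sP[oo ox].
  by split=> //; apply: grown_center.
- move=> i j u ij si sj; have nj := grown_sees_lt sj; have ni := ltn_trans ij nj.
  have [x [y [ix jy xy]]] := supernodes_adjacent dec ij
    (sees_extends ext ext_territory ni si) (sees_extends ext ext_territory nj sj).
  by exists x, y; split=> //; apply: (supernode_extends ext).
- exact: grown_contact_chain.
- move=> u c uN cn; apply: leq_trans (near_count_le3 dec (unassigned_extends ext uN) cn).
  exact: near_count_grown_le (ltnW cn).
Qed.

Lemma grown_detached u i : unassigned asg' u -> (i < n)%N -> nears asg' region i u ->
  ~ sees asg' i u -> detached u !=set0.
Proof.
move=> uN ni near_i unseen; apply: contrapT => detached0; apply: (detached0); exists i.
split=> //; first exact: (nears_extends ext ext_territory (fun _ _ => erefl) ni near_i).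
move=> [x [y [ix xy uy]]]; apply: unseen.
exists x, y; split=> //; first exact: (supernode_extends ext).
elim: uy {xy} => [_|z t uz IH zt tN]; first exact: joined_refl.
apply: (joined_step IH zt); case E: (asg' t) => [[c o]|]; rewrite /unassigned /= ?E //.
have [[_ dt _ _] _ _ _] := asg'_grown.2 _ _ _ tN E.
by case: detached0; rewrite (detached_joined (joined_step uz zt tN)).
Qed.

End GrowthRound.

Lemma growth_round n asg region b : decomposition n asg region ->
  (forall u, unassigned asg u -> detached n asg region u !=set0 ->
     (near_count asg region n u <= b.+1)%N) ->
  exists asg', [/\ extends asg asg',
    forall i x, supernode asg' i x -> territory asg i x, decomposition n asg' region &
    forall u, unassigned asg' u -> detached n asg' region u !=set0 ->
     (near_count asg' region n u <= b)%N].
Proof.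
move=> dec count_le.
have [asg' [gr abs]] := absorption adj_sym close_refl close_sym adj_close
  (assigned_joined dec) (center_region dec) (growth_candidates_finite dec).
have ext := gr.1; exists asg'; split=> //.
- exact: grown_territory gr.
- exact: grown_decomposition gr abs.
move=> u uN [i [ni near_i unseen]].
have du := grown_detached dec gr uN ni near_i unseen.
have [iN _ _] := detached_indexP du.
have := near_count_grown dec gr abs (c := n) uN du; rewrite iN leqnn => /(_ isT) lt.
by have := count_le u (unassigned_extends ext uN) du; lia.
Qed.

Lemma growth_phase n asg region : decomposition n asg region ->
  (forall u, unassigned asg u -> (near_count asg region n u <= 4)%N) ->
  exists asg', [/\ extends asg asg',
    forall i x, supernode asg' i x -> territory asg i x & buffered n asg' region].
Proof.
move=> dec count_le.
have {}count_le : forall u, unassigned asg u -> detached n asg region u !=set0 ->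
    (near_count asg region n u <= 4)%N by move=> u /count_le.
move: 4 count_le => b; elim: b asg dec => [|b IHb] asg dec count_le.
  exists asg; split=> //; first by move=> i x; left.
  split=> // i u ni uN near_i; apply: contrapT => unseen.
  have := near_count_gt0 ni near_i.
  by have := count_le u uN (ex_intro _ i (And3 ni near_i unseen)); lia.
have [asg1 [ext1 terr1 dec1 count_le1]] := growth_round dec count_le.
have [asg2 [ext2 terr2 buf2]] := IHb _ dec1 count_le1.
exists asg2; split=> //; first exact: extends_trans ext2.
move=> i x /terr2 terr_x; case: (ltnP i n) => ni.
  exact: (territory_extends ext1 (fun i x _ => @terr1 i x) ni).
by case: terr_x => [/terr1//|[_ /(sees_lt dec1)]]; lia.
Qed.

Lemma geodesic_joined D n p K E i j x z : geodesic adj close D n p K ->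
  (i <= j < n)%N -> (forall k, (i <= k <= j)%N -> K k `<=` E) -> K i z -> K j x ->
  joined E z x.
Proof.
move=> geo; elim: j x => [|j IHj] x /andP[ij jn] KE Kz Kx.
  have i0 : i = 0 by lia.
  rewrite i0 in Kz; have [_ [conK _] _ _] := geodesic_set geo jn.
  by apply: joined_subset (conK _ _ Kz Kx); apply: KE; lia.
have [_ [conK _] Kp _] := geodesic_set geo jn.
have [ij'|ji] := ltnP i j.+1; last first.
  have iE : i = j.+1 by lia.
  rewrite iE in Kz; apply: joined_subset (conK _ _ Kz Kx); apply: KE; lia.
have [_ _ _ Kp'] := geodesic_set geo (ltnW jn).
apply: (joined_trans (y := p j.+1)).
  by apply: IHj => //; [lia|move=> k kj; apply: KE; lia].
by apply: joined_subset (conK _ _ Kp Kx); apply: KE; lia.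
Qed.

Section NewSupernode.
Variables (n : nat) (asg : assignment) (region : nat -> set V) (v : V).
Hypothesis dec : decomposition n asg region.
Hypothesis vN : unassigned asg v.

Let component := joined (unassigned asg) v.

Definition new_region i := if i == n then component else region i.

(* The new supernode, numbered [n], after [j] paths have been added. *)
Record skeleton j asg1 : Prop := Skeleton {
  skeleton_extends : extends asg asg1 ;
  skeleton_new : forall x c o, asg x = None -> asg1 x = Some (c, o) ->
    [/\ c = n, component x, asg1 o = Some (n, o), joined (cluster asg1 n o) o x &
        chain component (spacing + 4 * rounds * j) o x] ;
  skeleton_finite : finite_set [set x | asg1 x <> None] ;
  skeleton_connected : connected_set (supernode asg1 n) ;
  skeleton_base : supernode asg1 n v ;
  skeleton_centers : forall x (s : seq V), uniq s ->
    (forall o, o \in s -> asg1 o = Some (n, o) /\ chain component (reach 4) o x) ->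
    (size s <= 1 + 7 * j)%N }.

Lemma component_base : component v.
Proof. exact: joined_refl. Qed.

Lemma component_unassigned x : component x -> asg x = None.
Proof. by move/joinedr. Qed.

Lemma skeleton_index asg1 j x c o : skeleton j asg1 -> asg1 x = Some (c, o) ->
  asg x = Some (c, o) /\ (c < n)%N \/ asg x = None /\ c = n.
Proof.
move=> skel xo; case E: (asg x) => [q|]; last by right; have [] := skeleton_new skel E xo.
have := extends_assigned (skeleton_extends skel) E xo; rewrite E => xo'.
by left; split=> //; have [] := assigned_spec dec (etrans E xo').
Qed.

Lemma skeleton_component asg1 j x : skeleton j asg1 -> supernode asg1 n x -> component x.
Proof.
move=> skel [ o xo]; case: (skeleton_index skel xo) => [[_]|[xN _]]; first by rewrite ltnn.
by have [] := skeleton_new skel xN xo.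
Qed.

Lemma skeleton_assigned asg1 j x :
  skeleton j asg1 -> component x -> asg1 x <> None -> supernode asg1 n x.
Proof.
move=> skel Cx; case E: (asg1 x) => [[c o]|//] _.
by have [cE _ _ _ _] := skeleton_new skel (component_unassigned Cx) E; exists o; rewrite E cE.
Qed.

Lemma skeleton_start : exists asg1, skeleton 0 asg1.
Proof.
pose asg1 := [eta asg with v |-> Some (n, v)].
have supernode1 x : supernode asg1 n x -> x = v.
  move=> [ o] /=; case: eqP => // _ /(assigned_spec dec)[].
  by rewrite ltnn.
have asg1v : asg1 v = Some (n, v) by rewrite /= eqxx.
exists asg1; split.
- exact: extends_with.
- move=> x c o xN xo; have : supernode asg1 n x /\ (c, o) = (n, v).
    move: xo => /=; case: eqP => [->|_]; last by rewrite xN.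
    by move=> [<- <-]; split=> //; exists v.
  move=> [/supernode1-> [-> ->]]; split=> //; [exact: component_base|exact: joined_refl|].
  exact: (@chain_leq _ _ _ close_refl component 0 _ _ _ component_base).
- apply: (@sub_finite_set _ _ ([set v] `|` [set x | asg x <> None])).
    by move=> x /=; case: eqP => [->|_]; [left|right].
  by rewrite finite_setU; split; [exact: finite_set1|exact: (assigned_finite dec)].
- by move=> x y /supernode1-> /supernode1->; apply: joined_refl; exists v.
- by exists v.
- move=> x s us sP; rewrite muln0 addn0.
  apply: (@uniq_leq_size _ s [:: v]) => // o /sP[oo _].
  by rewrite inE; apply/eqP/supernode1; exists o.
Qed.

Lemma skeletonS j asg1 : skeleton j asg1 -> skeleton j.+1 asg1.
Proof.
move=> skel; case: (skel) => ext new fin con base centers; split=> //.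
  move=> x c o xN xo; have [cE Cx oo cx ox] := new _ _ _ xN xo; split=> //.
  have Co : component o by apply: (skeleton_component skel); exists o.
  by apply: chain_leq ox => //; rewrite leq_add2l leq_mul2l leqnSn orbT.
by move=> x s us sP; apply: leq_trans (centers _ _ us sP) _; lia.
Qed.

(* A geodesic chain of links from [v], of which the link [j0] is the last to meet
   what is already there.  The links that follow are cut into segments of length
   [spacing]; each one is the core of a cluster, except that its last two links
   are left free to keep the cores apart. *)
Section AddPath.
Variables (j : nat) (asg1 : assignment).
Hypothesis skel : skeleton j asg1.
Variables (L : nat) (p : nat -> V) (K : nat -> set V).
Hypothesis geo : geodesic adj close component L p K.
Hypothesis p0 : p 0 = v.
Variables (j0 : nat) (z0 : V).
Hypothesis j0L : (j0 < L)%N.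
Hypothesis Kz0 : K j0 z0.
Hypothesis z0_supernode : supernode asg1 n z0.
Hypothesis link_free : forall i x, (j0 < i < L)%N -> K i x -> asg1 x = None.

Definition segment_start b := (j0.+1 + b * spacing)%N.

Definition in_core b i := (segment_start b <= i < L)%N /\
  ((i < segment_start b + spacing - 2)%N \/ (L <= segment_start b + spacing)%N).

Definition core b : set V := [set x | exists2 i, in_core b i & K i x].

Definition core_center b := p (segment_start b).

Definition core_asg : assignment := fun x =>
  if asg1 x is Some q then Some q
  else if `[< exists b, core b x >]
       then Some (n, core_center (xget 0 [set b | core b x])) else None.

Lemma spacing_gt3 : (3 < spacing)%N.
Proof. lia. Qed.

Lemma segment_startS b : segment_start b.+1 = (segment_start b + spacing)%N.
Proof. by rewrite /segment_start mulSn; lia. Qed.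

Lemma in_core_bounds b i : in_core b i ->
  [/\ (j0 < i < L)%N, (segment_start b <= i)%N & (i < segment_start b + spacing)%N].
Proof. by have := spacing_gt3; rewrite /in_core /segment_start => *; split; lia. Qed.

Lemma link_component i : (i < L)%N -> K i `<=` component.
Proof. by move/(geodesic_set geo)=> []. Qed.

Lemma link_point i : (i < L)%N -> K i (p i).
Proof. by move/(geodesic_set geo)=> []. Qed.

Lemma core_start_lt b x : core b x -> (segment_start b < L)%N.
Proof. by move=> [i /in_core_bounds[]]; lia. Qed.

Lemma core_center_component b : (segment_start b < L)%N -> component (core_center b).
Proof. by move=> sL; apply: (link_component sL); apply: link_point. Qed.

Lemma core_disjoint b b' x : core b x -> core b' x -> b = b'.
Proof.
wlog bb' : b b' / (b < b')%N => [W|[i ci Ki] [i' ci' Ki']].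
  by case: (ltngtP b b') => // lt bx bx'; [exact: W|symmetry; exact: W].
have [iL _ _] := in_core_bounds ci; have [iL' _ _] := in_core_bounds ci'.
have sb : (segment_start b + spacing <= segment_start b')%N.
  by rewrite -segment_startS /segment_start; nia.
have [near_x _] := geodesic_dist geo (proj2 (andP iL)) Ki.
have [_ far_x] := geodesic_dist geo (proj2 (andP iL')) Ki'.
by case: (far_x i.+1) => //; move: ci ci'; rewrite /in_core; lia.
Qed.

Lemma core_asgE b x : core b x -> core_asg x = Some (n, core_center b).
Proof.
move=> bx; rewrite /core_asg; have [i ci Ki] := bx.
have [iL _ _] := in_core_bounds ci; rewrite (link_free iL Ki).
have ex : exists b, core b x by exists b.
rewrite asboolT //; congr (Some (_, core_center _)).
by apply: core_disjoint bx; apply: (xgetPex 0 ex).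
Qed.

Lemma core_asg_inv x q : core_asg x = Some q -> asg1 x = Some q \/
  asg1 x = None /\ exists2 b, core b x & q = (n, core_center b).
Proof.
case E: (asg1 x) => [q'|]; first by rewrite /core_asg E; left.
move=> xq; right; split=> //; move: (xq); rewrite /core_asg E.
case: asboolP => // -[b bx] _; exists b => //.
by move: xq; rewrite (core_asgE bx) => -[].
Qed.

Lemma core_asg_extends : extends asg1 core_asg.
Proof. by move=> x q; rewrite /core_asg => ->. Qed.

Lemma core_center_core b : (segment_start b < L)%N -> core b (core_center b).
Proof.
move=> sL; exists (segment_start b); last exact: link_point.
by have := spacing_gt3; rewrite /in_core; lia.
Qed.

Lemma core_joined b x : core b x -> joined (core b) (core_center b) x.
Proof.
move=> bx; have sL := core_start_lt bx; case: bx => i ci Ki.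
have [iL si iW] := in_core_bounds ci.
apply: (geodesic_joined geo _ _ (link_point sL) Ki); first by rewrite si; case/andP: iL.
by move=> k /andP[sk ki] t Kt; exists k => //; move: ci; rewrite /in_core; lia.
Qed.

Lemma core_chain b x : core b x -> chain component spacing (core_center b) x.
Proof.
move=> bx; have sL := core_start_lt bx; case: bx => i ci Ki.
have [/andP[_ iL] si iW] := in_core_bounds ci.
apply: (@chain_leq _ _ _ close_refl _ (i - segment_start b).+1); last first.
- apply: (chain_step (geodesic_chain geo (j := i) _)); first by rewrite si ltnW.
  by have [KC sK Kp _] := geodesic_set geo iL; exists (K i).
- lia.
- exact: core_center_component.
Qed.

Lemma core_asg_index x c o : component x -> core_asg x = Some (c, o) -> c = n.
Proof.
move=> Cx /core_asg_inv[xo|[_ [b _ [-> _]]]//].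
by have [-> _ _ _ _] := skeleton_new skel (component_unassigned Cx) xo.
Qed.

Lemma core_asg_spec x o : core_asg x = Some (n, o) ->
  [/\ component x, core_asg o = Some (n, o), joined (cluster core_asg n o) o x &
      chain component (spacing + 4 * rounds * j) o x].
Proof.
move=> /core_asg_inv[xo|[xN [b bx [oE]]]].
  have Cx : component x by apply: skeleton_component skel _; exists o.
  have [_ _ oo cx ox] := skeleton_new skel (component_unassigned Cx) xo.
  split=> //; first exact: core_asg_extends.
  by apply: joined_subset cx; apply: cluster_extends core_asg_extends.
have sL := core_start_lt bx; have [i ci Ki] := bx; rewrite oE; split.
- by have [/andP[_ iL] _ _] := in_core_bounds ci; apply: (link_component iL).
- by apply: core_asgE; apply: core_center_core.
- by apply: joined_subset (core_joined bx) => t /core_asgE.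
- apply: (@chain_leq _ _ _ close_refl _ spacing); rewrite ?leq_addr //.
    exact: core_center_component.
  exact: core_chain.
Qed.

Lemma core_asg_old x c o : c <> n -> core_asg x = Some (c, o) -> asg x = Some (c, o).
Proof.
move=> cn /core_asg_inv[xo|[_ [b _ [/cn]]]//].
by case: (skeleton_index skel xo) => [[]|[_ /cn]].
Qed.

Lemma path_centers_bounded x (s : seq V) : uniq s ->
  (forall o, o \in s -> exists2 b, core b o /\ o = core_center b &
     chain component (reach 4) o x) -> (size s <= 7)%N.
Proof.
move=> us sP; pose segment o := xget 0 [set b | core b o].
have segmentP o : o \in s ->
    [/\ core (segment o) o, o = core_center (segment o) & chain component (reach 4) o x].
  move=> /sP[b [bo oE] ox]; have seg_o : [set b | core b o] (segment o) by apply: xgetPex; exists b.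
  by split=> //; rewrite {1}oE (core_disjoint bo seg_o).
rewrite -(size_map segment); apply: size_window.
  rewrite map_inj_in_uniq // => o o' /segmentP[_ oE _] /segmentP[_ oE' _] bE.
  by rewrite oE oE' bE.
move=> _ _ /mapP[ o os ->] /mapP[ o' os' ->].
have [bo oE ox] := segmentP _ os; have [bo' oE' ox'] := segmentP _ os'.
have sL := core_start_lt bo; have sL' := core_start_lt bo'.
have vo' : chain component (segment_start (segment o) + (reach 4 + reach 4)) v o'.
  apply: (chain_trans (y := o)); last exact: chain_trans ox (chain_sym ox').
  by rewrite {2}oE -p0 -[segment_start _]subn0; apply: (geodesic_chain geo); lia.
have [_ far_o'] := geodesic_dist geo sL' (link_point sL').
rewrite leqNgt; apply/negP => lt; rewrite oE' -p0 in vo'; apply: far_o' vo'.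
have : ((segment o + 7) * spacing <= segment o' * spacing)%N by rewrite leq_mul2r; lia.
by rewrite /segment_start /reach mulnDl; lia.
Qed.

Lemma core_asg_centers x (s : seq V) : uniq s ->
  (forall o, o \in s -> core_asg o = Some (n, o) /\ chain component (reach 4) o x) ->
  (size s <= 1 + 7 * j.+1)%N.
Proof.
move=> us sP; rewrite -(count_predC (fun o => asg1 o == Some (n, o))).
rewrite mulnS addnCA addnC leq_add // -size_filter.
  apply: (@path_centers_bounded x); first exact: filter_uniq.
  move=> o; rewrite mem_filter => /andP[/negP oN /sP[oo ox]].
  by case: (core_asg_inv oo) => [/eqP//|[_ [b bo [oE]]]]; exists b.
apply: (skeleton_centers skel (x := x)); first exact: filter_uniq.
by move=> o; rewrite mem_filter => /andP[/eqP oo /sP[_ ox]].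
Qed.

Definition path_eligible x c := [/\ c = n, core_asg x = None &
  exists2 i, (j0 <= i < L)%N & K i x].

Definition path_radius (x : V) (c : nat) := (spacing + 4 * rounds * j)%N.

Lemma new_region_n : new_region n = component.
Proof. by rewrite /new_region eqxx. Qed.

Lemma core_asg_joined w c o :
  core_asg w = Some (c, o) -> joined (cluster core_asg c o) o w.
Proof.
case: (c =P n) => [->|cn wo]; first by case/core_asg_spec.
apply: joined_subset (assigned_joined dec (core_asg_old cn wo)).
by move=> t /(skeleton_extends skel)/core_asg_extends.
Qed.

Lemma core_asg_center_region c o : core_asg o = Some (c, o) -> new_region c o.
Proof.
rewrite /new_region; case: eqP => [->|cn]; first by case/core_asg_spec.
by move/(core_asg_old cn)/(center_region dec).
Qed.

Lemma links_finite : finite_set [set x | exists2 i, (i < L)%N & K i x].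
Proof.
apply: sub_finite_set (@chain_finite _ adj _ component L v close_finite) => x [i iL Ki].
have [vx _] := geodesic_dist geo iL Ki; rewrite p0 in vx.
by apply: chain_leq vx => //; exact: component_base.
Qed.

Lemma path_candidates_finite : finite_set [set x | exists c o,
  [/\ path_eligible x c, core_asg o = Some (c, o) &
      chain (new_region c) (path_radius x c + 4 * rounds) o x]].
Proof.
apply: sub_finite_set links_finite => x [c [ o [[_ _ [i /andP[_ iL] Ki]] _ _]]].
by exists i.
Qed.

Lemma link_meets_core i x : (j0 <= i < L)%N -> K i x -> core_asg x = None ->
  exists2 w, K i w & core_asg w <> None.
Proof.
move=> /andP[j0i iL] Ki xN; have W3 := spacing_gt3.
case: (leqP i j0) => ij0.
  have -> : i = j0 by lia.
  by exists z0 => //; have [ o /core_asg_extends->] := z0_supernode.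
pose b := ((i - j0.+1) %/ spacing)%N; pose r := ((i - j0.+1) %% spacing)%N.
have iE : i = (segment_start b + r)%N.
  by have := divn_eq (i - j0.+1) spacing; rewrite /segment_start /b /r; lia.
have rW : (r < spacing)%N by rewrite ltn_mod; lia.
have free_i : ~ in_core b i.
  by move=> ci; have := @core_asgE b x (ex_intro2 _ _ i ci Ki); rewrite xN.
have [rW2 sL] : (spacing - 2 <= r)%N /\ (segment_start b + spacing < L)%N.
  by move: free_i; rewrite /in_core; lia.
have [_ _ Kp Kp'] := geodesic_set geo iL.
case: (ltnP r (spacing - 1)) => rW1.
  exists (p i) => //; rewrite (@core_asgE b) //; exists i.-1; first by rewrite /in_core; lia.
  have i1L : (i.-1 < L)%N by lia.
  by have [_ _ _] := geodesic_set geo i1L; have -> : i.-1.+1 = i by lia.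
exists (p i.+1) => //; have -> : i.+1 = segment_start b.+1 by rewrite segment_startS; lia.
by rewrite (@core_asgE b.+1) //; apply: core_center_core; rewrite segment_startS.
Qed.

Lemma link_absorbable i x : (j < 3)%N -> (j0 <= i < L)%N -> K i x -> core_asg x = None ->
  absorbable adj close new_region core_asg path_eligible path_radius rounds x
    (joined (K i `\` [set z | core_asg z <> None]) x).
Proof.
move=> j3 i_range Ki xN; have iL : (i < L)%N by case/andP: i_range.
have [w Kw wa] := link_meets_core i_range Ki xN.
have [KC sK _ _] := geodesic_set geo iL; have [conK _] := sK.
pose P := joined (K i `\` [set z | core_asg z <> None]) x.
have PP z : P z -> K i z /\ core_asg z = None by move=> /joinedr[Kz /= /contrapT].
have Px : P x by apply: joined_refl; split.
have eligibleP z c : P z -> path_eligible z c <-> c = n.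
  by move=> /PP[Kz zN]; split=> [[]//|->]; split=> //; exists i.
split=> //.
- by apply: small_subset sK _ _; [move=> z /PP[]|exact: connected_component_set].
- by move=> z /PP[].
- by move=> z c Pz; split=> /eligibleP/(_) cE; apply/eligibleP => //; exact: cE.
- move=> z c /PP[Kz _] /(eligibleP _ _ Px) ->; rewrite new_region_n.
  by split=> //; apply: KC.
- have xT : ~ [set z | core_asg z <> None] x by rewrite /= xN.
  have [x' [t [xx' x't Kt /=]]] := joined_exit adj_sym (conK _ _ Ki Kw) xT wa.
  case Et: (core_asg t) => [[c o]|//] _.
  have cE := core_asg_index (KC _ Kt) Et; rewrite cE in Et.
  have [_ _ _ ot] := core_asg_spec Et.
  by exists x', t, n, o; split; rewrite ?new_region_n //; apply/(eligibleP _ _ Px).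
- move=> s us sP; apply: leq_trans (core_asg_centers us _) _; last lia.
  move=> o /sP[c [oo /(eligibleP _ _ Px) cE ox]]; rewrite cE new_region_n in oo ox.
  have [Co _ _ _] := core_asg_spec oo.
  by split=> //; apply: chain_leq ox => //; rewrite /path_radius /reach; nia.
Qed.

Variable asg2 : assignment.
Hypothesis asg2_grown :
  grown adj close new_region core_asg path_eligible path_radius rounds asg2.
Hypothesis link_assigned : forall i x, (j0 <= i < L)%N -> K i x -> asg2 x <> None.

Let ext2 : extends core_asg asg2 := asg2_grown.1.

Lemma path_extends : extends asg1 asg2.
Proof. exact: extends_trans core_asg_extends ext2. Qed.

Lemma path_new x c o : asg1 x = None -> asg2 x = Some (c, o) ->
  c = n /\ exists2 i, (j0 <= i < L)%N & K i x.
Proof.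
move=> xN xo; case E: (core_asg x) => [q|]; last first.
  by have [[-> _ ?] _ _ _] := asg2_grown.2 _ _ _ E xo.
have := core_asg_inv (extends_assigned ext2 E xo); rewrite xN => -[//|[_ [b [i ci Ki] [-> _]]]].
by split=> //; exists i => //; have [iL _ _] := in_core_bounds ci; lia.
Qed.

Lemma link_supernode i : (j0 <= i < L)%N -> K i `<=` supernode asg2 n.
Proof.
move=> i_range x Ki; have iL : (i < L)%N by case/andP: i_range.
case E1: (asg1 x) => [q|].
  have : supernode asg1 n x by apply: (skeleton_assigned skel (link_component iL Ki)); rewrite E1.
  exact: (supernode_extends path_extends).
have := link_assigned i_range Ki; case E: (asg2 x) => [[c o]|//] _.
by have [cE _] := path_new E1 E; exists o; rewrite E cE.
Qed.

Lemma path_skeleton_new x c o : asg x = None -> asg2 x = Some (c, o) ->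
  [/\ c = n, component x, asg2 o = Some (n, o), joined (cluster asg2 n o) o x &
      chain component (spacing + 4 * rounds * j.+1) o x].
Proof.
move=> xN xo; case E: (core_asg x) => [q|]; last first.
  have [[cn _ [i /andP[_ iL] Ki]] oo ox cx] := asg2_grown.2 _ _ _ E xo.
  rewrite cn new_region_n in oo ox cx *; split=> //; [exact: link_component Ki|exact: ext2|].
  by rewrite mulnSr addnA.
have xo' := extends_assigned ext2 E xo.
have cn : c = n.
  by apply: contrapT => cn; have := core_asg_old cn xo'; rewrite xN.
rewrite cn in xo' *; have [Cx oo cx ox] := core_asg_spec xo'; have [Co _ _ _] := core_asg_spec oo.
split=> //; [exact: ext2|by apply: joined_subset cx; apply: cluster_extends|].
by apply: chain_leq ox => //; rewrite leq_add2l leq_mul2l leqnSn orbT.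
Qed.

Lemma path_skeleton : skeleton j.+1 asg2.
Proof.
split.
- exact: extends_trans (skeleton_extends skel) path_extends.
- exact: path_skeleton_new.
- apply: (@sub_finite_set _ _ ([set x | asg1 x <> None] `|`
      [set x | exists2 i, (i < L)%N & K i x])); last first.
    by rewrite finite_setU; split; [exact: (skeleton_finite skel)|exact: links_finite].
  move=> x /=; case E: (asg1 x) => [q|] xa; [by left|right].
  case E': (asg2 x) xa => [[c o]|//] _.
  by have [_ [i /andP[_ iL] Ki]] := path_new E E'; exists i.
- apply: (connected_from adj_sym (o := z0)) => x [ o xo]; case E: (asg1 x) => [q|].
    apply: joined_subset (supernode_extends path_extends (i := n)) _.
    apply: (skeleton_connected skel z0_supernode).
    by exists o; exact: extends_assigned path_extends E xo.
  have [_ [i i_range Ki]] := path_new E xo.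
  apply: (geodesic_joined geo i_range _ Kz0 Ki) => k /andP[j0k ki].
  by apply: link_supernode; lia.
- exact: (supernode_extends path_extends) (skeleton_base skel).
- move=> x s us sP; apply: (core_asg_centers (x := x) us) => o /sP[oo ox]; split=> //.
  case E: (core_asg o) => [q|]; first by rewrite -E; exact: extends_assigned E oo.
  by have [_ oo' _ _] := asg2_grown.2 _ _ _ E oo; rewrite E in oo'.
Qed.

End AddPath.

Lemma last_link_exists j asg1 L p K : skeleton j asg1 ->
  geodesic adj close component L p K -> p 0 = v -> (0 < L)%N ->
  exists j0 z0, [/\ (j0 < L)%N, K j0 z0, supernode asg1 n z0 &
    forall i x, (j0 < i < L)%N -> K i x -> asg1 x = None].
Proof.
move=> skel geo p0 L0.
pose meets i := (i < L)%N && `[< exists z, K i z /\ supernode asg1 n z >].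
have meets_ex : exists i, meets i.
  exists 0; rewrite /meets L0; apply/asboolP; exists v; split; last exact: skeleton_base skel.
  by rewrite -p0; have [] := geodesic_set geo L0.
have meets_le i : meets i -> (i <= L)%N by move=> /andP[/ltnW].
case: (ex_maxnP meets_ex meets_le) => j0 /andP[j0L /asboolP[z0 [Kz0 z0n]]] j0_max.
exists j0, z0; split=> // i x /andP[j0i iL] Kx; apply: contrapT => xa.
have := j0_max i; rewrite leqNgt j0i => /(_ _)/negP; apply=> //.
rewrite /meets iL; apply/asboolP; exists x; split=> //; apply: skeleton_assigned skel _ xa.
by have [KC _ _ _] := geodesic_set geo iL; apply: KC.
Qed.

Lemma add_path j asg1 y : (j < 3)%N -> skeleton j asg1 -> component y ->
  exists asg2, [/\ skeleton j.+1 asg2, extends asg1 asg2 & supernode asg2 n y].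
Proof.
move=> j3 skel Cy; case: (pselect (asg1 y = None)) => [yN|ya]; last first.
  by exists asg1; split=> //; [exact: skeletonS|exact: skeleton_assigned skel Cy ya].
have [L [p [K [p0 pL geo]]]] :=
  geodesic_exists close_refl adj_sym close_sym adj_close (joined_in_component Cy).
have L0 : (0 < L)%N.
  rewrite lt0n; apply/eqP => L0; have [ o] := skeleton_base skel.
  by rewrite -p0 -L0 pL yN.
have [j0 [z0 [j0L Kz0 z0n link_free]]] := last_link_exists skel geo p0 L0.
have [asg2 [gr abs]] := absorption adj_sym close_refl close_sym adj_close
  (core_asg_joined skel geo j0L link_free) (core_asg_center_region skel geo j0L link_free)
  (path_candidates_finite j asg1 geo p0 j0).
have link_assigned i x : (j0 <= i < L)%N -> K i x -> asg2 x <> None.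
  move=> i_range Ki; case E: (core_asg asg1 L p K j0 x) => [q|]; first by rewrite (gr.1 _ _ E).
  exact: abs (link_absorbable skel geo p0 j0L Kz0 z0n link_free j3 i_range Ki E).
exists asg2; split; first exact: (path_skeleton skel geo p0 j0L Kz0 z0n link_free gr link_assigned).
  exact: path_extends gr.
have Lpred : (L.-1 < L)%N by lia.
apply: (link_supernode skel geo j0L link_free gr link_assigned (i := L.-1)); first by lia.
by have [_ _ _] := geodesic_set geo Lpred; rewrite prednK // pL.
Qed.

Lemma skeleton_touching : exists j asg1, [/\ (j <= 3)%N, skeleton j asg1 &
  forall i, sees asg i v ->
    exists x y, [/\ supernode asg i x, supernode asg1 n y & adj x y]].
Proof.
pose s := [seq i <- iota 0 n | `[< sees asg i v >]].
have s3 : (size s <= 3)%N.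
  apply: (sees_le3 dec vN) => [|i]; first by rewrite filter_uniq ?iota_uniq.
  by rewrite mem_filter => /andP[/asboolP].
suff touching (t : seq nat) : (size t <= 3)%N -> {subset t <= s} ->
    exists asg1, skeleton (size t) asg1 /\ forall i, i \in t ->
    exists x y, [/\ supernode asg i x, supernode asg1 n y & adj x y].
  have [//|asg1 [skel touch]] := touching s s3.
  exists (size s), asg1; split=> // i iv; apply: touch.
  by rewrite mem_filter mem_iota asboolT // (sees_lt dec iv).
elim: t => [_ _|i t IHt /= t3 ts]; first by have [asg1 skel] := skeleton_start; exists asg1.
have [||asg1 [skel touch]] := IHt; first exact: ltnW.
  by move=> k kt; apply: ts; rewrite inE kt orbT.
have : i \in s by apply: ts; rewrite mem_head.
rewrite mem_filter => /andP[/asboolP[x [y [ix xy vy]]] _].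
have [asg2 [skel2 ext2 ny]] := add_path t3 skel vy.
exists asg2; split=> // k; rewrite inE => /orP[/eqP->|/touch[x' [y' [kx' ny' xy']]]].
  by exists x, y.
by exists x', y'; split=> //; apply: (supernode_extends ext2).
Qed.

Section SkeletonDecomposition.
Variables (j : nat) (asg1 : assignment).
Hypothesis skel : skeleton j asg1.
Hypothesis touching : forall i, sees asg i v ->
  exists x y, [/\ supernode asg i x, supernode asg1 n y & adj x y].
Hypothesis near_sees :
  forall i u, (i < n)%N -> unassigned asg u -> nears asg region i u -> sees asg i u.

Let ext : extends asg asg1 := skeleton_extends skel.

Lemma skeleton_old_supernode i x : i <> n -> supernode asg1 i x -> supernode asg i x.
Proof. by move=> ni [ o xo]; case: (skeleton_index skel xo) => [[xo' _]|[_ /ni//]]; exists o. Qed.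

Lemma skeleton_territory i x : (i < n)%N -> supernode asg1 i x -> territory asg i x.
Proof. by move=> ni ix; left; apply: skeleton_old_supernode ix; lia. Qed.

Lemma skeleton_sees_le i u : sees asg1 i u -> (i <= n)%N.
Proof. by move=> [x [y [[ o /(skeleton_index skel)[[_ /ltnW]|[_ ->]]]]]]. Qed.

Lemma new_region_old i : (i < n)%N -> new_region i = region i.
Proof. by move=> ni; rewrite /new_region; case: eqP => // ?; lia. Qed.

Lemma new_near_count_le u c : (c <= n)%N ->
  (near_count asg1 new_region c u <= near_count asg region c u)%N.
Proof. exact: (near_count_extends ext skeleton_territory new_region_old). Qed.

Lemma new_near_count_le3 u c : unassigned asg1 u -> (c <= n)%N ->
  (near_count asg1 new_region c u <= 3)%N.
Proof.
move=> uN cn; have uN' := unassigned_extends ext uN.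
apply: leq_trans (new_near_count_le u cn) _; rewrite /near_count -size_filter.
apply: (sees_le3 dec uN') => [|i]; first by rewrite filter_uniq ?iota_uniq.
rewrite mem_filter mem_iota => /andP[/asboolP near_i /andP[_ ic]].
by apply: near_sees => //; lia.
Qed.

Hypothesis j3 : (j <= 3)%N.

Lemma new_assigned_spec x i o : asg1 x = Some (i, o) ->
  [/\ (i < n.+1)%N, new_region i x, asg1 o = Some (i, o), joined (cluster asg1 i o) o x &
      chain (new_region i) (reach 3) o x].
Proof.
move=> xo; case: (skeleton_index skel xo) => [[xo' ni]|[xN ni]].
  have [_ Rx oo cx ox] := assigned_spec dec xo'; rewrite new_region_old //; split=> //.
  - exact: ltnW.
  - exact: ext.
  - by apply: joined_subset cx; apply: cluster_extends.
have [_ Cx oo cx ox] := skeleton_new skel xN xo; rewrite ni new_region_n in xo *; split=> //.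
apply: chain_leq ox => //; first by apply: (skeleton_component skel); exists o.
by rewrite /reach; nia.
Qed.

Lemma new_region_closed i x y : (i < n.+1)%N -> new_region i x -> adj x y ->
  not_older asg1 i y -> new_region i y.
Proof.
rewrite ltnS leq_eqVlt => /orP[/eqP->|ni]; last first.
  rewrite new_region_old // => Rx xy /(not_older_extends ext).
  exact: (region_closed dec ni Rx xy).
rewrite new_region_n => Cx xy older; apply: (joined_step Cx xy).
case E: (asg y) => [[i' o']|//]; exfalso.
by have := older _ _ (ext E); have [] := assigned_spec dec E; lia.
Qed.

Lemma new_centers_bounded i x (s : seq V) : uniq s ->
  (forall o, o \in s -> asg1 o = Some (i, o) /\ chain (new_region i) (reach 4) o x) ->
  (size s <= max_centers)%N.
Proof.
move=> us sP; have [ni|ni] := pselect (i = n).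
  apply: leq_trans (skeleton_centers skel (x := x) us _) _; last lia.
  by move=> o /sP; rewrite ni new_region_n.
apply: (centers_bounded dec (i := i) (x := x) us) => o /sP[oo ox].
case: (skeleton_index skel oo) => [[oo' i_lt]|[_ /ni//]].
by split=> //; rewrite -new_region_old.
Qed.

Lemma new_supernodes_adjacent i k u : (i < k)%N -> sees asg1 i u -> sees asg1 k u ->
  exists x y, [/\ supernode asg1 i x, supernode asg1 k y & adj x y].
Proof.
move=> ik si sk; have kn := skeleton_sees_le sk; have ni : (i < n)%N by lia.
have si' := sees_extends ext skeleton_territory ni si.
move: kn; rewrite leq_eqVlt => /orP[/eqP kn|kn]; last first.
  have [x [y [ix ky xy]]] :=
    supernodes_adjacent dec ik si' (sees_extends ext skeleton_territory kn sk).
  by exists x, y; split=> //; apply: (supernode_extends ext).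
rewrite kn in sk *; move: sk => [x [y [nx xy uy]]].
have uy' := joined_subset (unassigned_extends ext) uy.
have vu : joined (unassigned asg) v u.
  apply: joined_trans (joined_sym adj_sym uy').
  by apply: (joined_step (skeleton_component skel nx) xy); apply: joinedr uy'.
have [x1 [y1 [ix1 ny1 xy1]]] := touching (sees_joined (joined_sym adj_sym vu) si').
by exists x1, y1; split=> //; apply: (supernode_extends ext).
Qed.

Lemma new_contact_chain u c y o y' : asg1 y = Some (c, o) -> adj y y' ->
  joined (unassigned asg1) u y' ->
  chain (new_region c) (reach (3 - near_count asg1 new_region c u)) o y.
Proof.
move=> yo yy' uy'; case: (skeleton_index skel yo) => [[yo' cn]|[yN cn]].
  have [_ _ oo _ _] := assigned_spec dec yo'; rewrite new_region_old //.
  apply: (chain_leq_center dec oo _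
    (contact_chain dec yo' yy' (joined_subset (unassigned_extends ext) uy'))).
  by apply: leq_reach; have := new_near_count_le u (ltnW cn); lia.
have [_ _ _ _ oy] := skeleton_new skel yN yo; rewrite cn new_region_n.
apply: chain_leq oy => //; last by rewrite /reach; nia.
by apply: (skeleton_component skel); exists o; rewrite -cn; have [] := new_assigned_spec yo.
Qed.

Lemma new_decomposition : decomposition n.+1 asg1 new_region.
Proof.
split.
- exact: new_assigned_spec.
- exact: skeleton_finite skel.
- move=> i; have [->|ni] := pselect (i = n); first exact: skeleton_connected skel.
  move=> x y /(skeleton_old_supernode ni) ix /(skeleton_old_supernode ni) iy.
  exact: joined_subset (supernode_extends ext (i := i)) (supernode_connected dec ix iy).
- exact: new_region_closed.
- exact: new_centers_bounded.
- exact: new_supernodes_adjacent.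
- exact: new_contact_chain.
- by move=> u c uN; rewrite ltnS; apply: new_near_count_le3.
Qed.

End SkeletonDecomposition.

End NewSupernode.

Lemma add_supernode n asg region v : buffered n asg region -> unassigned asg v ->
  exists asg' region', [/\ extends asg asg',
    forall i x, (i < n)%N -> supernode asg' i x -> territory asg i x,
    forall i, (i < n)%N -> region' i = region i, buffered n.+1 asg' region' &
    asg' v <> None].
Proof.
move=> [dec near_sees] vN.
have [j [asg1 [j3 skel touching]]] := skeleton_touching dec vN.
have dec1 := new_decomposition dec skel touching near_sees j3.
have [u uN|asg2 [ext2 terr2 buf2]] := growth_phase dec1.
  apply: leq_trans (near_count_succ _ _ _ _) _; rewrite ltnS.
  exact: (new_near_count_le3 dec skel near_sees uN (leqnn n)).
exists asg2, (new_region n asg region v); split=> //.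
- exact: extends_trans (skeleton_extends skel) ext2.
- move=> i x ni /terr2; apply: (territory_extends (skeleton_extends skel) _ ni) => i' x'.
  exact: (skeleton_territory dec skel).
- by move=> i; exact: new_region_old.
- by have [ o vo] := skeleton_base skel; rewrite (ext2 _ _ vo).
Qed.

Lemma empty_buffered : buffered 0 (fun=> None) (fun=> set0).
Proof.
split=> //; split=> //=.
- by apply: sub_finite_set (finite_set0 V) => x.
- by move=> i x y [].
- by move=> i x [|o s] // us /(_ o); rewrite mem_head => /(_ isT)[].
- by move=> i j u _ [x [y [[]]]].
Qed.

Hypothesis V_infinite : infinite_set [set: V].

Lemma next_stage n asg region : buffered n asg region ->
  exists asg' region' v, [/\ buffered n.+1 asg' region', extends asg asg',
    (forall i x, (i < n)%N -> supernode asg' i x -> territory asg i x),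
    (forall i, (i < n)%N -> region' i = region i) &
    [/\ asg v = None, asg' v <> None &
        forall x, asg x = None -> (pickle v <= pickle x)%N]].
Proof.
move=> buf; have [v0 v0N] : exists v, asg v = None.
  apply: contrapT => nv; apply: V_infinite.
  apply: sub_finite_set (assigned_finite buf.1) => x _ xN.
  by apply: nv; exists x.
have code_ex : exists k, `[< exists v, asg v = None /\ pickle v = k >].
  by exists (pickle v0); apply/asboolP; exists v0.
case: (ex_minnP code_ex) => k /asboolP[v [vN vk]] kmin.
have [asg' [region' [ext terr regE buf' v_assigned]]] := add_supernode buf vN.
exists asg', region', v; split=> //; split=> // x xN; rewrite vk; apply: kmin.
by apply/asboolP; exists x.
Qed.

Lemma stages_exist : exists (asg : nat -> assignment) (region : nat -> nat -> set V),
  [/\ forall n, buffered n (asg n) (region n), forall n, extends (asg n) (asg n.+1),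
      forall n i x, (i < n)%N -> supernode (asg n.+1) i x -> territory (asg n) i x,
      forall n i, (i < n)%N -> region n.+1 i = region n i &
      forall n x, (pickle x < n)%N -> asg n x <> None].
Proof.
pose stage := {s : nat * assignment * (nat -> set V) | buffered s.1.1 s.1.2 s.2}.
pose index (s : stage) := (sval s).1.1; pose assign (s : stage) := (sval s).1.2.
pose follows (s s' : stage) := [/\ index s' = (index s).+1, extends (assign s) (assign s'),
  (forall i x, (i < index s)%N -> supernode (assign s') i x -> territory (assign s) i x),
  (forall i, (i < index s)%N -> (sval s').2 i = (sval s).2 i) &
  exists v, [/\ assign s v = None, assign s' v <> None &
    forall x, assign s x = None -> (pickle v <= pickle x)%N]].
have [s|f [f0 fS]] := @dependent_choice stage follows _ (exist _ (0, _, _) empty_buffered).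
  apply: cid; case: s => -[[n asg] region] buf.
  have [asg' [region' [v [buf' ext terr regE vP]]]] := next_stage buf.
  by exists (exist _ (n.+1, asg', region') buf'); split=> //; exists v.
have index_f n : index (f n) = n.
  by elim: n => [|n IHn]; [rewrite f0|have [-> _ _ _ _] := fS n; rewrite IHn].
exists (fun n => assign (f n)), (fun n => (sval (f n)).2); split.
- by move=> n; have := svalP (f n); rewrite -[(sval (f n)).1.1]/(index (f n)) index_f.
- by move=> n; have [] := fS n.
- by move=> n i x ni; have [_ _ terr _ _] := fS n; apply: terr; rewrite index_f.
- by move=> n i ni; have [_ _ _ regE _] := fS n; apply: regE; rewrite index_f.
move=> n x; suff code_ge : assign (f n) x = None -> (n <= pickle x)%N by move=> + /code_ge; lia.
elim: n x => // n IHn x xN.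
have [_ ext _ _ [v [vN va vmin]]] := fS n.
have xN' := extends_None ext xN; have := IHn _ xN'; rewrite leq_eqVlt => /orP[/eqP nx|//].
have vx := vmin _ xN'; have nv := IHn _ vN; exfalso; apply: va.
by have -> : v = x by apply: (pcan_inj pickleK); lia.
Qed.

Section Limit.
Variables (asg : nat -> assignment) (region : nat -> nat -> set V).
Hypothesis stage_buffered : forall n, buffered n (asg n) (region n).
Hypothesis stage_extends : forall n, extends (asg n) (asg n.+1).
Hypothesis stage_territory :
  forall n i x, (i < n)%N -> supernode (asg n.+1) i x -> territory (asg n) i x.
Hypothesis stage_region : forall n i, (i < n)%N -> region n.+1 i = region n i.
Hypothesis stage_total : forall n x, (pickle x < n)%N -> asg n x <> None.

Let stage_dec n : decomposition n (asg n) (region n) := (stage_buffered n).1.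

Lemma stage_extends_le m n : (m <= n)%N -> extends (asg m) (asg n).
Proof.
move=> /subnKC <-; elim: (n - m)%N => [|k IHk]; rewrite ?addn0 // addnS.
exact: (extends_trans IHk (@stage_extends _)).
Qed.

Lemma stage_region_le m n i : (i < m <= n)%N -> region n i = region m i.
Proof.
move=> /andP[im /subnKC <-]; elim: (n - m)%N => [|k IHk]; first by rewrite addn0.
by rewrite addnS stage_region ?IHk //; lia.
Qed.

Lemma stage_territory_le m n i :
  (i < m <= n)%N -> supernode (asg n) i `<=` territory (asg m) i.
Proof.
move=> /andP[im /subnKC <-]; move: (n - m)%N => k.
suff terr_sub : territory (asg (m + k)) i `<=` territory (asg m) i.
  by move=> x ix; apply: terr_sub; left.
elim: k => [|k IHk]; first by rewrite addn0.
rewrite addnS => x tx; apply: IHk; move: x tx.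
by apply: (territory_extends (n := m + k)%N); [exact: stage_extends|exact: stage_territory|lia].
Qed.

Definition final_label x := odflt (0, x) (asg (pickle x).+1 x).
Definition supernode_of x := (final_label x).1.
Definition center x := (final_label x).2.

Lemma stage_assigned n x : (pickle x < n)%N -> asg n x = Some (supernode_of x, center x).
Proof.
move=> xn; have := @stage_total (pickle x).+1 x (ltnSn _).
rewrite /supernode_of /center /final_label; case E: (asg (pickle x).+1 x) => [[i o]|//] _ /=.
exact: (stage_extends_le xn E).
Qed.

Lemma stage_unique n x i o : asg n x = Some (i, o) -> supernode_of x = i /\ center x = o.
Proof.
move=> xo; have := @stage_assigned (n + (pickle x).+1) x.
rewrite (stage_extends_le (leq_addr _ n) xo) leq_addl => /(_ isT).
by move=> [-> ->].
Qed.

Lemma supernode_of_unassigned x : asg (supernode_of x) x = None.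
Proof.
case E: (asg (supernode_of x) x) => [[i o]|//]; have [iE _] := stage_unique E.
by have [] := assigned_spec (stage_dec _) E; rewrite -iE ltnn.
Qed.

Lemma supernode_of_not_older n i x : (i <= supernode_of x)%N -> not_older (asg n) i x.
Proof. by move=> ix j o /stage_unique[<- _]. Qed.

Lemma center_stage_assigned x : asg (pickle x).+1 (center x) = Some (supernode_of x, center x).
Proof. by have [] := assigned_spec (stage_dec _) (stage_assigned (ltnSn (pickle x))). Qed.

Lemma center_idem x : center (center x) = center x.
Proof. by have [] := stage_unique (center_stage_assigned x). Qed.

Lemma center_joined x : joined [set y | center y = center x] (center x) x.
Proof.
have [_ _ _ cx _] := assigned_spec (stage_dec _) (stage_assigned (ltnSn (pickle x))).
by apply: joined_subset cx => y /= yE; have [] := stage_unique yE.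
Qed.

Lemma center_chain x : chain setT (reach 3) (center x) x.
Proof.
have [_ _ _ _] := assigned_spec (stage_dec _) (stage_assigned (ltnSn (pickle x))).
exact: chain_subset.
Qed.

Lemma connected_in_region (P : set V) n z : connected_set P -> (supernode_of z < n)%N ->
  (forall t, P t -> (supernode_of z <= supernode_of t)%N) -> P z ->
  P `<=` region n (supernode_of z).
Proof.
move=> cP zn Pz_min Pz; have Rz : region n (supernode_of z) z.
  have [|_ Rz _ _ _] := assigned_spec (stage_dec _) (@stage_assigned (n + (pickle z).+1) z _).
    by rewrite leq_addl.
  by rewrite -(stage_region_le (n := n + (pickle z).+1)) // zn leq_addr.
move=> t Pt; have := cP _ _ Pz Pt; elim=> // a b _ Ra ab Pb.
apply: (region_closed (stage_dec n) zn Ra ab).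
by apply: supernode_of_not_older; apply: Pz_min.
Qed.

(* [P] is left over, once the supernode [i] is removed, from a small set that
   meets no supernode older than [i]. *)
Definition younger_part i (P : set V) := (forall z, P z -> (i < supernode_of z)%N) /\
  exists P', [/\ small P', P `<=` P', forall z, P' z -> (i <= supernode_of z)%N &
                 exists2 z, P' z & supernode_of z = i].

Lemma younger_part_subset i (P Q : set V) : Q `<=` P -> younger_part i P -> younger_part i Q.
Proof.
move=> QP [Pi [P' [sP' PP' P'i iP']]]; split; first by move=> z /QP/Pi.
by exists P'; split=> // z /QP/PP'.
Qed.

Lemma min_supernode (P : set V) x : P x ->
  exists2 z, P z & forall t, P t -> (supernode_of z <= supernode_of t)%N.
Proof.
move=> Px; have ex : exists k, `[< exists z, P z /\ supernode_of z = k >].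
  by exists (supernode_of x); apply/asboolP; exists x.
case: (ex_minnP ex) => k /asboolP[z [Pz zk]] kmin; exists z => // t Pt.
by rewrite zk; apply: kmin; apply/asboolP; exists t.
Qed.

Lemma younger_parts_le3 (s : seq nat) (P : set V) x : uniq s ->
  (forall i, i \in s -> younger_part i P) -> P x -> (size s <= 3)%N.
Proof.
move=> us sP /min_supernode[u Pu umin]; pose n := supernode_of u.
have uN : unassigned (asg n) u := supernode_of_unassigned u.
apply: (sees_le3 (stage_dec n) uN us) => i /sP[Pi [P' [sP' PP' P'i [z P'z zi]]]].
have ni : (i < n)%N := Pi _ Pu; rewrite -zi in ni P'i *.
have RP' := connected_in_region sP'.1 ni P'i P'z.
apply: (stage_buffered n).2 => //; split; first exact/RP'/PP'.
exists z, u; split; last first.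
- exists P'; split=> // [t P't|]; last exact: PP'.
  by split; [exact: RP'|exact: supernode_of_not_older (P'i _ P't)].
- exact: joined_refl.
- apply: (@stage_territory_le _ (n + (pickle z).+1)); first by rewrite ni leq_addr.
  by exists (center z); rewrite stage_assigned // leq_addl.
Qed.

Lemma few_centers_in_small (P : set V) u : small P -> P u ->
  (forall t, P t -> (supernode_of u <= supernode_of t)%N) ->
  exists2 cs : seq V, (size cs <= max_centers)%N &
    forall z, P z -> supernode_of z = supernode_of u -> center z \in cs.
Proof.
move=> sP Pu umin; have /finite_seqP[l lE] : finite_set P.
  by apply: sub_finite_set (close_finite u) => t Pt; apply: sP.2.
have Pl t : P t <-> t \in l by rewrite lE.
pose N := (\max_(t <- l) pickle t + supernode_of u).+1.
have lN t : t \in l -> (pickle t < N)%N.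
  by move=> tl; rewrite ltnS; apply: leq_trans (leq_addr _ _); apply: leq_bigmax_seq.
have uN : (supernode_of u < N)%N by rewrite ltnS leq_addl.
have RP := connected_in_region sP.1 uN umin Pu.
exists (undup [seq center t | t <- l & supernode_of t == supernode_of u]) => [|z Pz zi]; last first.
  rewrite mem_undup; apply/mapP; exists z => //.
  by rewrite mem_filter zi eqxx; apply/Pl.
apply: (centers_bounded (stage_dec N) (i := supernode_of u) (x := u)); first exact: undup_uniq.
move=> o; rewrite mem_undup => /mapP[t]; rewrite mem_filter => /andP[/eqP ti tl ->].
have [_ _ oo _ ot] := assigned_spec (stage_dec N) (stage_assigned (lN _ tl)).
rewrite ti in oo ot; split=> //; apply: (chain_leq_center (stage_dec N) oo (k := (reach 3).+1)).
  by rewrite /reach; lia.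
by exists t => //; exists P; split=> //; apply/Pl.
Qed.

Lemma small_hops t : exists L, forall (s : seq nat) P x y, uniq s -> (size s + t = 4)%N ->
  (forall i, i \in s -> younger_part i P) -> small P -> P x -> P y ->
  hops adj center L x y.
Proof.
elim: t => [|t [L IHt]].
  exists 0 => s P x y us; rewrite addn0 => s4 sP _ Px _.
  by have := younger_parts_le3 us sP Px; rewrite s4.
exists (crossing_bound L max_centers) => s P x y us s4 sP smallP Px Py.
have [u Pu umin] := min_supernode Px.
have [cs cs_le csP] := few_centers_in_small smallP Pu umin.
apply: hops_leq (leq_crossing_bound L cs_le) _.
apply: (hops_crossing adj_sym (P := P)
  (S := [set z | supernode_of z = supernode_of u])); last first.
  by apply: joined_subset (smallP.1 _ _ Px Py) => z Pz; split=> // /csP; apply.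
move=> a b ab; pose Q := joined (P `\` [set z | supernode_of z = supernode_of u]) a.
have QP : Q `<=` P by move=> z /joinedr[].
have fresh_u : supernode_of u \notin s.
  by apply/negP => /sP[/(_ _ Pu)]; rewrite ltnn.
apply: (IHt (supernode_of u :: s) Q) => //; rewrite ?[size _]/= ?addSnnS //.
- by rewrite /= fresh_u.
- move=> i; rewrite inE => /orP[/eqP->|/sP]; last exact: younger_part_subset.
  split; last by exists P; split=> //; exists u.
  move=> z /joinedr[Pz /= zu]; rewrite ltn_neqAle umin // andbT.
  by apply/eqP => /esym.
- by apply: small_subset smallP QP _; exact: connected_component_set.
- exact: joined_refl (joinedl ab).
Qed.

End Limit.

Lemma bounded_clusters_exist : exists (center : V -> V) (R L : nat),
  [/\ forall x, center (center x) = center x,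
      forall x, joined [set y | center y = center x] (center x) x,
      forall x, chain setT R (center x) x &
      forall P x y, small P -> P x -> P y -> hops adj center L x y].
Proof.
have [asg [region [buf ext terr regE total]]] := stages_exist.
have [L LP] := small_hops buf ext terr regE total 4.
exists (center asg), (reach 3), L; split.
- exact: center_idem.
- exact: center_joined.
- exact: center_chain.
- by move=> P x y sP Px Py; apply: (LP [::] P).
Qed.

End Supernodes.

Theorem cluster_decomposition (V : countType) (adj close : V -> V -> Prop) :
  (forall x y, adj x y -> adj y x) ->
  (forall x, close x x) -> (forall x y, close x y -> close y x) ->
  (forall x y, adj x y -> close x y) ->
  (forall x, finite_set [set y | close x y]) -> K5_minor_free adj ->
  infinite_set [set: V] ->
  exists (center : V -> V) (R L : nat),
  [/\ forall x, center (center x) = center x,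
      forall x, joined adj [set y | center y = center x] (center x) x,
      forall x, chain adj close setT R (center x) x &
      forall P x y, small adj close P -> P x -> P y -> hops adj center L x y].
Proof.
move=> adj_sym close_refl close_sym adj_close close_finite no_K5.
exact: (bounded_clusters_exist adj_sym close_refl close_sym adj_close close_finite
  no_K5 (max_centers := 22) (rounds := 66) (growth := 268) (spacing := 1072)).
Qed.

(** * The square grid has no K5 minor *)

Definition unit_dir (d : Z2) : bool := d \in [:: (1, 0); (0, 1); (-1, 0); (0, -1)]%R.

Definition grid_step : rel Z2 := fun p q => unit_dir (q - p)%R.

Definition grid_adj (p q : Z2) : Prop := grid_step p q.

Section GridParity.
Local Open Scope ring_scope.

Lemma unit_dirP d :
  unit_dir d -> [\/ d = (1, 0), d = (0, 1), d = (-1, 0) | d = (0, -1)].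
Proof.
by rewrite /unit_dir !inE => /or4P[] /eqP->;
  [apply: Or41|apply: Or42|apply: Or43|apply: Or44].
Qed.

Lemma unit_dirN d : unit_dir d -> unit_dir (- d).
Proof. by case/unit_dirP => ->. Qed.

Lemma grid_adj_add p d : unit_dir d -> grid_adj p (p + d).
Proof. by rewrite /grid_adj /grid_step [p + d]addrC addrK. Qed.

Lemma grid_adjP p q : grid_adj p q -> exists2 d, unit_dir d & q = p + d.
Proof. by move=> pq; exists (q - p) => //; rewrite addrC subrK. Qed.

Lemma grid_adj_sym p q : grid_adj p q -> grid_adj q p.
Proof. by move=> /unit_dirN; rewrite opprB. Qed.

Lemma grid_adj_orient p q : grid_adj p q ->
  exists2 e : Z2, e = (1, 0) \/ e = (0, 1) & q = p + e \/ p = q + e.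
Proof.
move=> /grid_adjP[d /unit_dirP[] -> ->].
- by exists (1, 0); [left|left].
- by exists (0, 1); [right|left].
- by exists (1, 0); [left|right; rewrite -addrA -[LHS]addr0; congr (_ + _)].
- by exists (0, 1); [right|right; rewrite -addrA -[LHS]addr0; congr (_ + _)].
Qed.

(* The step from [a] to [b] crosses the upward ray issued from the center of the
   unit square whose lower left corner is [q]. *)
Definition crosses (a b q : Z2) : bool :=
  [&& a.2 == b.2, (a.1 == q.1) && (b.1 == q.1 + 1) || (b.1 == q.1) && (a.1 == q.1 + 1)
    & q.2 < a.2].

(* The order at infinity of the upward rays. *)
Definition before (a b : Z2) : bool := (a.1 < b.1) || (a.1 == b.1) && (b.2 < a.2).

Fixpoint path_crosses (a : Z2) (l : seq Z2) (q : Z2) : bool :=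
  if l is b :: l' then crosses a b q (+) path_crosses b l' q else false.

Definition edge_crossings a a' c c' :=
  crosses a a' c (+) crosses a a' c' (+) (crosses c c' a (+) crosses c c' a').

Definition ends_order a a' c c' :=
  before a c (+) before a c' (+) (before a' c (+) before a' c').

Lemma beforeN a b : a <> b -> before a b = ~~ before b a.
Proof.
case: a b => [a1 a2] [b1 b2] ab; rewrite /before /=.
have {}ab : ~ (a1 = b1 /\ a2 = b2) by move=> [e1 e2]; apply: ab; rewrite e1 e2.
lia.
Qed.

Lemma crosses_sym a b q : crosses a b q = crosses b a q.
Proof.
rewrite /crosses eq_sym orbC; case: eqP => //= e.
by rewrite e.
Qed.

Lemma edge_crossings_revl a a' c c' : edge_crossings a a' c c' = edge_crossings a' a c c'.
Proof. by rewrite /edge_crossings !(crosses_sym a a') [in RHS](addbC (crosses c c' a')). Qed.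

Lemma edge_crossingsC a a' c c' : edge_crossings a a' c c' = edge_crossings c c' a a'.
Proof. exact: addbC. Qed.

Lemma edge_crossings_revr a a' c c' : edge_crossings a a' c c' = edge_crossings a a' c' c.
Proof. by rewrite edge_crossingsC edge_crossings_revl edge_crossingsC. Qed.

Lemma ends_order_revl a a' c c' : ends_order a a' c c' = ends_order a' a c c'.
Proof. exact: addbC. Qed.

Lemma ends_order_revr a a' c c' : ends_order a a' c c' = ends_order a a' c' c.
Proof. by rewrite /ends_order (addbC (before a c)) (addbC (before a' c)). Qed.

Lemma ends_orderC a a' c c' : a <> c -> a <> c' -> a' <> c -> a' <> c' ->
  ends_order a a' c c' = ends_order c c' a a'.
Proof.
move=> ac ac' a'c a'c'; rewrite /ends_order (beforeN ac) (beforeN ac') (beforeN a'c) (beforeN a'c').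
by do 4![case: (before _ _)].
Qed.

Lemma crosses_vertical (x y : int) q : crosses (x, y) (x, y + 1) q = false.
Proof. by rewrite /crosses /=; apply/negbTE/negP => /andP[/eqP]; lia. Qed.

Lemma before_vertical (x y : int) c :
  (x, y) <> c -> before (x, y) c = before (x, y + 1) c.
Proof.
case: c => c1 c2 n; have {}n : ~ (x = c1 /\ y = c2) by move=> [e1 e2]; apply: n; congr pair.
by rewrite /before /=; case: (ltgtP x c1) n => //= ->; lia.
Qed.

Lemma crosses_vertical_ray a a' (x y : int) : a <> (x, y + 1) -> a' <> (x, y + 1) ->
  crosses a a' (x, y) = crosses a a' (x, y + 1).
Proof.
case: a a' => [a1 a2] [b1 b2] n n'.
have {}n : ~ (a1 = x /\ a2 = y + 1) by move=> [e1 e2]; apply: n; congr pair.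
have {}n' : ~ (b1 = x /\ b2 = y + 1) by move=> [e1 e2]; apply: n'; congr pair.
rewrite /crosses /=; case: eqP => //= ab.
have [/andP[/eqP e1 /eqP e2]|] := boolP ((a1 == x) && _) => /=; first lia.
by have [/andP[/eqP e1 /eqP e2] _|//] := boolP ((b1 == x) && _) => /=; lia.
Qed.

Lemma vertical_edge_parity (a c c' : Z2) (a' := a + (0, 1)) :
  a <> c -> a <> c' -> a' <> c -> a' <> c' ->
  edge_crossings a a' c c' = ends_order a a' c c'.
Proof.
have -> : a' = (a.1, a.2 + 1) by rewrite /a' {1}[a]surjective_pairing; congr pair; rewrite addr0.
case: a {a'} => x y /= ac ac' a'c a'c'.
rewrite /edge_crossings /ends_order !crosses_vertical (@crosses_vertical_ray c c' x y).
  by rewrite (before_vertical ac) (before_vertical ac') !addbb.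
  exact: nesym.
exact: nesym.
Qed.

Local Ltac decide_int := repeat match goal with
  | |- context [@eq_op ?T ?a ?b] =>
      first [have -> : @eq_op T a b = true by apply/eqP; lia
            |have -> : @eq_op T a b = false by apply/eqP; lia]
  | |- context [@Order.lt ?d ?T ?a ?b] =>
      first [have -> : @Order.lt d T a b = true by lia
            |have -> : @Order.lt d T a b = false by lia]
  end.

Lemma horizontal_edges_parity (x y u w : int) :
  (x, y) <> (u, w) -> (x, y) <> (u + 1, w) -> (x + 1, y) <> (u, w) ->
  edge_crossings (x, y) (x + 1, y) (u, w) (u + 1, w) =
  ends_order (x, y) (x + 1, y) (u, w) (u + 1, w).
Proof.
move=> n1 n2 n3; rewrite /edge_crossings /ends_order /crosses /before /=.
have {}n1 : ~ (x = u /\ y = w) by move=> [e1 e2]; apply: n1; congr pair.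
have {}n2 : ~ (x = u + 1 /\ y = w) by move=> [e1 e2]; apply: n2; congr pair.
have {}n3 : ~ (x + 1 = u /\ y = w) by move=> [e1 e2]; apply: n3; congr pair.
have [yw|[wy|yw]] : y < w \/ w < y \/ y = w by lia.
- have : x = u \/ x = u + 1 \/ u = x + 1 \/ (x < u - 1) \/ (u + 1 < x) by lia.
  by case=> [e|[e|[e|[e|e]]]]; decide_int; rewrite /= ?andbF.
- have : x = u \/ x = u + 1 \/ u = x + 1 \/ (x < u - 1) \/ (u + 1 < x) by lia.
  by case=> [e|[e|[e|[e|e]]]]; decide_int; rewrite /= ?andbF.
- have : (x < u - 1) \/ (u + 1 < x) by lia.
  by case=> e; decide_int; rewrite /= ?andbF.
Qed.

Lemma disjoint_edges_parity a a' c c' : grid_adj a a' -> grid_adj c c' ->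
  a <> c -> a <> c' -> a' <> c -> a' <> c' ->
  edge_crossings a a' c c' = ends_order a a' c c'.
Proof.
have oriented (b d e f : Z2) : e = (1, 0) \/ e = (0, 1) -> f = (1, 0) \/ f = (0, 1) ->
    b <> d -> b <> d + f -> b + e <> d -> b + e <> d + f ->
    edge_crossings b (b + e) d (d + f) = ends_order b (b + e) d (d + f).
  move=> [] -> [] -> n1 n2 n3 n4; try exact: vertical_edge_parity.
    case: b d n1 n2 n3 n4 => [x y] [u w]; rewrite -![_ + (1, 0)]/(_, _) !addr0 => n1 n2 n3 _.
    exact: horizontal_edges_parity.
  rewrite edge_crossingsC ends_orderC // vertical_edge_parity //; exact: nesym.
move=> /grid_adj_orient[e eP [->|->]] /grid_adj_orient[f fP [->|->]] n1 n2 n3 n4.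
- exact: oriented.
- by rewrite edge_crossings_revr ends_order_revr; apply: oriented.
- by rewrite edge_crossings_revl ends_order_revl; apply: oriented.
- rewrite edge_crossings_revl ends_order_revl edge_crossings_revr ends_order_revr.
  exact: oriented.
Qed.

Lemma path_edge_parity a l c c' : path grid_step a l -> grid_adj c c' ->
  c \notin a :: l -> c' \notin a :: l ->
  path_crosses a l c (+) path_crosses a l c' (+)
    (crosses c c' a (+) crosses c c' (last a l)) =
  ends_order a (last a l) c c'.
Proof.
move=> + cc; elim: l a => [a _ _ _|b l IHl a /= /andP[ab pl]] /=.
  by rewrite /ends_order !addbb.
rewrite !(inE, negb_or) => /and3P[/eqP ca /eqP cb cl] /and3P[/eqP ca' /eqP cb' cl'].
have := disjoint_edges_parity ab cc (nesym ca) (nesym ca') (nesym cb) (nesym cb').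
have := IHl b pl; rewrite !(inE, negb_or) cl cl' !andbT.
move/eqP: cb => ->; move/eqP: cb' => -> /(_ isT isT).
rewrite /edge_crossings /ends_order (addbACA (crosses a b c) (path_crosses b l c)).
move: (crosses a b c (+) crosses a b c') (path_crosses b l c (+) path_crosses b l c')
  (crosses c c' a) (crosses c c' b) (crosses c c' (last b l)) (before a c (+) _)
  (before b c (+) _) (before (last b l) c (+) _).
by do 8!case.
Qed.

Lemma disjoint_paths_parity a l c k : path grid_step a l -> path grid_step c k ->
  (forall x, x \in a :: l -> x \in c :: k -> False) ->
  path_crosses a l c (+) path_crosses a l (last c k) (+)
    (path_crosses c k a (+) path_crosses c k (last a l)) =
  ends_order a (last a l) c (last c k).
Proof.
move=> pl; elim: k c => [c _ _|c' k IHk c /= /andP[cc pk] disj] /=.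
  by rewrite /ends_order !addbb.
have cl : c \notin a :: l by apply/negP => /disj; apply; rewrite mem_head.
have cl' : c' \notin a :: l by apply/negP => /disj; apply; rewrite !inE eqxx orbT.
have := IHk c' pk (fun x xl xk => disj x xl ltac:(rewrite inE xk orbT //)).
have := path_edge_parity pl cc cl cl'; rewrite /ends_order.
rewrite (addbACA (before a c) (before a c')) (addbACA (before a c') (before a (last c' k))).
rewrite (addbACA (before a c) (before a (last c' k))) (addbACA (crosses _ _ _)).
move: (path_crosses a l c) (path_crosses a l c') (path_crosses a l (last c' k))
  (crosses c c' a (+) crosses c c' (last a l))
  (path_crosses c' k a (+) path_crosses c' k (last a l))
  (before a c (+) _) (before a c' (+) _) (before a (last c' k) (+) _).
by do 8!case.
Qed.

Lemma joined_path (D : set Z2) a b : joined grid_adj D a b ->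
  exists l, [/\ path grid_step a l, last a l = b & forall x, x \in a :: l -> D x].
Proof.
elim=> [Da|y z _ [l [pl <- lD]] yz Dz].
  by exists [::]; split=> // x; rewrite inE => /eqP->.
exists (rcons l z); split; first by rewrite rcons_path pl.
  by rewrite last_rcons.
by move=> x; rewrite -rcons_cons mem_rcons inE => /orP[/eqP->|/lD].
Qed.

Section FiveBranchSets.
Variable A : nat -> set Z2.
Hypothesis A_connected : forall i, (i < 5)%N -> connected_set grid_adj (A i).
Hypothesis A_disjoint : forall i j x, (i < j < 5)%N -> A i x -> A j x -> False.
Hypothesis A_adjacent :
  forall i j, (i < j < 5)%N -> exists x y, [/\ A i x, A j y & grid_adj x y].

Lemma branch_sets_disjoint i j x :
  (i < 5)%N -> (j < 5)%N -> i <> j -> A i x -> A j x -> False.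
Proof.
move=> i5 j5 ij Ai Aj; case: (ltngtP i j) => // lt.
  by apply: (@A_disjoint i j x) => //; rewrite lt.
by apply: (@A_disjoint j i x) => //; rewrite lt.
Qed.

Lemma branch_vertices_exist : exists r : nat -> Z2, forall i, (i < 5)%N -> A i (r i).
Proof.
suff /choice[r rA] : forall i, exists x, (i < 5)%N -> A i x by exists r.
move=> i; case: (ltnP i 5) => [i5|_]; last by exists (0, 0).
have [i4|i4] := ltnP i 4.
  by have [|x [y [Ax _ _]]] := @A_adjacent i 4; [lia|exists x].
by have [|x [y [_ Ay _]]] := @A_adjacent 0 i; [lia|exists y].
Qed.

Lemma branch_paths_exist (r : nat -> Z2) : (forall i, (i < 5)%N -> A i (r i)) ->
  exists P : nat * nat -> seq Z2, forall ij, (ij.1 < ij.2 < 5)%N ->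
    [/\ path grid_step (r ij.1) (P ij), last (r ij.1) (P ij) = r ij.2 &
        forall x, x \in r ij.1 :: P ij -> A ij.1 x \/ A ij.2 x].
Proof.
move=> rA; suff /choice[P PP] : forall ij : nat * nat, exists l, (ij.1 < ij.2 < 5)%N ->
  [/\ path grid_step (r ij.1) l, last (r ij.1) l = r ij.2 &
      forall x, x \in r ij.1 :: l -> A ij.1 x \/ A ij.2 x] by exists P.
move=> [i j] /=; case: (boolP (i < j < 5)%N) => [ij|_]; last by exists [::].
have [x [y [Ax Ay xy]]] := A_adjacent ij; have /andP[ltij j5] := ij.
have i5 := ltn_trans ltij j5.
suff /joined_path[l] : joined grid_adj (A i `|` A j) (r i) (r j) by exists l.
apply: (joined_trans (y := x)).
  by apply: joined_subset (A_connected i5 (rA _ i5) Ax) => z; left.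
apply: (joined_trans (y := y)); last first.
  by apply: joined_subset (A_connected j5 Ay (rA _ j5)) => z; right.
by apply: joined_adj xy; [left|right].
Qed.

(* Each pair of disjoint edges of K5 gives a parity relation; in their sum every
   crossing number occurs twice and the orders at infinity add up to an odd number. *)
Lemma no_five_branch_sets : False.
Proof.
have [r rA] := branch_vertices_exist; have [P PP] := branch_paths_exist rA.
pose u i j l : nat := path_crosses (r i) (P (i, j)) (r l).
pose s i k : nat := before (r i) (r k).
have sN i k : (i < k < 5)%N -> (s i k + s k i = 1)%N.
  move=> ik; rewrite /s beforeN; first by case: before.
  by move=> e; apply: (A_disjoint ik (x := r i)); last rewrite e; apply: rA; lia.
have even_sum i j k l : [&& (i < j < 5)%N, (k < l < 5)%N & uniq [:: i; j; k; l]] ->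
    exists h, (u i j k + u i j l + (u k l i + u k l j) +
      (s i k + s i l + (s j k + s j l)) = h.*2)%N.
  rewrite /= !inE !negb_or => /and3P[ij kl /and4P[/and3P[_ ik il] /andP[jk jl] _ _]].
  have [i5 j5] : (i < 5)%N /\ (j < 5)%N by lia.
  have [k5 l5] : (k < 5)%N /\ (l < 5)%N by lia.
  have [pij eij dij] := PP (i, j) ij; have [pkl ekl dkl] := PP (k, l) kl.
  rewrite /= in pij eij dij pkl ekl dkl.
  have := disjoint_paths_parity pij pkl; rewrite eij ekl => parity.
  eexists; apply/esym/even_halfK; rewrite !oddD !oddb parity ?addbb // => x /dij[] Ax /dkl[] Ax';
  by apply: branch_sets_disjoint Ax Ax' => //; exact/eqP.
move: (even_sum 0 1 2 3 isT) (even_sum 0 1 2 4 isT) (even_sum 0 1 3 4 isT)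
  (even_sum 0 2 1 3 isT) (even_sum 0 2 1 4 isT) (even_sum 0 2 3 4 isT)
  (even_sum 0 3 1 2 isT) (even_sum 0 3 1 4 isT) (even_sum 0 3 2 4 isT)
  (even_sum 0 4 1 2 isT) (even_sum 0 4 1 3 isT) (even_sum 0 4 2 3 isT)
  (even_sum 1 2 3 4 isT) (even_sum 1 3 2 4 isT) (even_sum 1 4 2 3 isT)
  (sN 0 1 isT) (sN 0 2 isT) (sN 0 3 isT) (sN 0 4 isT) (sN 1 2 isT)
  (sN 1 3 isT) (sN 1 4 isT) (sN 2 3 isT) (sN 2 4 isT) (sN 3 4 isT).
clear even_sum sN PP rA A_connected A_disjoint A_adjacent; clearbody u s.
do 15![case=> ? ?]; lia.
Qed.

End FiveBranchSets.

Lemma grid_K5_minor_free : K5_minor_free grid_adj.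
Proof. by move=> [A [A_connected A_disjoint A_adjacent]]; exact: (@no_five_branch_sets A). Qed.

End GridParity.

(** * Functions on a segment *)

Section Segments.
Local Open Scope ring_scope.
Variable R : realType.
Implicit Types (a b t x e k m : R).

Lemma within_itvP (T : topologicalType) (f : R -> T) a b :
  {within `[a, b], continuous f} <->
  forall t, a <= t <= b -> forall U, nbhs (f t) U ->
  exists2 e, 0 < e & forall x, a <= x <= b -> `|x - t| < e -> U (f x).
Proof.
rewrite subspace_continuousP; split=> f_cont t tab.
  move=> U fU; have /f_cont/(_ U fU) : `[a, b]%classic t by rewrite /= in_itv.
  rewrite /= => /nbhs_ballP[e e0 ball_U]; exists e => // x xab xt.
  by apply: (ball_U x); rewrite /ball /= 1?distrC // in_itv.
move=> U fU; rewrite /= in_itv /= in tab.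
have [e e0 near_t] := f_cont t tab U fU; apply/nbhs_ballP; exists e => // x xt.
by rewrite /= in_itv /= => xab; apply: near_t => //; rewrite distrC.
Qed.

Lemma within_itv_subset (T : topologicalType) (f : R -> T) a b a' b' : a <= a' -> b' <= b ->
  {within `[a, b], continuous f} -> {within `[a', b'], continuous f}.
Proof.
by move=> aa' b'b; apply: continuous_subspaceW => x; rewrite /= !in_itv /=; lra.
Qed.

Lemma within_itv_affine (T : topologicalType) (f : R -> T) k m a b a' b' :
  (forall t, a' <= t <= b' -> a <= k * t + m <= b) ->
  {within `[a, b], continuous f} -> {within `[a', b'], continuous (fun t => f (k * t + m))}.
Proof.
move=> km_ab /within_itvP f_cont; apply/within_itvP => t tab U fU.
have [e e0 near_t] := f_cont _ (km_ab t tab) U fU.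
have k0 : 0 < `|k| + 1 by rewrite ltr_pwDr.
exists (e / (`|k| + 1)); first exact: divr_gt0.
move=> x xab; rewrite ltr_pdivlMr // => xt; apply: near_t; first exact: km_ab.
have -> : k * x + m - (k * t + m) = k * (x - t) by ring.
by rewrite normrM; apply: le_lt_trans xt; rewrite mulrC ler_wpM2l // lerDl.
Qed.

Lemma within_itv_closed_left (T : topologicalType) (f : R -> T) (K : set T) a b t :
  {within `[a, b], continuous f} -> a < t <= b -> closed K ->
  (forall x, a <= x < t -> K (f x)) -> K (f t).
Proof.
move=> /within_itvP f_cont /andP[at_ tb] K_closed fK; apply: K_closed => V ftV.
have [|e e0 near_t] := f_cont t _ V ftV; first lra.
pose x := Num.max a (t - e / 2).
have ax : a <= x by rewrite le_max lexx.
have ex : t - e / 2 <= x by rewrite le_max lexx orbT.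
have xt : x < t by rewrite gt_max at_; lra.
by exists (f x); split; [apply: fK; rewrite ax|apply: near_t; rewrite ?ltr_norml; lra].
Qed.

Lemma itv01_rev t : t \in `[0, 1] -> 1 - t \in `[0, 1].
Proof. by rewrite !in_itv /=; lra. Qed.

Lemma within_itv_rev (T : topologicalType) (f : R -> T) :
  {within `[0, 1], continuous f} -> {within `[0, 1], continuous (fun t => f (1 - t))}.
Proof.
have -> : (fun t => f (1 - t)) = (fun t => f (-1 * t + 1)).
  by apply/funext => t; congr f; lra.
by apply: within_itv_affine => t; lra.
Qed.

Lemma within_itvZ (f : R -> R) k a b :
  {within `[a, b], continuous f} -> {within `[a, b], continuous (fun t => k * f t)}.
Proof. by move=> f_cont t; apply: cvgM; [exact: cvg_cst|exact: f_cont]. Qed.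

Lemma real_induction (P : R -> Prop) a b : P a ->
  (forall t, a <= t < b -> P t ->
     exists2 e, 0 < e & forall x, t < x < t + e -> x <= b -> P x) ->
  (forall t, a < t <= b -> (forall x, a <= x < t -> P x) -> P t) ->
  forall t, a <= t <= b -> P t.
Proof.
move=> Pa step closure t tab; apply: contrapT => nPt.
pose S := [set y | a <= y <= b /\ ~ P y]; have St : S t by [].
have S_lb : has_lbound S by exists a => y [/andP[]].
have S_inf : has_inf S by split; first exists t.
have am : a <= inf S by apply: lb_le_inf; [exists t|move=> y [/andP[]]].
have mt : inf S <= t by exact: ge_inf.
have below x : a <= x < inf S -> P x.
  move=> /andP[ax xm]; apply: contrapT => nPx; move: (xm); rewrite ltNge => /negP; apply.
  by apply: ge_inf => //; split=> //; lra.
have Pm : P (inf S).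
  have [<-//|am'] : a = inf S \/ a < inf S by lra.
  by apply: closure => //; rewrite am' (le_trans mt) //; case/andP: tab.
have mb : inf S < b.
  rewrite lt_neqAle (le_trans mt) ?andbT; last by case/andP: tab.
  apply/eqP => mE; apply: nPt; suff -> : t = inf S by [].
  by case/andP: tab => _ tb; lra.
have [|e e0 Pe] := step _ _ Pm; first by rewrite am.
have [y [yab nPy] ye] := inf_adherent e0 S_inf; have /andP[_ yb] := yab.
have my : inf S <= y by apply: ge_inf.
apply: nPy; have [<-//|my'] : inf S = y \/ inf S < y by lra.
by apply: Pe => //; rewrite my'.
Qed.

Lemma segment_induction (P : R -> R -> Prop) a b : a <= b ->
  (forall t, a <= t <= b -> exists2 e, 0 < e &
    forall x y, a <= x <= t -> t <= y <= b -> t - x < e -> y - t < e -> P x y) ->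
  (forall x y z, a <= x <= y -> y <= z <= b -> P x y -> P y z -> P x z) -> P a b.
Proof.
move=> ab local add; apply: (@real_induction (P a) a b); last by rewrite ab lexx.
- have [|e e0 Pe] := local a; first by rewrite lexx.
  by apply: Pe; rewrite ?lexx ?subrr.
- move=> t /andP[at_ tb] Pat; have [|e e0 Pe] := local t; first by rewrite at_ ltW.
  exists e => // x /andP[tx xe] xb; apply: (add a t) => //; first by rewrite lexx.
    by rewrite ltW.
  by apply: Pe; rewrite ?subrr ?lexx ?at_ ?(ltW tx) //; lra.
- move=> t /andP[at_ tb] Pa; have [|e e0 Pe] := local t; first by rewrite ltW.
  pose x := Num.max a (t - e / 2).
  have ax : a <= x by rewrite le_max lexx.
  have ex : t - e / 2 <= x by rewrite le_max lexx orbT.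
  have xt : x < t by rewrite gt_max at_; lra.
  apply: (add a x) => //; rewrite ?lexx ?ax ?(ltW xt) //; first by apply: Pa; rewrite ax.
  by apply: Pe; rewrite ?subrr ?lexx ?ax ?(ltW xt) //; lra.
Qed.

Definition glue (T : Type) b (f g : R -> T) t := if t <= b then f t else g t.

Lemma glue_left (T : Type) b (f g : R -> T) t : t <= b -> glue b f g t = f t.
Proof. by rewrite /glue => ->. Qed.

Lemma glue_right (T : Type) b (f g : R -> T) t : f b = g b -> b <= t -> glue b f g t = g t.
Proof.
rewrite /glue => fgb bt; case: (leP t b) => // tb.
by have -> : t = b by apply/eqP; rewrite eq_le tb.
Qed.

Lemma comp_glue (T U : Type) (h : T -> U) b (f g : R -> T) :
  h \o glue b f g = glue b (h \o f) (h \o g).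
Proof. by apply/funext => t; rewrite /glue /=; case: ifP. Qed.

Lemma within_itv_glue (T : topologicalType) (f g : R -> T) a b c : a <= b -> b <= c ->
  f b = g b -> {within `[a, b], continuous f} -> {within `[b, c], continuous g} ->
  {within `[a, c], continuous (glue b f g)}.
Proof.
move=> ab bc fgb f_cont g_cont.
have -> : `[a, c]%classic = `[a, b] `|` `[b, c].
  apply/seteqP; split=> x /=; rewrite !in_itv /=; last by case=> /andP[]; lra.
  by move=> /andP[ax xc]; have [xb|/ltW bx] := leP x b; [left|right]; rewrite ?ax ?bx.
apply: withinU_continuous; [exact: itv_closed|exact: itv_closed| |].
  apply: subspace_eq_continuous f_cont => t; rewrite inE /= in_itv /= => /andP[_ tb].
  exact/esym/glue_left.
apply: subspace_eq_continuous g_cont => t; rewrite inE /= in_itv /= => /andP[bt _].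
exact/esym/glue_right.
Qed.

End Segments.

(** * Arcs *)

Section Arcs.
Local Open Scope ring_scope.
Variables (R : realType) (E : normedModType R).
Implicit Types (a b c : E) (S T : set E) (s t : R).

Definition is_arc a b S := exists f : R -> E,
  [/\ {within `[0, 1], continuous f}, {in `[0, 1] &, injective f}, f 0 = a, f 1 = b &
      S = f @` `[0, 1]].

Definition segment_set a b : set E := [set a + t *: (b - a) | t in `[0, 1]].

Lemma arc_segment a b : a <> b -> is_arc a b (segment_set a b).
Proof.
move=> ab; exists (fun t => a + t *: (b - a)); split=> //.
- apply: continuous_subspaceT => t; apply: cvgD; first exact: cvg_cst.
  by apply: cvgZ; [exact: cvg_id|exact: cvg_cst].
- move=> s t _ _ /addrI/eqP; rewrite -subr_eq0 -scalerBl scaler_eq0 !subr_eq0.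
  by case/orP => /eqP // ba; case: ab.
- by rewrite scale0r addr0.
- by rewrite scale1r addrC subrK.
Qed.

Lemma arc_end a b S : is_arc a b S -> S b.
Proof. by move=> [f [_ _ _ <- ->]]; exists 1; rewrite //= in_itv /= lexx ler01. Qed.

Lemma arc_rev a b S : is_arc a b S -> is_arc b a S.
Proof.
move=> [f [f_cont f_inj f0 f1 ->]]; exists (fun t => f (1 - t)).
split; [exact: within_itv_rev| |by rewrite subr0|by rewrite subrr|].
  by move=> s t /itv01_rev s1 /itv01_rev t1 /(f_inj _ _ s1 t1); lra.
apply/seteqP; split=> x [t tI <-]; exists (1 - t); try exact: itv01_rev tI; last by [].
by rewrite subKr.
Qed.

Lemma arc_cat a b c S T : is_arc a b S -> is_arc b c T ->
  (forall x, S x -> T x -> x = b) -> is_arc a c (S `|` T).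
Proof.
move=> [f [f_cont f_inj f0 f1 SE]] [g [g_cont g_inj g0 g1 TE]] ST.
pose f2 t := f (2 * t + 0); pose g2 t := g (2 * t + -1).
have fg2 : f2 (1 / 2) = g2 (1 / 2).
  have e1 : 2 * (1 / 2) + 0 = 1 :> R by lra.
  have e0 : 2 * (1 / 2) + -1 = 0 :> R by lra.
  by rewrite /f2 /g2 e1 e0 f1 g0.
have fI t : t \in `[0, 1] -> t <= 1 / 2 -> 2 * t + 0 \in `[0, 1] by rewrite !in_itv /=; lra.
have gI t : t \in `[0, 1] -> 1 / 2 <= t -> 2 * t + -1 \in `[0, 1] by rewrite !in_itv /=; lra.
have f_end t : t \in `[0, 1] -> f t = b -> t = 1.
  by move=> tI ftb; apply: f_inj => //; rewrite ?ftb ?f1 // in_itv /= lexx ler01.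
have g_start t : t \in `[0, 1] -> g t = b -> t = 0.
  by move=> tI gtb; apply: g_inj => //; rewrite ?gtb ?g0 // in_itv /= lexx ler01.
have mixed s t : s \in `[0, 1] -> t \in `[0, 1] -> s <= 1 / 2 -> 1 / 2 <= t ->
    f2 s = g2 t -> s = t.
  move=> sI tI s2 t2 fg; have {}sI := fI s sI s2; have {}tI := gI t tI t2.
  have fb : f2 s = b by apply: ST; [rewrite SE|rewrite fg TE]; eexists; try reflexivity.
  by have := f_end _ sI fb; have := g_start _ tI (etrans (esym fg) fb); lra.
exists (glue (1 / 2) f2 g2); split.
- apply: (within_itv_glue _ _ fg2); [lra|lra| |].
    by apply: within_itv_affine f_cont => t; lra.
  by apply: within_itv_affine g_cont => t; lra.
- move=> s t sI tI; rewrite /glue; case: (lerP s (1 / 2)) => s2; case: (lerP t (1 / 2)) => t2.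
  + by move/f_inj => h; have := h (fI _ sI s2) (fI _ tI t2); lra.
  + exact: mixed (ltW t2).
  + by move/esym => h; apply/esym; exact: mixed (ltW s2) h.
  + by move/g_inj => h; have := h (gI _ sI (ltW s2)) (gI _ tI (ltW t2)); lra.
- by rewrite glue_left /f2 ?mulr0 ?add0r //; lra.
- rewrite glue_right /g2 //; last lra.
  by have -> : 2 * 1 + -1 = 1 :> R by lra.
- rewrite SE TE; apply/seteqP; split=> x.
    case=> -[t tI <-]; rewrite /= in_itv /= in tI.
      exists (t / 2); first by rewrite /= in_itv /=; lra.
      by rewrite glue_left /f2; [congr f; lra|lra].
    exists ((t + 1) / 2); first by rewrite /= in_itv /=; lra.
    by rewrite glue_right /g2 //; [congr g; lra|lra].
  move=> [t tI <-]; case: (lerP t (1 / 2)) => t2.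
    by left; rewrite glue_left //; exists (2 * t + 0) => //; exact: fI.
  by right; rewrite glue_right ?(ltW t2) //; exists (2 * t + -1) => //; exact: gI (ltW t2).
Qed.

End Arcs.

(** * Vectors of the plane *)

Section PlaneVectors.
Local Open Scope ring_scope.
Variable R : realType.
Implicit Types (v w : 'rV[R]_2) (G : 'M[R]_2).

Lemma forall_ord2 (P : 'I_2 -> Prop) : P 0 -> P 1 -> forall j, P j.
Proof.
move=> P0 P1 j; case: (unliftP 0 j) => [k|] -> //.
by have -> : lift 0 k = 1 by apply/val_inj; rewrite /= ord1.
Qed.

Definition row2 (a b : R) : 'rV[R]_2 := \row_j (if j == 0 then a else b).

Lemma row2_0 a b : row2 a b 0 0 = a.
Proof. by rewrite mxE. Qed.

Lemma row2_1 a b : row2 a b 0 1 = b.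
Proof. by rewrite mxE. Qed.

Lemma row2_ext v w : v 0 0 = w 0 0 -> v 0 1 = w 0 1 -> v = w.
Proof. by move=> vw0 vw1; apply/rowP; exact: forall_ord2. Qed.

Lemma mx_entry_norm_le m n (v : 'M[R]_(m, n)) (j : 'I_m) (k : 'I_n) : `|v j k| <= `|v|.
Proof.
rewrite [X in _ <= X](_ : _ = mx_norm v) // mx_normrE.
exact: (@le_bigmax _ _ _ 0 (fun ij : 'I_m * 'I_n => `|v ij.1 ij.2|) (j, k)).
Qed.

Lemma norm_row2_le v r : `|v 0 0| <= r -> `|v 0 1| <= r -> `|v| <= r.
Proof.
move=> v0 v1; rewrite (_ : `|v| = mx_norm v) // mx_normrE.
apply: bigmax_le => [|[j k] _ /=]; first exact: le_trans (normr_ge0 _) v0.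
by rewrite ord1; move: k; exact: forall_ord2.
Qed.

Lemma compact_norm_le (x : 'rV[R]_2) (r : R) : compact [set y | `|x - y| <= r].
Proof.
apply: bounded_closed_compact.
  exists (`|x| + r); split; first exact: num_real.
  move=> B ltB y /= xy; apply: le_trans (ltW ltB); rewrite -[y](subKr x).
  by apply: le_trans (ler_normB _ _) _; rewrite lerD2l.
exact: closed_closed_ball_.
Qed.

Lemma bilin_row2 G v w : bilin G v w =
  (v 0 0 * G 0 0 + v 0 1 * G 1 0) * w 0 0 + (v 0 0 * G 0 1 + v 0 1 * G 1 1) * w 0 1.
Proof.
rewrite /bilin !mxE !big_ord_recl !big_ord0 !mxE !big_ord_recl !big_ord0.
have -> : lift ord0 (ord0 : 'I_1) = 1 :> 'I_2 by apply/val_inj.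
by rewrite !addr0.
Qed.

Lemma bilinZ G k v : bilin G (k *: v) (k *: v) = k ^+ 2 * bilin G v v.
Proof. by rewrite /bilin linearZ /= -!scalemxAl -scalemxAr !mxE expr2 mulrA. Qed.

End PlaneVectors.

(** * Planar drawings from arcs *)

Section PlanarDrawing.
Local Open Scope ring_scope.
Variables (R : realType) (G : graph).
Variables (code : vertex G -> nat) (pos : vertex G -> 'rV[R]_2).
Variable edge : vertex G -> vertex G -> set 'rV[R]_2.
Hypothesis code_inj : injective code.
Hypothesis pos_inj : injective pos.
Hypothesis edge_arc : forall u v, adj u v -> is_arc (pos u) (pos v) (edge u v).
Hypothesis edge_vertex : forall u v w, adj u v -> edge u v (pos w) -> w = u \/ w = v.
Hypothesis edges_meet : forall u v u' v' x, adj u v -> adj u' v' ->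
  edge u v x -> edge u' v' x ->
  (exists w, x = pos w) \/ (u = u' /\ v = v') \/ (u = v' /\ v = u').

Definition parametrizes (u v : vertex G) (f : R -> 'rV[R]_2) :=
  [/\ {within `[0, 1], continuous f}, {in `[0, 1] &, injective f},
      f 0 = pos u, f 1 = pos v & forall t, t \in `[0, 1] -> edge u v (f t)].

Lemma parametrization_exists : exists F : vertex G -> vertex G -> R -> 'rV[R]_2,
  forall u v, adj u v -> parametrizes u v (F u v).
Proof.
suff /choice[F FP] : forall uv : vertex G * vertex G, exists f,
    adj uv.1 uv.2 -> parametrizes uv.1 uv.2 f.
  by exists (fun u v => F (u, v)) => u v; exact: FP (u, v).
move=> [u v] /=; have [uv|nuv] := pselect (adj u v); last by exists (fun=> 0) => /nuv.
have [f [f_cont f_inj f0 f1 fE]] := edge_arc uv; exists f => _; split=> // t tI.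
by rewrite fE; exists t.
Qed.

Section OrientedArcs.
Variable F : vertex G -> vertex G -> R -> 'rV[R]_2.
Hypothesis FP : forall u v, adj u v -> parametrizes u v (F u v).

Definition oriented_arc u v : R -> 'rV[R]_2 :=
  if (code u < code v)%N then F u v else fun t => F v u (1 - t).

Lemma interior_not_vertex u v w t : adj u v -> 0 < t < 1 -> F u v t <> pos w.
Proof.
move=> uv /andP[t0 t1] Ftw; have [_ F_inj F0 F1 F_edge] := FP uv.
have tI : t \in `[0, 1] by rewrite in_itv /= !ltW.
have := F_edge t tI; rewrite Ftw => /(edge_vertex uv)[wu|wv].
  have : t = 0 by apply: F_inj; rewrite ?in_itv /= ?lexx ?ler01 // Ftw F0 wu.
  by move=> tE; rewrite tE ltxx in t0.
have : t = 1 by apply: F_inj; rewrite ?in_itv /= ?lexx ?ler01 // Ftw F1 wv.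
by move=> tE; rewrite tE ltxx in t1.
Qed.

Lemma interiors_meet u v u' v' s t : adj u v -> adj u' v' -> 0 < s < 1 -> 0 < t < 1 ->
  F u v s = F u' v' t -> (u = u' /\ v = v') \/ (u = v' /\ v = u').
Proof.
move=> uv uv' sI tI Fst; have [_ _ _ _ edge_s] := FP uv; have [_ _ _ _ edge_t] := FP uv'.
have s_closed : s \in `[0, 1] by rewrite in_itv /=; case/andP: sI => *; rewrite !ltW.
have t_closed : t \in `[0, 1] by rewrite in_itv /=; case/andP: tI => *; rewrite !ltW.
have es := edge_s s s_closed; have := edge_t t t_closed; rewrite -Fst.
by case/(edges_meet uv uv' es) => // -[w /(interior_not_vertex uv sI)].
Qed.

Lemma oriented_arc_interior u v t : adj u v -> 0 < t < 1 ->
  exists u' v' s, [/\ adj u' v', (u', v') = (u, v) \/ (u', v') = (v, u), 0 < s < 1 &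
    oriented_arc u v t = F u' v' s].
Proof.
move=> uv tI; rewrite /oriented_arc; case: ifP => _; first by exists u, v, t; split=> //; left.
by exists v, u, (1 - t); split=> //; [exact: adj_sym|right|lra].
Qed.

Lemma oriented_arcP u v : adj u v ->
  [/\ {within `[0, 1], continuous (oriented_arc u v)},
      {in `[0, 1] &, injective (oriented_arc u v)},
      oriented_arc u v 0 = pos u, oriented_arc u v 1 = pos v &
      forall t : R, 0 <= t <= 1 -> oriented_arc v u t = oriented_arc u v (1 - t)].
Proof.
move=> uv; have [F_cont F_inj F0 F1 _] := FP uv.
have [F_cont' F_inj' F0' F1' _] := FP (adj_sym uv).
rewrite /oriented_arc; case: (ltngtP (code u) (code v)) => [_|_|/code_inj uE]; last first.
- by case: (@adj_irrefl G v); rewrite -{1}uE.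
- split; [exact: within_itv_rev| |by rewrite subr0|by rewrite subrr|].
    by move=> s t /itv01_rev sI /itv01_rev tI /(F_inj' _ _ sI tI); lra.
  by move=> t _; rewrite subKr.
- by split.
Qed.

End OrientedArcs.

Lemma planar_graph_of_arcs : planar_graph R G.
Proof.
have [F FP] := parametrization_exists.
exists pos, (oriented_arc F); split=> // [u v|u v w t uv tI|u v u' v' s t uv uv' sI tI].
- exact: oriented_arcP.
- have [u' [v' [s [uv' _ sI ->]]]] := oriented_arc_interior F uv tI.
  exact: interior_not_vertex.
have [u1 [v1 [s1 [uv1 e1 s1I ->]]]] := oriented_arc_interior F uv sI.
have [u2 [v2 [s2 [uv2 e2 s2I ->]]]] := oriented_arc_interior F uv' tI.
move/(interiors_meet FP uv1 uv2 s1I s2I).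
by case: e1 => -[-> ->]; case: e2 => -[-> ->] [] [-> ->]; (try by left); by right.
Qed.

End PlanarDrawing.

(** * Routing the edges through the cells of the clusters *)

Section Strands.
Local Open Scope ring_scope.
Variable R : realType.
Implicit Types (q d u : Z2) (t : R) (w : 'rV[R]_2).

(* [lra] and [nra] need a goal over an ordered ring. *)
Local Ltac absurd_lra := exfalso; have : (1 : R) <= 0; [lra|by rewrite ler10].
Local Ltac absurd_nra := exfalso; have : (1 : R) <= 0; [nra|by rewrite ler10].

Definition turn d : Z2 := (- d.2, d.1).

Lemma turn_turn d : turn (turn d) = - d.
Proof. by case: d. Qed.

Lemma turnN d : turn (- d) = - turn d.
Proof. by case: d. Qed.

Lemma unit_dir_turn_cases u d : unit_dir u -> unit_dir d ->
  [\/ d = u, d = - u, d = turn u | d = - turn u].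
Proof.
by case/unit_dirP => -> /unit_dirP[] ->;
  first [apply: Or41; by []|apply: Or42; by []|apply: Or43; by []|apply: Or44; by []].
Qed.

Lemma unit_dir_turn_neq u : unit_dir u ->
  [/\ - u == - turn u = false, turn u == - turn u = false & turn u == - u = false].
Proof. by case/unit_dirP => ->. Qed.

(* The unit cells are centered at the lattice points. *)
Definition lattice q : 'rV[R]_2 := row2 q.1%:~R q.2%:~R.

Definition side_point q d t : 'rV[R]_2 :=
  lattice q + (1 / 2) *: lattice d + (t - 1 / 2) *: lattice (turn d).

Definition offset w q u : R :=
  (w 0 0 - q.1%:~R) * u.1%:~R + (w 0 1 - q.2%:~R) * u.2%:~R.

Definition unit_dirE := (mulrNz, mulr0z, mulr1z).

Lemma lattice_inj : injective lattice.
Proof.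
move=> [a b] [a' b'] /rowP e; have := e 0; have := e 1; rewrite !mxE /=.
by move=> /intr_inj -> /intr_inj ->.
Qed.

Lemma offsetN w q u : offset w q (- u) = - offset w q u.
Proof. by rewrite /offset /= !mulrNz; ring. Qed.

Lemma offset_inj w w' q u : unit_dir u -> offset w q u = offset w' q u ->
  offset w q (turn u) = offset w' q (turn u) -> w = w'.
Proof.
rewrite /offset /turn => /unit_dirP[] -> /=; rewrite ?unit_dirE => e1 e2;
  by apply: row2_ext; lra.
Qed.

Lemma offset_side_point q d t : unit_dir d -> offset (side_point q d t) q d = 1 / 2 /\
  offset (side_point q d t) q (turn d) = t - 1 / 2.
Proof.
by case/unit_dirP => ->; rewrite /offset /turn !mxE /= ?unit_dirE; split; lra.
Qed.

Lemma offset_lattice q u : offset (lattice q) q u = 0.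
Proof. by rewrite /offset /lattice row2_0 row2_1; ring. Qed.

Lemma offset_segment w w' l q u :
  offset (w + l *: (w' - w)) q u = offset w q u + l * (offset w' q u - offset w q u).
Proof. by rewrite /offset !mxE; ring. Qed.

Lemma side_pointN q d t : unit_dir d -> side_point (q + d) (- d) (1 - t) = side_point q d t.
Proof.
case/unit_dirP => ->; apply: row2_ext; rewrite !mxE /= ?intrD ?unit_dirE; lra.
Qed.

(* A spanning forest: each cell of a cluster leads to that of its center. *)
Variables (center parent : Z2 -> Z2) (depth : Z2 -> nat).
Hypothesis parentP : forall z, z <> center z ->
  [/\ unit_dir (parent z), center (z + parent z) = center z & (depth (z + parent z)%R < depth z)%N].

(* A strand runs from the center of a cluster to the position [t] of the side [d]
   of the cell of [q].  In that cell it is the chord from the position [entry] of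
   the parent side: the line [X = entry + Y * slope] for [0 < Y <= height], in the
   frame whose [X]-axis is the parent side. *)
Definition outlet q d t := [/\ unit_dir d, 0 < t < 1 & q <> center q -> d <> parent q].

Definition entry q d t : R :=
  if d == - turn (parent q) then (1 - t) / 3
  else if d == - parent q then (2 - t) / 3 else 1 - t / 3.

Definition slope q d t : R :=
  if d == - turn (parent q) then - 1 / 3
  else if d == - parent q then (1 - 2 * t) / 3 else 1 / 3.

Definition height q d t : R :=
  if d == - turn (parent q) then 1 - t else if d == - parent q then 1 else t.

Definition center_chord q d t : set 'rV[R]_2 := [set w | exists2 l : R, 0 <= l <= 1 &
  offset w q d = l / 2 /\ offset w q (turn d) = l * (t - 1 / 2)].

Definition inner_chord q d t : set 'rV[R]_2 := [set w |
  let X := 1 / 2 + offset w q (turn (parent q)) in let Y := 1 / 2 - offset w q (parent q) in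
  [/\ 0 < Y, Y <= height q d t & X = entry q d t + Y * slope q d t]].

Definition chord q d t := if q == center q then center_chord q d t else inner_chord q d t.

Lemma inner_outletP q d t : q <> center q -> outlet q d t ->
  [\/ [/\ d = - turn (parent q), entry q d t = (1 - t) / 3, slope q d t = - 1 / 3 &
          height q d t = 1 - t],
      [/\ d = - parent q, entry q d t = (2 - t) / 3, slope q d t = (1 - 2 * t) / 3 &
          height q d t = 1] |
      [/\ d = turn (parent q), entry q d t = 1 - t / 3, slope q d t = 1 / 3 &
          height q d t = t]].
Proof.
move=> qc [dir_d _ /(_ qc) d_parent]; have [dir_p _ _] := parentP qc.
have [n1 n2 n3] := unit_dir_turn_neq dir_p; rewrite /entry /slope /height.
case: (unit_dir_turn_cases dir_p dir_d) => [/d_parent//|->|->|->].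
- by apply: Or32; rewrite n1 eqxx.
- by apply: Or33; rewrite n2 n3.
- by apply: Or31; rewrite eqxx.
Qed.

Lemma side_point_eq q d t w : unit_dir d ->
  offset w q d = 1 / 2 -> offset w q (turn d) = t - 1 / 2 -> w = side_point q d t.
Proof.
move=> dir_d wd wr; have [sd sr] := offset_side_point q t dir_d.
by apply: (offset_inj dir_d (q := q)); rewrite ?wd ?wr ?sd ?sr.
Qed.

Lemma center_chord_in_cell q d t w u : outlet q d t -> center_chord q d t w -> unit_dir u ->
  offset w q u <= 1 / 2 /\ (offset w q u = 1 / 2 -> u = d /\ w = side_point q d t).
Proof.
move=> [dir_d /andP[t0 t1] _] [l /andP[l0 l1] [wd wr]] dir_u.
have r_lt : l * (t - 1 / 2) < 1 / 2 by nra.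
have r_gt : - (l * (t - 1 / 2)) < 1 / 2 by nra.
case: (unit_dir_turn_cases dir_d dir_u) => ->; rewrite ?offsetN ?wd ?wr.
- split=> [|l2]; first lra; split=> //; apply: side_point_eq; rewrite // ?wd ?wr; first lra.
  by have -> : l = 1; [lra|rewrite mul1r].
- by split; [lra|move=> ?; absurd_lra].
- by split; [lra|move=> ?; absurd_lra].
- by split; [lra|move=> ?; absurd_lra].
Qed.

Lemma inner_chord_in_cell q d t w u : q <> center q -> outlet q d t -> inner_chord q d t w ->
  unit_dir u ->
  offset w q u <= 1 / 2 /\ (offset w q u = 1 / 2 -> u = d /\ w = side_point q d t).
Proof.
move=> qc out_d; have [dir_p _ _] := parentP qc; have [dir_d /andP[t0 t1] _] := out_d.
set X := offset w q (turn (parent q)); set Y := offset w q (parent q).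
rewrite /inner_chord /= -/X -/Y => -[Y0 Y1 XY] dir_u.
have exitE a b : offset w q d = a -> offset w q (turn d) = b -> a = 1 / 2 -> b = t - 1 / 2 ->
  w = side_point q d t by move=> <- <-; exact: side_point_eq.
case: (inner_outletP qc out_d) => -[dE pE sE yE]; rewrite pE sE in XY; rewrite yE in Y1;
  rewrite dE ?(turnN, turn_turn, offsetN, opprK) -/X -/Y in exitE;
  have {}exitE := exitE _ _ erefl erefl;
  case: (unit_dir_turn_cases dir_p dir_u) => ->; rewrite ?offsetN -/X -/Y;
  (split; [nra|move=> side]); try by [absurd_nra].
- by rewrite dE; split=> //; apply: exitE; lra.
- rewrite dE; split=> //; apply: exitE; first lra.
  have YE : Y = - (1 / 2) by lra.
  by rewrite YE in XY; lra.
- by rewrite dE; split=> //; apply: exitE; lra.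
Qed.

Lemma chord_in_cell q d t w u : outlet q d t -> chord q d t w -> unit_dir u ->
  offset w q u <= 1 / 2 /\ (offset w q u = 1 / 2 -> u = d /\ w = side_point q d t).
Proof.
move=> out_d; rewrite /chord; case: eqP => qc; first exact: center_chord_in_cell.
exact: inner_chord_in_cell.
Qed.

Lemma center_chords_meet q d t d' t' w : outlet q d t -> outlet q d' t' ->
  center_chord q d t w -> center_chord q d' t' w -> (d = d' /\ t = t') \/ w = lattice q.
Proof.
move=> [dir_d /andP[t0 t1] _] [dir_d' /andP[s0 s1] _].
move=> [l /andP[l0 l1] [wd wr]] [k /andP[k0 k1] [wd' wr']].
have [l00|lp] : l = 0 \/ 0 < l by lra.
  right; apply: (offset_inj dir_d (q := q)).
    by rewrite wd l00 offset_lattice; lra.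
  by rewrite wr l00 offset_lattice; lra.
left; case: (unit_dir_turn_cases dir_d dir_d') => dE;
  rewrite dE ?(turnN, turn_turn, offsetN, opprK) wd wr in wd' wr'.
- split=> //; have lk : l = k by lra.
  rewrite lk in wr' lp; have : k * (t - t') = 0 by lra.
  by move/eqP; rewrite mulf_eq0 => /orP[/eqP|/eqP]; lra.
- by absurd_lra.
- by absurd_nra.
- by absurd_nra.
Qed.

Lemma inner_chords_meet q d t d' t' w : q <> center q -> outlet q d t -> outlet q d' t' ->
  inner_chord q d t w -> inner_chord q d' t' w -> d = d' /\ t = t'.
Proof.
move=> qc out_d out_d'; have [_ /andP[t0 t1] _] := out_d; have [_ /andP[s0 s1] _] := out_d'.
rewrite /inner_chord /=; set Y := _ - offset w q _; set X := _ + _.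
move=> [Y0 Y1 XY] [_ Y1' XY'].
case: (inner_outletP qc out_d) => -[dE pE sE yE];
  case: (inner_outletP qc out_d') => -[dE' pE' sE' yE'];
  rewrite pE sE in XY; rewrite pE' sE' in XY'; rewrite yE in Y1; rewrite yE' in Y1';
  rewrite dE dE'; try by [absurd_nra].
- by split=> //; lra.
- split=> //; have : (t - t') * (1 + 2 * Y) = 0 by lra.
  by move/eqP; rewrite mulf_eq0 => /orP[/eqP|/eqP]; lra.
- by split=> //; lra.
Qed.

Lemma chords_meet_in_cell q d t d' t' w : outlet q d t -> outlet q d' t' ->
  chord q d t w -> chord q d' t' w -> (d = d' /\ t = t') \/ q = center q /\ w = lattice q.
Proof.
move=> out_d out_d'; rewrite /chord; case: eqP => qc qw q'w.
  by have [|->] := center_chords_meet out_d out_d' qw q'w; [left|right].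
by left; exact: inner_chords_meet qc out_d out_d' qw q'w.
Qed.

Lemma int_dist_le1 (a b : int) : (a%:~R - b%:~R <= 1 :> R) -> (b%:~R - a%:~R <= 1 :> R) ->
  [\/ a = b, a = b + 1 | b = a + 1].
Proof.
rewrite -!intrB !(ler_int R _ 1) => ab ba.
have [->|[->|->]] : a = b \/ a = b + 1 \/ b = a + 1 by lia.
- exact: Or31.
- exact: Or32.
- exact: Or33.
Qed.

(* Two cells that share a point differ by a step or by a diagonal step. *)
Lemma cells_share_point q q' w :
  (forall u, unit_dir u -> offset w q u <= 1 / 2 /\ offset w q' u <= 1 / 2) -> q <> q' ->
  exists2 u, unit_dir u & [/\ offset w q u = 1 / 2, offset w q' (- u) = 1 / 2 &
    q' = q + u \/ exists2 v, unit_dir v & v <> u /\ offset w q v = 1 / 2].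
Proof.
move=> in_cells.
have [E E'] := in_cells (1, 0) isT; have [N N'] := in_cells (0, 1) isT.
have [W W'] := in_cells (-1, 0) isT; have [S S'] := in_cells (0, -1) isT.
move: E E' N N' W W' S S'; rewrite /offset /= ?unit_dirE; case: q q' {in_cells} => [x y] [x' y'] /=.
move: (w 0 0) (w 0 1) => p r E E' N N' W W' S S'.
have [xE|xE|xE] : [\/ x' = x, x' = x + 1 | x = x' + 1] by apply: int_dist_le1; lra.
- have [yE|yE|yE] : [\/ y' = y, y' = y + 1 | y = y' + 1] by apply: int_dist_le1; lra.
  + by rewrite xE yE.
  + exists (0, 1) => //; subst; rewrite /= ?intrD ?unit_dirE in E E' N N' W W' S S' *.
    by split; [lra|lra|left; congr pair; rewrite addr0].
  + exists (0, -1) => //; subst; rewrite /= ?intrD ?unit_dirE in E E' N N' W W' S S' *.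
    by split; [lra|lra|left; congr pair; rewrite ?addr0 ?addrK].
- exists (1, 0) => //; subst; rewrite /= ?intrD ?unit_dirE in E E' N N' W W' S S' *.
  split; [lra|lra|].
  have [yE|yE|yE] : [\/ y' = y, y' = y + 1 | y = y' + 1] by apply: int_dist_le1; lra.
  + by left; rewrite yE; congr pair; rewrite addr0.
  + by right; exists (0, 1) => //; split=> //; rewrite /= yE intrD ?unit_dirE in S' *; lra.
  + by right; exists (0, -1) => //; split=> //; rewrite /= yE intrD ?unit_dirE in N' S *; lra.
- exists (-1, 0) => //; subst; rewrite /= ?intrD ?unit_dirE in E E' N N' W W' S S' *.
  split; [lra|lra|].
  have [yE|yE|yE] : [\/ y' = y, y' = y + 1 | y = y' + 1] by apply: int_dist_le1; lra.
  + by left; rewrite yE; congr pair; rewrite ?addr0 ?addrK.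
  + by right; exists (0, 1) => //; split=> //; rewrite /= yE intrD ?unit_dirE in S' *; lra.
  + by right; exists (0, -1) => //; split=> //; rewrite /= yE intrD ?unit_dirE in N' S *; lra.
Qed.

Lemma chords_meet_across_cells q d t q' d' t' w : outlet q d t -> outlet q' d' t' ->
  chord q d t w -> chord q' d' t' w -> q <> q' ->
  [/\ q' = q + d, d' = - d & w = side_point q d t].
Proof.
move=> out_d out_d' qw q'w qq'.
have [|//|u dir_u [qu q'u cell_step]] := @cells_share_point q q' w.
  by move=> u dir_u; have [-> _] := chord_in_cell out_d qw dir_u;
     have [-> _] := chord_in_cell out_d' q'w dir_u.
have [_ /(_ qu)[uE wE]] := chord_in_cell out_d qw dir_u.
have [_ /(_ q'u)[u'E _]] := chord_in_cell out_d' q'w (unit_dirN dir_u).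
case: cell_step => [->|[v dir_v [vu qv]]]; first by rewrite uE -u'E uE.
by have [_ /(_ qv)[vE _]] := chord_in_cell out_d qw dir_v; case: vu; rewrite vE uE.
Qed.

Lemma entry_bounds q d t : q <> center q -> outlet q d t -> 0 < entry q d t < 1.
Proof.
move=> qc out_d; have [_ /andP[t0 t1] _] := out_d.
by case: (inner_outletP qc out_d) => -[_ -> _ _]; lra.
Qed.

Lemma height_gt0 q d t : q <> center q -> outlet q d t -> 0 < height q d t.
Proof.
move=> qc out_d; have [_ /andP[t0 t1] _] := out_d.
by case: (inner_outletP qc out_d) => -[_ _ _ ->]; lra.
Qed.

Lemma entry_inj q d t d' t' : q <> center q -> outlet q d t -> outlet q d' t' ->
  entry q d t = entry q d' t' -> d = d' /\ t = t'.
Proof.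
move=> qc out_d out_d'; have [_ /andP[t0 t1] _] := out_d; have [_ /andP[s0 s1] _] := out_d'.
case: (inner_outletP qc out_d) => -[dE -> _ _]; case: (inner_outletP qc out_d') => -[dE' -> _ _] e;
  rewrite dE dE'; try by [absurd_lra]; by split=> //; lra.
Qed.

Lemma parent_outlet q d t : q <> center q -> outlet q d t ->
  outlet (q + parent q) (- parent q) (1 - entry q d t).
Proof.
move=> qc out_d; have [dir_p _ depth_lt] := parentP qc; have /andP[e0 e1] := entry_bounds qc out_d.
split; [exact: unit_dirN|lra|move=> pc pE].
by have [_ _] := parentP pc; rewrite -pE addrK => /(ltn_trans depth_lt); rewrite ltnn.
Qed.

(* The successive outlets on the way from the outlet [(q, d, t)] to the center. *)
Inductive route q d t : Z2 -> Z2 -> R -> Prop :=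
| route_refl : route q d t q d t
| route_next q' d' t' : route q d t q' d' t' -> q' <> center q' ->
    route q d t (q' + parent q') (- parent q') (1 - entry q' d' t').

Lemma route_outlet q d t q' d' t' : outlet q d t -> route q d t q' d' t' -> outlet q' d' t'.
Proof. by move=> out_d; elim=> // *; apply: parent_outlet. Qed.

Lemma route_center q d t q' d' t' : route q d t q' d' t' -> center q' = center q.
Proof. by elim=> // q1 d1 t1 _ e /parentP[_ -> _]. Qed.

Lemma route_depth q d t q' d' t' : route q d t q' d' t' -> (depth q' <= depth q)%N.
Proof. by elim=> // q1 d1 t1 _ le /parentP[_ _ /ltnW lt]; apply: leq_trans lt le. Qed.

Lemma route_last q d t q' d' t' : route q d t q' d' t' ->
  [/\ q' = q, d' = d & t' = t] \/ exists q1 d1 t1, [/\ route q d t q1 d1 t1, q1 <> center q1,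
    q' = q1 + parent q1, d' = - parent q1 & t' = 1 - entry q1 d1 t1].
Proof. by case=> [|q1 d1 t1 rt n]; [left|right; exists q1, d1, t1]. Qed.

Lemma route_first q d t q' d' t' : route q d t q' d' t' ->
  [/\ q' = q, d' = d & t' = t] \/
  q <> center q /\ route (q + parent q) (- parent q) (1 - entry q d t) q' d' t'.
Proof.
elim=> [|q1 d1 t1 _ [[-> -> ->]|[qc rt]] n]; first by left.
  by right; split=> //; apply: route_refl.
by right; split=> //; apply: route_next.
Qed.

Lemma route_cons q d t q' d' t' : q <> center q ->
  route (q + parent q) (- parent q) (1 - entry q d t) q' d' t' -> route q d t q' d' t'.
Proof.
move=> qc; elim=> [|q1 d1 t1 _ rt n]; last exact: route_next.
by apply: route_next => //; apply: route_refl.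
Qed.

Definition strand q d t : set 'rV[R]_2 :=
  [set w | exists q' d' t', route q d t q' d' t' /\ chord q' d' t' w].

Lemma strand_center q d t : q = center q -> strand q d t = chord q d t.
Proof.
move=> qc; apply/seteqP; split=> w.
  by move=> [q' [d' [t' [/route_first[[-> -> ->]|[]]]]]].
by move=> qw; exists q, d, t; split=> //; apply: route_refl.
Qed.

Lemma strand_next q d t : q <> center q ->
  strand q d t = chord q d t `|` strand (q + parent q) (- parent q) (1 - entry q d t).
Proof.
move=> qc; apply/seteqP; split=> w.
  move=> [q' [d' [t' [/route_first[[-> -> ->]|[_ rt]] q'w]]]]; first by left.
  by right; exists q', d', t'.
move=> [qw|[q' [d' [t' [rt q'w]]]]]; first by exists q, d, t; split=> //; apply: route_refl.
by exists q', d', t'; split=> //; apply: route_cons.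
Qed.

Lemma center_chord_segment q d t : q = center q -> outlet q d t ->
  chord q d t = segment_set (lattice q) (side_point q d t).
Proof.
move=> qc [dir_d _ _]; have [sd sr] := offset_side_point q t dir_d.
rewrite /chord -qc eqxx; apply/seteqP; split=> w.
  move=> [l l01 [wd wr]]; exists l; rewrite /= ?in_itv //; apply: (offset_inj dir_d (q := q));
  by rewrite offset_segment offset_lattice ?sd ?sr ?wd ?wr; lra.
move=> [l]; rewrite /= in_itv /= => l01 <-; exists l => //.
by rewrite !offset_segment !offset_lattice sd sr; split; lra.
Qed.

Lemma side_point_chord q d t : q <> center q -> outlet q d t ->
  1 / 2 + offset (side_point q d t) q (turn (parent q)) =
    entry q d t + height q d t * slope q d t /\
  1 / 2 - offset (side_point q d t) q (parent q) = height q d t.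
Proof.
move=> qc out_d; have [dir_d _ _] := out_d; have [] := offset_side_point q t dir_d.
case: (inner_outletP qc out_d) => -[dE -> -> ->]; set w := side_point _ _ _; rewrite dE;
  rewrite ?(turnN, turn_turn, offsetN, opprK) => sd sr; by split; lra.
Qed.

Lemma inner_chord_segment q d t : q <> center q -> outlet q d t ->
  let b := side_point (q + parent q) (- parent q) (1 - entry q d t) in
  chord q d t `|` [set b] = segment_set b (side_point q d t) /\ ~ chord q d t b.
Proof.
move=> qc out_d b; have [dir_p _ _] := parentP qc.
have bE : b = side_point q (parent q) (entry q d t) by rewrite /b side_pointN.
have [bd br] := offset_side_point q (entry q d t) dir_p; rewrite -bE in bd br.
have [sX sY] := side_point_chord qc out_d; have h0 := height_gt0 qc out_d.
have Yb : offset (side_point q d t) q (parent q) - 1 / 2 = - height q d t by lra.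
have Xb : offset (side_point q d t) q (turn (parent q)) - (entry q d t - 1 / 2) =
  height q d t * slope q d t by lra.
rewrite /chord; case: eqP => // _; split; last by rewrite /inner_chord /= bd => -[]; lra.
apply/seteqP; split=> w.
  move=> [[Y0 Yh XY]|->]; last by exists 0; rewrite /= ?in_itv /= ?lexx ?ler01 // scale0r addr0.
  exists ((1 / 2 - offset w q (parent q)) / height q d t).
    by rewrite /= in_itv /= divr_ge0 ?(ltW Y0) ?(ltW h0) //= ler_pdivrMr // [leRHS]mul1r.
  apply: (offset_inj dir_p (q := q)); rewrite offset_segment ?bd ?br ?Yb ?Xb.
    by rewrite mulrN divfK; [lra|rewrite gt_eqF].
  by rewrite mulrA divfK; [lra|rewrite gt_eqF].
move=> [l /=]; rewrite in_itv /= => /andP[l0 l1] wE.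
have [l00|lp] : l = 0 \/ 0 < l by lra.
  by right; rewrite -wE l00 scale0r addr0.
left; rewrite /inner_chord /= -wE !offset_segment bd br Yb Xb.
have lh0 : 0 < l * height q d t by apply: mulr_gt0.
have lh1 : l * height q d t <= height q d t by rewrite -[leRHS]mul1r ler_wpM2r // ltW.
by split; [lra|lra|ring].
Qed.

Lemma side_point_in_chord q d t : q <> center q -> outlet q d t -> chord q d t (side_point q d t).
Proof.
move=> qc out_d; rewrite /chord; case: eqP => // _; rewrite /inner_chord /=.
by have [-> ->] := side_point_chord qc out_d; split=> //; exact: height_gt0.
Qed.

Lemma chord_meets_rest q d t w : q <> center q -> outlet q d t -> chord q d t w ->
  ~ strand (q + parent q) (- parent q) (1 - entry q d t) w.
Proof.
move=> qc out_d qw [q' [d' [t' [rt q'w]]]]; have [_ _ depth_lt] := parentP qc.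
have depth_q' : (depth q' < depth q)%N by apply: leq_ltn_trans (route_depth rt) depth_lt.
have qq' : q <> q' by move=> e; rewrite e ltnn in depth_q'.
have out_d' := route_outlet (parent_outlet qc out_d) rt.
have [q'E d'E _] := chords_meet_across_cells out_d out_d' qw q'w qq'.
case: (route_last rt) => [[_ d'p _]|[q1 [d1 [t1 [rt1 _ q'E1 d'E1 _]]]]].
  by have [_ _ /(_ qc)] := out_d; apply; apply: oppr_inj; rewrite -d'E.
have dp : d = parent q1 by apply: oppr_inj; rewrite -d'E.
have q1E : q1 = q by apply: (addIr d); rewrite -q'E q'E1 dp.
by move: (leq_ltn_trans (route_depth rt1) depth_lt); rewrite q1E ltnn.
Qed.

Lemma strand_arc q d t :
  outlet q d t -> is_arc (lattice (center q)) (side_point q d t) (strand q d t).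
Proof.
have [n] := ubnP (depth q); elim: n q d t => // n IHn q d t depth_n out_d.
have [qc|qc] := pselect (q = center q).
  rewrite strand_center // center_chord_segment // -qc; apply: arc_segment => qE.
  have [dir_d _ _] := out_d; have [sd _] := offset_side_point q t dir_d.
  by move: sd; rewrite -qE offset_lattice; lra.
have [dir_p cp depth_lt] := parentP qc; rewrite strand_next //.
have out_p := parent_outlet qc out_d.
have := IHn _ _ _ (leq_trans depth_lt depth_n) out_p; rewrite cp.
set b := side_point (q + parent q) _ _ => arc_p.
have [segE nb] := inner_chord_segment qc out_d; rewrite -/b in segE nb.
have -> : chord q d t `|` strand (q + parent q) (- parent q) (1 - entry q d t) =
   strand (q + parent q) (- parent q) (1 - entry q d t) `|` segment_set b (side_point q d t).
  rewrite -segE; apply/seteqP; split=> w.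
    by case=> h; [right; left|left].
  by case=> [h|[h|->]]; [right|left|right; apply: (arc_end arc_p)].
apply: arc_cat arc_p _ _ => [|w pw].
  by apply: arc_segment => bE; apply: nb; rewrite bE; exact: side_point_in_chord.
by rewrite -segE => -[/(chord_meets_rest qc out_d)/(_ pw)|].
Qed.

(* The middle of a side between two clusters, where a strand ends. *)
Definition gate q d := unit_dir d /\ center (q + d) <> center q.

Lemma gate_outlet q d : gate q d -> outlet q d (1 / 2).
Proof.
move=> [dir_d cq]; split=> //; first by lra.
by move=> /parentP[_ cE _] dE; apply: cq; rewrite dE.
Qed.

Lemma gateN q d : gate q d -> gate (q + d) (- d).
Proof. by move=> [dir_d cq]; split; [exact: unit_dirN|rewrite addrK => /esym]. Qed.

Lemma gate_not_parent q d q1 :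
  gate q d -> q1 <> center q1 -> q = q1 + parent q1 -> d <> - parent q1.
Proof. by move=> [_ cq] /parentP[_ cE _] qE dE; apply: cq; rewrite dE qE addrK cE. Qed.

Lemma route_inj q d q' d' q1 d1 t1 : gate q d -> gate q' d' ->
  route q d (1 / 2) q1 d1 t1 -> route q' d' (1 / 2) q1 d1 t1 -> q = q' /\ d = d'.
Proof.
move=> gd gd'; have out_d := gate_outlet gd; have out_d' := gate_outlet gd'.
elim=> [/route_last[[-> -> _]//|[q2 [d2 [t2 [_ n qE dE _]]]]]|].
  by case: (gate_not_parent gd n qE dE).
move=> q2 d2 t2 rt IH n /route_last[[qE dE _]|[q3 [d3 [t3 [rt3 n3 qE dE tE]]]]].
  by case: (gate_not_parent gd' n (esym qE) (esym dE)).
have pE : parent q2 = parent q3 by apply: oppr_inj.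
have q23 : q2 = q3 by apply: (addIr (parent q3)); rewrite -{1}pE.
subst q3; have [|d23 t23] := entry_inj n (route_outlet out_d rt) (route_outlet out_d' rt3).
  by lra.
by apply: IH; rewrite d23 t23.
Qed.

Lemma strands_meet q d q' d' w : gate q d -> gate q' d' ->
  strand q d (1 / 2) w -> strand q' d' (1 / 2) w ->
  [\/ q = q' /\ d = d', center q = center q' /\ w = lattice (center q) |
    [/\ q' = q + d, d' = - d & w = side_point q d (1 / 2)]].
Proof.
move=> gd gd' [q1 [d1 [t1 [rt q1w]]]] [q2 [d2 [t2 [rt' q2w]]]].
have out1 := route_outlet (gate_outlet gd) rt; have out2 := route_outlet (gate_outlet gd') rt'.
have [q12|q12] := pselect (q1 = q2).
  subst q2; case: (chords_meet_in_cell out1 out2 q1w q2w) => [[dE tE]|[q1c wE]].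
    by apply: Or31; rewrite -dE -tE in rt'; apply: (route_inj gd gd' rt rt').
  by apply: Or32; rewrite -(route_center rt) -(route_center rt') -q1c.
have [q2E d2E wE] := chords_meet_across_cells out1 out2 q1w q2w q12.
case: (route_last rt) => [[q1q d1d t1h]|[q3 [d3 [t3 [_ n3 q1E d1E _]]]]]; last first.
  have q2q3 : q2 = q3 by rewrite q2E q1E d1E addrK.
  by have [_ _] := out2; rewrite q2q3 => /(_ n3) []; rewrite d2E d1E opprK.
case: (route_last rt') => [[q2q' d2d' _]|[q4 [d4 [t4 [_ n4 q2E' d2E' _]]]]].
  by apply: Or33; subst.
have dp : d = parent q4 by apply: oppr_inj; rewrite -d1d -d2E.
have q4E : q4 = q by apply: (addIr d); rewrite {1}dp -q2E' q2E q1q d1d.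
by have [_ cE _] := parentP n4; have [_] := gd; rewrite dp -q4E cE.
Qed.

Lemma strand_vertex q d r :
  gate q d -> r = center r -> strand q d (1 / 2) (lattice r) -> r = center q.
Proof.
move=> gd rc [q1 [d1 [t1 [rt q1r]]]]; have out1 := route_outlet (gate_outlet gd) rt.
suff rE : r = q1 by rewrite rc rE (route_center rt).
have in_cell u (dir_u : unit_dir u) := (chord_in_cell out1 q1r dir_u).1.
move: (in_cell (1, 0) isT) (in_cell (0, 1) isT) (in_cell (-1, 0) isT) (in_cell (0, -1) isT).
rewrite /offset /lattice !row2_0 !row2_1 /= ?unit_dirE.
case: r q1 {rc rt q1r out1 in_cell} => [x y] [x' y'] /= E N W S.
have [xE|xE|xE] : [\/ x = x', x = x' + 1 | x' = x + 1] by apply: int_dist_le1; lra.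
- have [->|yE|yE] : [\/ y = y', y = y' + 1 | y' = y + 1] by apply: int_dist_le1; lra.
  + by rewrite xE.
  + by rewrite yE intrD mulr1z in N; absurd_lra.
  + by rewrite yE intrD mulr1z in S; absurd_lra.
- by rewrite xE intrD mulr1z in E; absurd_lra.
- by rewrite xE intrD mulr1z in W; absurd_lra.
Qed.

Definition edge_set q d := strand q d (1 / 2) `|` strand (q + d) (- d) (1 / 2).

Lemma edge_set_arc q d :
  gate q d -> is_arc (lattice (center q)) (lattice (center (q + d))) (edge_set q d).
Proof.
move=> gd; have gd' := gateN gd; have [dir_d cq] := gd.
have arc1 := strand_arc (gate_outlet gd); have arc2 := strand_arc (gate_outlet gd').
have mid : side_point (q + d) (- d) (1 / 2) = side_point q d (1 / 2).
  by have <- := side_pointN q (1 / 2) dir_d; congr side_point; lra.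
rewrite mid in arc2; apply: arc_cat arc1 (arc_rev arc2) _ => x s1 s2.
case: (strands_meet gd gd' s1 s2) => [[qE _]|[cE _]|[_ _ ->//]].
  by case: cq; rewrite -qE.
by case: cq.
Qed.

Lemma edge_set_vertex q d r : gate q d -> r = center r -> edge_set q d (lattice r) ->
  r = center q \/ r = center (q + d).
Proof.
move=> gd rc [/(strand_vertex gd rc)|/(strand_vertex (gateN gd) rc)]; by [left|right].
Qed.

Lemma gate_strands_meet q d q' d' w : gate q d -> gate q' d' ->
  strand q d (1 / 2) w -> strand q' d' (1 / 2) w ->
  [\/ w = lattice (center q), center q = center q' /\ center (q + d) = center (q' + d') |
      center q = center (q' + d') /\ center (q + d) = center q'].
Proof.
move=> gd gd' s s'; case: (strands_meet gd gd' s s') => [[-> ->]|[_ ->]|[-> -> _]].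
- exact: Or32.
- exact: Or31.
- by apply: Or33; rewrite addrK.
Qed.

Lemma edge_sets_meet q d q' d' w : gate q d -> gate q' d' ->
  edge_set q d w -> edge_set q' d' w ->
  (w = lattice (center q) \/ w = lattice (center (q + d))) \/
  (center q = center q' /\ center (q + d) = center (q' + d')) \/
  (center q = center (q' + d') /\ center (q + d) = center q').
Proof.
move=> gd gd' [s|s] [s'|s'].
- by case: (gate_strands_meet gd gd' s s'); tauto.
- by case: (gate_strands_meet gd (gateN gd') s s'); rewrite ?addrK; tauto.
- by case: (gate_strands_meet (gateN gd) gd' s s'); rewrite ?addrK; tauto.
- by case: (gate_strands_meet (gateN gd) (gateN gd') s s'); rewrite ?addrK; tauto.
Qed.

End Strands.

(** * The cluster graph *)

Section ClusterGraph.
Local Open Scope ring_scope.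
Variable center : Z2 -> Z2.
Hypothesis center_joined : forall x, joined grid_adj [set y | center y = center x] (center x) x.

Fixpoint near_center n z := if n is n'.+1
  then exists2 d, unit_dir d & center (z + d) = center z /\ near_center n' (z + d)
  else z = center z.

Lemma near_center_exists z : exists n, near_center n z.
Proof.
have joined_near r y : joined grid_adj [set y | center y = r] r y -> exists n, near_center n y.
  elim=> [/= rr|y1 z1 ry [n ny] /grid_adj_sym/grid_adjP[d dir_d y1E] /= zr].
    by exists 0%N.
  by exists n.+1, d; rewrite -?y1E // zr; split=> //; exact: joinedr ry.
exact: joined_near (center_joined z).
Qed.

Lemma spanning_forest_exists : exists (parent : Z2 -> Z2) (depth : Z2 -> nat),
  forall z, z <> center z ->
  [/\ unit_dir (parent z), center (z + parent z) = center z & (depth (z + parent z)%R < depth z)%N].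
Proof.
have /choice[depth depthP] : forall z, exists n,
    near_center n z /\ forall m, near_center m z -> (n <= m)%N.
  move=> z; have ex : exists n, `[< near_center n z >].
    by have [n nz] := near_center_exists z; exists n; apply/asboolP.
  case: (ex_minnP ex) => n /asboolP nz nmin; exists n; split=> // m mz.
  by apply: nmin; apply/asboolP.
have /choice[parent parentP] : forall z, exists d, z <> center z ->
    [/\ unit_dir d, center (z + d) = center z & (depth (z + d)%R < depth z)%N].
  move=> z; have [] := depthP z; case: (depth z) => [zc|n [d dir_d [cE nd]] _].
    by exists z => /(_ zc).
  by exists d => _; split=> //; rewrite ltnS; have [_] := depthP (z + d); apply.
by exists parent, depth.
Qed.

Definition cluster_adj (u v : {z : Z2 | center z == z}) : Prop :=
  val u <> val v /\ exists x y, [/\ center x = val u, center y = val v & grid_adj x y].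

Lemma cluster_adj_sym u v : cluster_adj u v -> cluster_adj v u.
Proof.
move=> [uv [x [y [xu yv xy]]]]; split; first by move/esym.
by exists y, x; split=> //; apply: grid_adj_sym.
Qed.

Lemma cluster_adj_irrefl u : ~ cluster_adj u u.
Proof. by case. Qed.

Definition cluster_graph := Graph cluster_adj_sym cluster_adj_irrefl.

Lemma cluster_gate_exists : exists gates : vertex cluster_graph -> vertex cluster_graph -> Z2 * Z2,
  forall u v, adj u v -> [/\ gate center (gates u v).1 (gates u v).2, center (gates u v).1 = val u &
    center ((gates u v).1 + (gates u v).2) = val v].
Proof.
suff /choice[gates gatesP] : forall uv : vertex cluster_graph * vertex cluster_graph,
    exists qd : Z2 * Z2, adj uv.1 uv.2 ->
    [/\ gate center qd.1 qd.2, center qd.1 = val uv.1 & center (qd.1 + qd.2) = val uv.2].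
  by exists (fun u v => gates (u, v)) => u v; exact: gatesP (u, v).
move=> [u v] /=; have [uv|nuv] := pselect (cluster_adj u v); last by exists (0, 0) => /nuv.
have [uvN [x [y [xu yv /grid_adjP[d dir_d yE]]]]] := uv.
exists (x, d) => _ /=; rewrite -yE; split=> //.
by split=> //; rewrite -yE xu yv => /esym.
Qed.

Lemma planar_cluster_graph (R : realType) : planar_graph R cluster_graph.
Proof.
have [parent [depth parentP]] := spanning_forest_exists.
have [gates gatesP] := cluster_gate_exists.
have valE (u : vertex cluster_graph) : val u = center (val u) by apply/esym/eqP; exact: (valP u).
apply: (@planar_graph_of_arcs R cluster_graph (fun u => pickle (val u))
  (fun u => lattice R (val u))
  (fun u v => @edge_set R center parent (gates u v).1 (gates u v).2)).
- by move=> u v /(pcan_inj pickleK)/val_inj.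
- by move=> u v /lattice_inj/val_inj.
- move=> u v /= /gatesP[gd <- <-]; exact: (edge_set_arc R parentP gd).
- move=> u v w /gatesP[gd uE vE] /(edge_set_vertex parentP gd (valE w)).
  by rewrite uE vE => -[/val_inj|/val_inj]; [left|right].
- move=> u v u' v' x /gatesP[gd uE vE] /gatesP[gd' uE' vE'] s s'.
  have := edge_sets_meet parentP gd gd' s s'; rewrite uE vE uE' vE'.
  case=> [[->|->]|[[/val_inj-> /val_inj->]|[/val_inj-> /val_inj->]]].
  + by left; exists u.
  + by left; exists v.
  + by right; left.
  + by right; right.
Qed.

End ClusterGraph.

(** * Piecewise C^1 curves *)

Section RealDerivatives.
Local Open Scope ring_scope.
Variable R : realType.
Implicit Types (a b t x y k m z : R) (s : seq R).

Lemma ndecr_off_finite (f df : R -> R) s a b : a <= b -> {within `[a, b], continuous f} ->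
  (forall t, a < t < b -> t \notin s -> is_derive t (1 : R) f (df t)) ->
  (forall t, a < t < b -> t \notin s -> 0 <= df t) -> f a <= f b.
Proof.
elim: s a b => [|y s IHs] a b ab f_cont f_derive df_ge0.
  apply: (ger0_derive1_ndecr (a := a) (b := b)); rewrite ?lexx // => t; rewrite in_itv /= => tab.
    by have Df := f_derive t tab isT; exact: ex_derive.
  by have Df := f_derive t tab isT; rewrite derive1E derive_val df_ge0.
have half u v : a <= u -> u <= v -> v <= b -> ~~ (u < y < v) -> f u <= f v.
  move=> au uv vb yuv; apply: (IHs u v) => //; first exact: within_itv_subset f_cont.
    move=> t tuv ts; apply: f_derive; first lra.
    by rewrite in_cons negb_or ts andbT; apply: contraNN yuv => /eqP <-.
  move=> t tuv ts; apply: df_ge0; first lra.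
  by rewrite in_cons negb_or ts andbT; apply: contraNN yuv => /eqP <-.
have [/andP[/ltW ay /ltW yb]|yab] := boolP (a < y < b); last exact: half.
by apply: (@le_trans _ _ (f y)); apply: half; rewrite ?ltxx ?andbF.
Qed.

Lemma normB_le_off_finite (f h df dh : R -> R) (s : seq R) a b : a <= b ->
  {within `[a, b], continuous f} -> {within `[a, b], continuous h} ->
  (forall t, a < t < b -> t \notin s ->
    [/\ is_derive t (1 : R) f (df t), is_derive t (1 : R) h (dh t) & `|df t| <= dh t]) ->
  `|f a - f b| <= h b - h a.
Proof.
move=> ab f_cont h_cont der.
have ndecr z : z = 1 \/ z = -1 -> 1 * h a + z * f a <= 1 * h b + z * f b.
  move=> z1; apply: (@ndecr_off_finite (fun t => 1 * h t + z * f t)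
    (fun t => 1 * dh t + z * df t) s) => //.
  - by apply: within_continuousD; exact: within_itvZ.
  - move=> t tab ts; have [Df Dh _] := der t tab ts.
    have -> : (fun t => 1 * h t + z * f t) = (1 \*: h) \+ (z \*: f) by [].
    exact: is_derive_eq.
  - move=> t tab ts; have [_ _] := der t tab ts; rewrite ler_norml => /andP[].
    by case: z1 => ->; lra.
by have := ndecr 1 (or_introl erefl); have := ndecr (-1) (or_intror erefl); rewrite ler_norml; lra.
Qed.

Lemma near_notin s t : \forall x \near t, x != t -> x \notin s.
Proof.
have : nbhs t (~` [set` [seq y <- s | y != t]]).
  apply: open_nbhs_nbhs; split; last by rewrite /= mem_filter eqxx.
  apply: closed_openC; apply: (accessible_finite_set_closed.1 _ _ (finite_seq _)).
  exact: hausdorff_accessible (@Rhausdorff R).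
by apply: filterS => x /= xs xt; apply: contra_notN xs; rewrite mem_filter xt.
Qed.

Lemma near_eq_derive1 (V : normedModType R) (f h : R -> V) x :
  {near x, f =1 h} -> derive1 f x = derive1 h x.
Proof. by move=> fh; rewrite !derive1E; exact: near_eq_derive. Qed.

Lemma near_eq_is_cvg (T : Type) (V : normedModType R) (F : set_system T) {FF : Filter F}
    (f h : T -> V) : {near F, f =1 h} -> cvg (f x @[x --> F]) -> cvg (h x @[x --> F]).
Proof.
move=> fh /cvg_ex[l f_l]; apply/cvg_ex; exists l.
exact: cvg_trans (near_eq_cvg fh) f_l.
Qed.

Lemma is_derive_affine (V : normedModType R) (f : R -> V) k m x :
  derivable f (k * x + m) 1 ->
  is_derive x (1 : R) (fun t => f (k * t + m)) (k *: derive1 f (k * x + m)).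
Proof.
move=> /derivable1_diffP df.
have dh : is_derive x (1 : R) (fun t => k * t + m) k.
  have -> : (fun t => k * t + m) = (k \*: id) \+ cst m by [].
  by apply: is_derive_eq; rewrite addr0 /GRing.scale /= mulr1.
have hd : differentiable (fun t => k * t + m) x by apply/derivable1_diffP.
have dc : differentiable (f \o (fun t => k * t + m)) x by apply: differentiable_comp.
apply: DeriveDef; first exact/derivable1_diffP.
rewrite (deriveE _ dc) (diff_comp hd df) /= -(deriveE _ hd) derive_val derive1E (deriveE _ df).
by rewrite -linearZ /= /GRing.scale /= mulr1.
Qed.

Lemma cvg_nbhs_continuous (V : normedModType R) (f : R -> V) t :
  cvg (f x @[x --> t]) -> {for t, continuous f}.
Proof.
move=> /cvg_ex[l f_l]; suff lE : l = f t by move: f_l; rewrite lE.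
apply/eqP; rewrite -subr_eq0 -normr_le0; apply/ler_addgt0Pr => e e0; rewrite add0r ltW //.
by move/cvgrPdist_lt: f_l => /(_ e e0)/nbhs_singleton.
Qed.

(* The filter of the neighborhoods of [t] on both sides ([z = 0]), at the right
   ([z = 1]) or at the left ([z = -1]) of [t]. *)
Definition approach z t : set_system R :=
  within [set x | z = 0 \/ 0 < z * (x - t)] (nbhs t).

Global Instance approach_filter z t : Filter (approach z t).
Proof. exact: within_filter. Qed.

Lemma near_approach z t (P : set R) : nbhs t P -> approach z t P.
Proof. by move=> tP; rewrite /approach /within /=; apply: filterS tP. Qed.

Lemma approachW z t (P : set R) : (forall x, z = 0 \/ 0 < z * (x - t) -> P x) -> approach z t P.
Proof. by move=> sideP; rewrite /approach /within; apply: nearW. Qed.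

Lemma approach_both t : approach 0 t = nbhs t.
Proof.
apply/seteqP; split=> P; last exact: near_approach.
by rewrite /approach /within /=; apply: filterS => x; apply; left.
Qed.

Lemma approach_right t : approach 1 t = t^'+.
Proof.
suff sideE : [set x | (1 : R) = 0 \/ 0 < 1 * (x - t)] = [set x | t < x].
  by rewrite /approach sideE.
apply/seteqP; split=> x /=; rewrite mul1r subr_gt0; last by right.
by case=> // /eqP; rewrite oner_eq0.
Qed.

Lemma approach_left t : approach (-1) t = t^'-.
Proof.
suff sideE : [set x | (-1 : R) = 0 \/ 0 < -1 * (x - t)] = [set x | x < t].
  by rewrite /approach sideE.
apply/seteqP; split=> x /=; rewrite mulN1r oppr_gt0 subr_lt0; last by right.
by case=> // /eqP; rewrite oppr_eq0 oner_eq0.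
Qed.

Lemma nbhs_left_right t (P : set R) :
  approach (-1) t P -> approach 1 t P -> P t -> nbhs t P.
Proof.
rewrite /approach /within /= => leftP rightP Pt.
apply: filterS2 leftP rightP => x xP Px; have [xt|tx|->//] := ltgtP x t.
  by apply: xP; right; rewrite mulN1r oppr_gt0 subr_lt0.
by apply: Px; right; rewrite mul1r subr_gt0.
Qed.

Lemma approach_affine k m z t : k != 0 ->
  k * x + m @[x --> approach z t] --> approach (Num.sg k * z) (k * t + m).
Proof.
move=> k0 P nearP; have affine_cvg : k * x + m @[x --> t] --> k * t + m.
  by apply: cvgD; [apply: cvgM; [exact: cvg_cst|exact: cvg_id]|exact: cvg_cst].
have near_t : \forall x \near t, Num.sg k * z = 0 \/
    0 < Num.sg k * z * (k * x + m - (k * t + m)) -> P (k * x + m) := affine_cvg _ nearP.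
suff : \forall x \near t, z = 0 \/ 0 < z * (x - t) -> P (k * x + m) by [].
apply: filterS near_t => x Px side; apply: Px.
case: side => [->|side]; [by left; rewrite mulr0|right].
have -> : Num.sg k * z * (k * x + m - (k * t + m)) = `|k| * (z * (x - t)).
  by rewrite normrEsg; ring.
by rewrite mulr_gt0 ?normr_gt0.
Qed.

End RealDerivatives.

Section Curves.
Local Open Scope ring_scope.
Variables (R : realType) (M : topologicalType) (A : smooth_atlas R M) (g : riemannian_metric A).
Implicit Types (a b t x k m z B : R) (c : R -> M) (L : R -> R) (s : seq R).

Lemma chart_atP p : dom (chart_at A p) p.
Proof. by rewrite /chart_at; case: cid. Qed.

Lemma speed_ge0 c t : 0 <= speed g c t.
Proof. exact: sqrtr_ge0. Qed.

Lemma near_eq_speed c c' t : {near t, c =1 c'} -> speed g c t = speed g c' t.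
Proof.
move=> cc'; rewrite /speed /= (nbhs_singleton cc'); set i := chart_at A _.
have -> // : derive1 (coord i \o c) t = derive1 (coord i \o c') t.
by apply: near_eq_derive1; apply: filterS cc' => x /= ->.
Qed.

(* The curve on [a, b], with corners in [s], extends to the side [z] of [t]. *)
Definition has_side z a b s t :=
  [\/ [/\ z = 0, a < t < b & t \notin s], z = 1 /\ a <= t < b | z = -1 /\ a < t <= b].

Lemma has_side_itv z a b s t : has_side z a b s t -> a <= t <= b.
Proof. by case=> [[_ tab _]|[_ tab]|[_ tab]]; lra. Qed.

Lemma has_side_subset z a b a' b' s t : a <= a' -> b' <= b ->
  has_side z a' b' s t -> has_side z a b s t.
Proof.
move=> aa' b'b [[-> tab ts]|[-> tab]|[-> tab]].
- by apply: Or31; split=> //; lra.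
- by apply: Or32; split=> //; lra.
- by apply: Or33; split=> //; lra.
Qed.

Lemma near_has_side z a b s t : has_side z a b s t ->
  \forall x \near approach z t, a < x < b /\ x \notin s.
Proof.
have near_ab : a < t < b -> \forall x \near t, a < x < b.
  by move=> tab; apply: filterS (@near_in_itvoo R a b t _) => [x|]; rewrite in_itv.
case=> [[-> tab ts]|[-> /andP[at_ tb]]|[-> /andP[at_ tb]]].
- rewrite approach_both; apply: filterS2 (near_ab tab) (near_notin s t) => x xab xs.
  by split=> //; have [->|] := eqVneq x t.
- have := near_approach 1 (near_notin s t); rewrite approach_right => near_s.
  apply: filterS3 near_s (nbhs_right_gt t) (nbhs_right_lt tb) => x xs tx xb.
  by rewrite xs ?gt_eqF //; split=> //; lra.
- have := near_approach (-1) (near_notin s t); rewrite approach_left => near_s.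
  apply: filterS3 near_s (nbhs_left_lt t) (nbhs_left_gt at_) => x xs xt ax.
  by rewrite xs ?lt_eqF //; split=> //; lra.
Qed.

Definition piecewise_C1_on c a b s := [/\ {within `[a, b], continuous c},
  forall t (i : chart A), a < t < b -> t \notin s -> dom i (c t) -> derivable (coord i \o c) t 1 &
  forall z t (i : chart A), has_side z a b s t -> dom i (c t) ->
    cvg (derive1 (coord i \o c) x @[x --> approach z t])].

Definition arclength c L a b := {within `[a, b], continuous L} /\
  exists s, piecewise_C1_on c a b s /\
    forall t, a < t < b -> t \notin s -> is_derive t (1 : R) L (speed g c t).

Lemma near_dom c a b t (i : chart A) : {within `[a, b], continuous c} ->
  a <= t <= b -> dom i (c t) -> \forall x \near t, a <= x <= b -> dom i (c x).
Proof.
move=> /within_itvP c_cont tab it.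
have [e e0 near_t] := c_cont t tab _ (open_nbhs_nbhs (conj (dom_open i) it)).
by apply/nbhs_ballP; exists e => // x xt xab; apply: near_t; rewrite // distrC.
Qed.

Lemma near_side_dom c a b s z t (i : chart A) : {within `[a, b], continuous c} ->
  has_side z a b s t -> dom i (c t) ->
  \forall x \near approach z t, [/\ a < x < b, x \notin s & dom i (c x)].
Proof.
move=> c_cont side it.
have near_i := near_approach z (near_dom c_cont (has_side_itv side) it).
apply: filterS2 (near_has_side side) near_i => x [xab xs] ix.
by split=> //; apply: ix; lra.
Qed.

Lemma piecewise_C1_on_subset c a b a' b' s : a <= a' -> b' <= b ->
  piecewise_C1_on c a b s -> piecewise_C1_on c a' b' s.
Proof.
move=> aa' b'b [c_cont c_der c_side]; split; first exact: within_itv_subset c_cont.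
  by move=> t i tab; apply: c_der; lra.
by move=> z t i /(has_side_subset aa' b'b); exact: c_side.
Qed.

Lemma arclength_subset c L a b a' b' : a <= a' -> b' <= b ->
  arclength c L a b -> arclength c L a' b'.
Proof.
move=> aa' b'b [L_cont [s [c_C1 L_der]]]; split; first exact: within_itv_subset L_cont.
exists s; split; first exact: piecewise_C1_on_subset c_C1.
by move=> t tab; apply: L_der; lra.
Qed.

Lemma arclength_ndecr c L a b : a <= b -> arclength c L a b -> L a <= L b.
Proof.
move=> ab [L_cont [s [_ L_der]]]; apply: (ndecr_off_finite ab L_cont L_der) => t _ _.
exact: speed_ge0.
Qed.

Lemma arclength_le c L a b B : a <= b -> arclength c L a b ->
  (forall t, a < t < b -> speed g c t <= B) -> L b - L a <= B * (b - a).
Proof.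
move=> ab [L_cont [s [_ L_der]]] speed_le.
suff : B * a + -1 * L a <= B * b + -1 * L b by lra.
apply: (@ndecr_off_finite _ (fun t => B * t + -1 * L t) (fun t => B + -1 * speed g c t) s) => //.
- apply: within_continuousD; last exact: within_itvZ.
  by apply: continuous_subspaceT => t; apply: cvgM; [exact: cvg_cst|exact: cvg_id].
- move=> t tab ts; have D := L_der t tab ts.
  have -> : (fun t => B * t + -1 * L t) = (B \*: id) \+ ((-1) \*: L) by [].
  by apply: is_derive_eq; rewrite /GRing.scale /= mulr1.
- by move=> t tab _; have := speed_le t tab; lra.
Qed.

Lemma arclength_unique c L L' a b : a <= b -> arclength c L a b -> arclength c L' a b ->
  L b - L a = L' b - L' a.
Proof.
suff le c1 L1 L2 : a <= b -> arclength c1 L1 a b -> arclength c1 L2 a b ->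
    L1 b - L1 a <= L2 b - L2 a.
  by move=> ab cL cL'; apply/le_anti/andP; split; exact: (le c).
move=> ab [L1_cont [s1 [_ L1_der]]] [L2_cont [s2 [_ L2_der]]].
have : L2 a + (-1) * L1 a <= L2 b + (-1) * L1 b; last lra.
apply: (@ndecr_off_finite _ (fun t => L2 t + (-1) * L1 t) (fun=> 0) (s1 ++ s2)) => //.
  by apply: within_continuousD => //; exact: within_itvZ.
move=> t tab; rewrite mem_cat negb_or => /andP[ts1 ts2].
have D1 := L1_der t tab ts1; have D2 := L2_der t tab ts2.
have -> : (fun t => L2 t + -1 * L1 t) = (L2 \+ (-1) \*: L1) by [].
by apply: is_derive_eq; rewrite /GRing.scale /= mulN1r subrr.
Qed.

Section AffineReparametrization.
Variables (k m a b a' b' : R).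
Hypothesis k_neq0 : k != 0.
Hypothesis km_ab : forall t, a' <= t <= b' -> a <= k * t + m <= b.

Lemma affine_itvoo t : a' < t < b' -> a < k * t + m < b.
Proof.
move=> tab; have := km_ab (t := a'); have := km_ab (t := b').
by case: ltrgt0P k_neq0 => // k0 _ b'_ab a'_ab; nra.
Qed.

Lemma affine_notin s t : t \notin [seq (y - m) / k | y <- s] -> k * t + m \notin s.
Proof.
apply: contraNN => ts; have -> : t = (k * t + m - m) / k by field.
exact: map_f.
Qed.

Lemma affine_has_side z s t : has_side z a' b' [seq (y - m) / k | y <- s] t ->
  has_side (Num.sg k * z) a b s (k * t + m).
Proof.
move=> side; have t_ab' := has_side_itv side; have := km_ab (t := a'); have := km_ab (t := b').
rewrite !lexx; case: ltrgt0P k_neq0 => // k0 _ b'_ab a'_ab;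
  rewrite ?(gtr0_sg k0) ?(ltr0_sg k0); case: side => [[-> tab ts]|[-> tab]|[-> tab]].
- by apply: Or31; split; [rewrite mulr0|exact: affine_itvoo|exact: affine_notin].
- by apply: Or32; split; [rewrite mulr1|nra].
- by apply: Or33; split; [rewrite mul1r|nra].
- by apply: Or31; split; [rewrite mulr0|exact: affine_itvoo|exact: affine_notin].
- by apply: Or33; split; [rewrite mulr1|nra].
- by apply: Or32; split; [rewrite mulrNN mulr1|nra].
Qed.

Lemma speed_affine c x :
  derivable (coord (chart_at A (c (k * x + m))) \o c) (k * x + m) 1 ->
  speed g (fun t => c (k * t + m)) x = `|k| * speed g c (k * x + m).
Proof.
move=> du; rewrite /speed; set j := chart_at A _; set u := coord j \o c.
have -> : coord j \o (fun t => c (k * t + m)) = fun t => u (k * t + m) by [].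
have Du := is_derive_affine du.
by rewrite derive1E derive_val bilinZ sqrtrM ?sqr_ge0 // sqrtr_sqr.
Qed.

Lemma piecewise_C1_on_affine c s : piecewise_C1_on c a b s ->
  piecewise_C1_on (fun t => c (k * t + m)) a' b' [seq (y - m) / k | y <- s].
Proof.
move=> [c_cont c_der c_side]; have c'_cont := within_itv_affine km_ab c_cont.
have der x (i : chart A) : a' < x < b' -> x \notin [seq (y - m) / k | y <- s] ->
    dom i (c (k * x + m)) -> is_derive x (1 : R) (coord i \o (fun t => c (k * t + m)))
      (k *: derive1 (coord i \o c) (k * x + m)).
  move=> xab xs ix; apply: (is_derive_affine (f := coord i \o c)).
  by apply: c_der; [exact: affine_itvoo|exact: affine_notin|].
split=> // [t i tab ts it|z t i side it]; first by have D := der t i tab ts it; exact: ex_derive.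
have /cvg_ex[l c_l] := c_side _ _ _ (affine_has_side side) it.
have kc_l : k *: derive1 (coord i \o c) (k * x + m) @[x --> approach z t] --> k *: l.
  by apply: cvgZr; apply: cvg_comp c_l; exact: approach_affine.
apply: near_eq_is_cvg (cvgP _ kc_l).
apply: filterS (near_side_dom c'_cont side it) => x [xab xs ix].
by have D := der x i xab xs ix; rewrite [RHS]derive1E derive_val.
Qed.

Lemma arclength_affine c L : arclength c L a b ->
  arclength (fun t => c (k * t + m)) (fun t => Num.sg k * L (k * t + m)) a' b'.
Proof.
move=> [L_cont [s [c_C1 L_der]]]; split.
  by apply: within_itvZ; exact: within_itv_affine km_ab L_cont.
exists [seq (y - m) / k | y <- s]; split; first exact: piecewise_C1_on_affine.
move=> t tab ts; have [_ c_der _] := c_C1.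
have {}tab := affine_itvoo tab; have {}ts := affine_notin ts.
rewrite speed_affine; last by apply: c_der => //; exact: chart_atP.
have D := L_der _ tab ts; have D' := is_derive_affine (@ex_derive _ _ _ _ _ _ _ D).
have -> : (fun t => Num.sg k * L (k * t + m)) = Num.sg k \*: (fun t => L (k * t + m)) by [].
by apply: is_derive_eq; rewrite derive1E derive_val /GRing.scale /= mulrA -normrEsg.
Qed.

End AffineReparametrization.

Lemma has_side_glue z a b e s s' t : a < b -> b < e -> has_side z a e (b :: s ++ s') t ->
  (t <= b /\ has_side z a b s t) \/ (b <= t /\ has_side z b e s' t).
Proof.
move=> ab be [[-> tae]|[-> tae]|[-> tae]].
- rewrite in_cons mem_cat !negb_or => /and3P[tb ts ts'].
  have {tb}[tb|bt] : t < b \/ b < t by apply/orP; rewrite -neq_lt.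
    by left; split; [lra|apply: Or31; split=> //; lra].
  by right; split; [lra|apply: Or31; split=> //; lra].
- have [tb|bt] := ltP t b; first by left; split; [lra|apply: Or32; split=> //; lra].
  by right; split=> //; apply: Or32; split=> //; lra.
- have [tb|bt] := leP t b; first by left; split=> //; apply: Or33; split=> //; lra.
  by right; split; [lra|apply: Or33; split=> //; lra].
Qed.

Lemma near_glue_left (T : Type) (f h : R -> T) b x : x < b -> {near x, glue b f h =1 f}.
Proof. by move=> xb; apply: filterS (lt_nbhsl xb) => y /ltW /glue_left ->. Qed.

Lemma near_glue_right (T : Type) (f h : R -> T) b x : b < x -> {near x, glue b f h =1 h}.
Proof. by move=> bx; apply: filterS (lt_nbhsr bx) => y /=; rewrite /glue; case: leP. Qed.

Section Concatenation.
Variables (a b e : R) (c c' : R -> M).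
Hypotheses (ab : a < b) (be : b < e) (cb : c b = c' b).

Lemma piecewise_C1_on_glue s s' : piecewise_C1_on c a b s -> piecewise_C1_on c' b e s' ->
  piecewise_C1_on (glue b c c') a e (b :: s ++ s').
Proof.
move=> [c_cont c_der c_side] [c'_cont c'_der c'_side]; split.
- by apply: within_itv_glue c_cont c'_cont => //; exact: ltW.
- move=> t i tae; rewrite in_cons mem_cat !negb_or comp_glue => /and3P[tb ts ts'].
  have {tb}[tb|bt] : t < b \/ b < t by apply/orP; rewrite -neq_lt.
    rewrite glue_left ?(ltW tb) // => it.
    apply: (near_eq_derivable (f := coord i \o c)); last by apply: c_der => //; lra.
    by apply: filterS (near_glue_left (coord i \o c) (coord i \o c') tb) => y ->.
  rewrite glue_right ?(ltW bt) // => it.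
  apply: (near_eq_derivable (f := coord i \o c')); last by apply: c'_der => //; lra.
  by apply: filterS (near_glue_right (coord i \o c) (coord i \o c') bt) => y ->.
move=> z t i side; rewrite comp_glue.
have [[tb side_l]|[bt side_r]] := has_side_glue ab be side.
  rewrite glue_left // => it; apply: near_eq_is_cvg (c_side z t i side_l it).
  apply: filterS (near_side_dom c_cont side_l it) => x [/andP[_ xb] _ _].
  exact/esym/near_eq_derive1/near_glue_left.
rewrite glue_right // => it; apply: near_eq_is_cvg (c'_side z t i side_r it).
apply: filterS (near_side_dom c'_cont side_r it) => x [/andP[bx _] _ _].
exact/esym/near_eq_derive1/near_glue_right.
Qed.

Lemma arclength_glue L L' : L b = L' b -> arclength c L a b -> arclength c' L' b e ->
  arclength (glue b c c') (glue b L L') a e.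
Proof.
move=> Lb [L_cont [s [c_C1 L_der]]] [L'_cont [s' [c'_C1 L'_der]]]; split.
  by apply: within_itv_glue L_cont L'_cont => //; exact: ltW.
exists (b :: s ++ s'); split; first exact: piecewise_C1_on_glue.
move=> t tae; rewrite in_cons mem_cat !negb_or => /and3P[tb ts ts'].
have {tb}[tb|bt] : t < b \/ b < t by apply/orP; rewrite -neq_lt.
  have LL := near_glue_left L L' tb; rewrite (near_eq_speed (near_glue_left c c' tb)).
  have D : is_derive t (1 : R) L (speed g c t) by apply: L_der => //; lra.
  apply: DeriveDef; last by rewrite -derive1E (near_eq_derive1 LL) derive1E derive_val.
  by apply: near_eq_derivable (@ex_derive _ _ _ _ _ _ _ D); apply: filterS LL => y ->.
have LL := near_glue_right L L' bt; rewrite (near_eq_speed (near_glue_right c c' bt)).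
have D : is_derive t (1 : R) L' (speed g c' t) by apply: L'_der => //; lra.
apply: DeriveDef; last by rewrite -derive1E (near_eq_derive1 LL) derive1E derive_val.
by apply: near_eq_derivable (@ex_derive _ _ _ _ _ _ _ D); apply: filterS LL => y ->.
Qed.

End Concatenation.

End Curves.

Section Lengths.
Local Open Scope ring_scope.
Variables (R : realType) (M : topologicalType) (A : smooth_atlas R M) (g : riemannian_metric A).
Implicit Types (a b t x z : R) (c : R -> M) (L : R -> R) (s : seq R).

Lemma cvg_mx_entry (T : Type) (F : set_system T) (m n : nat) (f : T -> 'M[R]_(m, n))
    (f0 : 'M[R]_(m, n)) (j : 'I_m) (k : 'I_n) :
  f @ F --> f0 -> f x j k @[x --> F] --> f0 j k.
Proof.
move=> f_cvg; exact: (@cvg_comp _ _ _ f (fun v : 'M[R]_(m, n) => v j k) F (nbhs f0)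
  (nbhs (f0 j k)) f_cvg (@matrix_normedtype.coord_continuous R m n j k f0)).
Qed.

Lemma cvg_bilin (T : Type) (F : set_system T) {FF : Filter F} (G : T -> 'M[R]_2)
    (v w : T -> 'rV[R]_2) G0 v0 w0 : G @ F --> G0 -> v @ F --> v0 -> w @ F --> w0 ->
  bilin (G x) (v x) (w x) @[x --> F] --> bilin G0 v0 w0.
Proof.
move=> G_cvg v_cvg w_cvg; rewrite bilin_row2; under eq_fun do rewrite bilin_row2.
have cG j k : G x j k @[x --> F] --> G0 j k by exact: cvg_mx_entry.
have cv k : v x 0 k @[x --> F] --> v0 0 k by exact: cvg_mx_entry.
have cw k : w x 0 k @[x --> F] --> w0 0 k by exact: cvg_mx_entry.
by apply: cvgD; (apply: cvgM; [apply: cvgD; apply: cvgM|]).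
Qed.

Lemma speed_chart c t (i : chart A) : (\forall x \near t, dom i (c x)) ->
  derivable (coord i \o c) t 1 ->
  speed g c t = Num.sqrt (bilin (gram g i (coord i (c t))) (derive1 (coord i \o c) t)
    (derive1 (coord i \o c) t)).
Proof.
move=> near_i du; have it := nbhs_singleton near_i; rewrite /speed; set j := chart_at A (c t).
have jt : dom j (c t) by exact: chart_atP.
pose tau := coord j \o param i : 'rV[R]_2 -> 'rV[R]_2.
have [tau_der _] := transition_smooth i j 1.
have dtau : differentiable tau ((coord i \o c) t) by apply: tau_der; exists (c t).
have -> : derive1 (coord j \o c) t = derive1 (tau \o (coord i \o c)) t.
  by apply: near_eq_derive1; apply: filterS near_i => x ix; rewrite /tau /= coordK.
move/derivable1_diffP: (du) => du'.
rewrite derive1E (deriveE _ (differentiable_comp du' dtau)) (diff_comp du' dtau) /=.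
rewrite -(deriveE _ du') -derive1E -(deriveE _ dtau).
by rewrite (gram_compat g it jt) /= coordK.
Qed.

Section Speed.
Variables (c : R -> M) (a b : R) (s : seq R).
Hypothesis c_C1 : piecewise_C1_on A c a b s.

Lemma curve_cvg z t : has_side z a b s t -> c x @[x --> approach z t] --> c t.
Proof.
have [c_cont _ _] := c_C1; move=> side U cU.
have [e e0 near_t] := (within_itvP _ _ _).1 c_cont t (has_side_itv side) U cU.
have near_e : \forall x \near t, `|x - t| < e.
  by apply/nbhs_ballP; exists e => // x; rewrite /ball /= distrC.
apply: filterS2 (near_has_side side) (near_approach z near_e) => x [xab _]; apply: near_t; lra.
Qed.

Lemma speed_cvg z t : has_side z a b s t -> cvg (speed g c x @[x --> approach z t]).
Proof.
have [c_cont c_der c_side] := c_C1; move=> side; pose i := chart_at A (c t).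
have it : dom i (c t) by exact: chart_atP.
have /cvg_ex[l u'_l] := c_side z t i side it.
have u_cvg : coord i (c x) @[x --> approach z t] --> coord i (c t).
  exact: cvg_comp (curve_cvg side) (coord_continuous it).
have gram_cvg : gram g i (coord i (c x)) @[x --> approach z t] --> gram g i (coord i (c t)).
  by apply: cvg_comp u_cvg _; apply: (gram_smooth g i 0); exists (c t).
pose S x := bilin (gram g i (coord i (c x))) (derive1 (coord i \o c) x) (derive1 (coord i \o c) x).
have S_cvg : cvg (Num.sqrt (S x) @[x --> approach z t]).
  have S_l : S x @[x --> approach z t] --> bilin (gram g i (coord i (c t))) l l.
    exact: cvg_bilin.
  exact: cvgP _ (continuous_cvg _ (@sqrt_continuous R _) S_l).
apply: near_eq_is_cvg S_cvg; apply: filterS (near_side_dom c_cont side it) => x [xab xs ix].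
rewrite (speed_chart (i := i)) //; last exact: c_der.
have x_ab : x \in `]a, b[ by rewrite in_itv.
have xab' : a <= x <= b by lra.
apply: filterS2 (near_in_itvoo x_ab) (near_dom c_cont xab' ix) => y.
by rewrite in_itv /= => yab; apply; lra.
Qed.

Lemma speed_continuous t : a < t < b -> t \notin s -> {for t, continuous (speed g c)}.
Proof.
move=> tab ts; apply: cvg_nbhs_continuous; rewrite -approach_both.
by apply: speed_cvg; apply: Or31.
Qed.

Lemma speed_bounded_side z t : z = 1 \/ z = -1 -> a <= t <= b ->
  exists B, \forall x \near approach z t, a <= x <= b -> speed g c x <= B.
Proof.
move=> z1 tab; have [side|no_side] := pselect (has_side z a b s t).
  have /cvg_ex[l speed_l] := speed_cvg side; exists (l + 1).
  move/cvgrPdist_lt: speed_l => /(_ 1 ltr01); apply: filterS => x xl _.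
  by move: xl; rewrite distrC ltr_norml; lra.
exists 0; apply: approachW => x; case: z1 no_side => -> no_side [z0|side] xab; try lra.
  by case: no_side; apply: Or32; split=> //; lra.
by case: no_side; apply: Or33; split=> //; lra.
Qed.

Lemma speed_bounded : a <= b -> exists B, forall t, a <= t <= b -> speed g c t <= B.
Proof.
move=> ab; apply: (@segment_induction _ (fun x y => exists B, forall t, x <= t <= y ->
  speed g c t <= B)) ab _ _ => [t tab|x y z _ _ [B xyB] [B' yzB']].
  have [B1 B1_right] := speed_bounded_side (or_introl erefl) tab.
  have [B2 B2_left] := speed_bounded_side (or_intror erefl) tab.
  pose B := Num.max (speed g c t) (Num.max B1 B2).
  have : \forall x \near t, a <= x <= b -> speed g c x <= B.
    apply: nbhs_left_right; last by rewrite /B le_max lexx.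
      by apply: filterS B2_left => x xB /xB; rewrite /B !le_max => ->; rewrite !orbT.
    by apply: filterS B1_right => x xB /xB; rewrite /B !le_max => ->; rewrite !orbT.
  move=> /nbhs_ballP[e /= e0 near_t]; exists e => // x y axt tyb xe ye; exists B => w xwy.
  by apply: near_t; [rewrite /ball /= ltr_norml; lra|lra].
exists (Num.max B B') => t xtz; rewrite le_max; have [ty|yt] := leP t y.
  by rewrite xyB //; lra.
by rewrite yzB' ?orbT //; lra.
Qed.

Lemma finite_measurable_fun (f : R -> R) (r : seq R) :
  measurable [set` r] /\ measurable_fun [set` r] f.
Proof.
elim: r => [|y r [r_meas f_meas]].
  by rewrite set_nil; split; [exact: measurable0|exact: measurable_fun_set0].
have -> : [set` y :: r] = [set y] `|` [set` r].
  apply/seteqP; split=> x /=; rewrite in_cons; first by case/predU1P; [left|right].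
  by case=> ->; rewrite ?eqxx ?orbT.
split; first exact: measurableU.
by apply/measurable_funU => //; split=> //; exact: measurable_fun_set1.
Qed.

Lemma speed_measurable : measurable_fun `[a, b] (speed g c).
Proof.
pose r := [:: a, b & s]; have [r_meas speed_r] := finite_measurable_fun (speed g c) r.
pose D := `]a, b[%classic `\` [set` s].
have D_open : open D.
  rewrite /D setDE; apply: openI; [exact: interval_open|apply: closed_openC].
  exact: (accessible_finite_set_closed.1 (hausdorff_accessible (@Rhausdorff R)) _ (finite_seq s)).
have speed_D : measurable_fun D (speed g c).
  apply: open_continuous_measurable_fun => // t; rewrite inE => -[/=]; rewrite in_itv /= => tab ts.
  by apply: speed_continuous => //; exact/negP.
have speed_Dr : measurable_fun (D `|` [set` r]) (speed g c).
  by apply/measurable_funU => //; exact: open_measurable.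
apply: measurable_funS speed_Dr; first by apply: measurableU => //; exact: open_measurable.
move=> t; rewrite /= in_itv /= => tab; have [ts|ts] := boolP (t \in r); [by right|left].
move: ts; rewrite !in_cons !negb_or => /and3P[ta tb ts]; split; last exact/negP.
by rewrite /= in_itv /= !lt_neqAle eq_sym ta tb.
Qed.

Lemma speed_integrable : a < b ->
  (@lebesgue_measure R).-integrable `[a, b] (EFin \o speed g c).
Proof.
move=> ab; have [B speed_B] := speed_bounded (ltW ab).
apply: measurable_bounded_integrable => //.
- by rewrite /= lebesgue_measure_itv /= lte_fin ab ltry.
- exact: speed_measurable.
- exists `|B|; split; first exact: num_real.
  move=> y By t; rewrite /= in_itv /= => tab; rewrite ger0_norm ?speed_ge0 //.
  exact: le_trans (speed_B t tab) (le_trans (ler_norm B) (ltW By)).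
Qed.

Lemma arclength_exists : a < b -> exists L, arclength g c L a b /\
  L b - L a = \int[@lebesgue_measure R]_(t in `[a, b]) speed g c t.
Proof.
move=> ab; have c_int := speed_integrable ab.
pose L x := (\int[@lebesgue_measure R]_(t in [set` Interval (BLeft a) (BRight x)]) speed g c t)%R.
exists L; split; last by rewrite /L set_itv1 Rintegral_set1 subr0.
split; first exact: parameterized_integral_continuous (ltW ab) c_int.
exists s; split=> // t tab ts; have /andP[at_ tb] := tab.
have [L_der LE] := continuous_FTC1 tb c_int at_ (speed_continuous tab ts).
by apply: DeriveDef; [exact: L_der|rewrite -derive1E; exact: LE].
Qed.

End Speed.

Lemma piecewise_C1P c : piecewise_C1 A c <-> exists s, piecewise_C1_on A c 0 1 s.
Proof.
split=> [[c_cont [s cP]]|[s [c_cont c_der c_side]]].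
  exists s; split=> // [t i t01 ts it|z t i side it].
    by have [|/(_ t01 ts)[]] := cP t i _ it; first lra.
  have [c_both c_left c_right] := cP t i (has_side_itv side) it.
  case: side => [[-> t01 ts]|[-> /andP[_ t1]]|[-> /andP[t0 _]]].
  - have [_ u_cont] := c_both t01 ts; rewrite approach_both; exact: cvgP u_cont.
  - by rewrite approach_right; exact: c_right.
  - by rewrite approach_left; exact: c_left.
split=> //; exists s => t i t01 it u; split=> [t01' ts|t0|t1].
- split; first exact: c_der.
  by apply: cvg_nbhs_continuous; rewrite -approach_both; apply: c_side => //; apply: Or31.
- by rewrite -approach_left; apply: c_side => //; apply: Or33; split=> //; lra.
- by rewrite -approach_right; apply: c_side => //; apply: Or32; split=> //; lra.
Qed.

Lemma curve_length_arclength c : piecewise_C1 A c ->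
  exists L, arclength g c L 0 1 /\ L 1 - L 0 = curve_length g c.
Proof. by move=> /piecewise_C1P[s c_C1]; exact: arclength_exists c_C1 ltr01. Qed.

Lemma arclength_curve_length c L : arclength g c L 0 1 ->
  piecewise_C1 A c /\ curve_length g c = L 1 - L 0.
Proof.
move=> cL; have c_C1 : piecewise_C1 A c.
  by have [_ [s [c_C1 _]]] := cL; apply/piecewise_C1P; exists s.
have [L' [cL' <-]] := curve_length_arclength c_C1.
by split=> //; exact: arclength_unique ler01 cL' cL.
Qed.

End Lengths.

Section Distance.
Local Open Scope ring_scope.
Variables (R : realType) (M : topologicalType) (A : smooth_atlas R M) (g : riemannian_metric A).
Implicit Types (a b t e r : R) (p q o : M) (c : R -> M) (L : R -> R).
Local Notation d := (riemannian_dist g).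

Definition curve_of_length p q r := exists c L a b,
  [/\ a < b, arclength g c L a b, c a = p, c b = q & L b - L a = r].

Definition rectifiably_joined p q := exists r, curve_of_length p q r.

Lemma curve_of_length_ge0 p q r : curve_of_length p q r -> 0 <= r.
Proof.
by move=> [c [L [a [b [/ltW ab cL _ _ <-]]]]]; rewrite subr_ge0; exact: arclength_ndecr cL.
Qed.

Lemma curve_of_length_reparametrize p q r a' b' : a' < b' -> curve_of_length p q r ->
  exists c L, [/\ arclength g c L a' b', c a' = p, c b' = q & L b' - L a' = r].
Proof.
move=> ab' [c [L [a [b [ab cL <- <- <-]]]]]; pose k := (b - a) / (b' - a').
have k0 : 0 < k by rewrite divr_gt0 ?subr_gt0.
have ka : k * a' + (a - k * a') = a by ring.
have kb : k * b' + (a - k * a') = b by rewrite /k; field; rewrite subr_eq0 gt_eqF.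
exists (fun t => c (k * t + (a - k * a'))), (fun t => Num.sg k * L (k * t + (a - k * a'))).
split; rewrite ?ka ?kb //; last by rewrite gtr0_sg // !mul1r.
by apply: arclength_affine cL => [|t tab]; [exact: lt0r_neq0|rewrite -{1}ka -{1}kb; nra].
Qed.

Lemma arclength_cst p r a b : arclength g (fun=> p) (fun=> r) a b.
Proof.
have d0 (i : chart A) t : derive1 (coord i \o (fun=> p)) t = 0.
  by rewrite derive1E; exact: derive_cst.
split; first by apply: continuous_subspaceT => t; exact: cvg_cst.
exists [::]; split=> [|t _ _].
  split=> [|t i _ _ _|z t i _ _]; first by apply: continuous_subspaceT => t; exact: cvg_cst.
    exact: derivable_cst.
  rewrite (_ : derive1 _ = fun=> 0); last exact/funext/d0.
  exact: is_cvg_cst.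
rewrite /speed d0 bilin_row2 !mxE !(mul0r, mulr0, addr0) sqrtr0.
exact: is_derive_cst.
Qed.

Lemma curve_of_length_refl p : curve_of_length p p 0.
Proof.
exists (fun=> p), (fun=> 0), 0, 1.
by split; [exact: ltr01|exact: arclength_cst| | |rewrite subrr].
Qed.

Lemma curve_of_length_sym p q r : curve_of_length p q r -> curve_of_length q p r.
Proof.
move=> [c [L [a [b [ab cL <- <- <-]]]]].
exists (fun t => c (-1 * t + 0)), (fun t => Num.sg (-1) * L (-1 * t + 0)), (- b), (- a).
split; rewrite ?mulN1r ?opprK ?addr0 ?ltrN2 //; last by rewrite ltr0_sg ?ltrN10 //; ring.
by apply: arclength_affine cL => [|t tab]; [rewrite oppr_eq0 oner_eq0|lra].
Qed.

Lemma curve_of_length_trans p q o r r' :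
  curve_of_length p q r -> curve_of_length q o r' -> curve_of_length p o (r + r').
Proof.
move=> /(curve_of_length_reparametrize (ltrN10 R))[c [L [cL <- c0 <-]]].
move=> /(curve_of_length_reparametrize ltr01)[c' [L' [c'L' c'0 <- <-]]].
have L''_shift : arclength g c' (fun t => L' t + (L 0 - L' 0)) 0 1.
  have [L'_cont [s [c'_C1 L'_der]]] := c'L'; split.
    by apply: within_continuousD L'_cont _; apply: continuous_subspaceT => t; exact: cvg_cst.
  exists s; split=> // t t01 ts; have D := L'_der t t01 ts.
  rewrite (_ : (fun t => _) = L' \+ cst (L 0 - L' 0)) //.
  by apply: is_derive_eq; rewrite addr0.
have cc' : c 0 = c' 0 by rewrite c0 c'0.
have LL' : L 0 = L' 0 + (L 0 - L' 0) by ring.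
exists (glue 0 c c'), (glue 0 L (fun t => L' t + (L 0 - L' 0))), (-1), 1; split.
- exact: lt_trans (ltrN10 R) ltr01.
- exact: (arclength_glue (ltrN10 R) ltr01 cc' LL' cL L''_shift).
- by rewrite glue_left ?lerN10.
- by rewrite glue_right.
- by rewrite glue_right // glue_left ?lerN10 //; ring.
Qed.

Lemma curve_of_length_split p q r r1 : curve_of_length p q r -> 0 <= r1 <= r ->
  exists o, curve_of_length p o r1 /\ curve_of_length o q (r - r1).
Proof.
move=> pq r1r; have [c [L [a [b [ab cL ca cb Lab]]]]] := pq; have [L_cont _] := cL.
have [|t] := @IVT R L a b (L a + r1) (ltW ab) L_cont.
  by rewrite minElt maxElt; case: ifP => h; lra.
rewrite in_itv /= => tab Lt; exists (c t).
have [ta|at_] : t = a \/ a < t by lra.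
  have -> : r1 = 0 by rewrite ta in Lt; lra.
  by rewrite ta ca subr0; split; [exact: curve_of_length_refl|].
have [tb|tb] : t = b \/ t < b by lra.
  have -> : r1 = r by rewrite tb in Lt; lra.
  by rewrite tb cb subrr; split; [|exact: curve_of_length_refl].
split; [exists c, L, a, t|exists c, L, t, b]; split=> //; try lra;
  by apply: arclength_subset cL; lra.
Qed.

Lemma dist_curve p q : d p q = inf [set r | curve_of_length p q r].
Proof.
rewrite /riemannian_dist; congr inf; apply/seteqP; split=> r /=.
  move=> [c [c_C1 c0 c1] <-]; have [L [cL LE]] := curve_length_arclength g c_C1.
  by exists c, L, 0, 1; split.
move=> /(curve_of_length_reparametrize ltr01)[c [L [cL c0 c1 <-]]].
by have [c_C1 <-] := arclength_curve_length cL; exists c.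
Qed.

Lemma dist_le p q r : curve_of_length p q r -> d p q <= r.
Proof.
move=> pq; rewrite dist_curve; apply: ge_inf => //.
by exists 0 => x; exact: curve_of_length_ge0.
Qed.

Lemma dist_ge0 p q : 0 <= d p q.
Proof.
rewrite dist_curve; have [[r pq]|npq] := pselect (rectifiably_joined p q).
  by apply: lb_le_inf; [exists r|move=> x; exact: curve_of_length_ge0].
by rewrite inf_out // => -[[r pq] _]; apply: npq; exists r.
Qed.

Lemma dist_sym p q : d p q = d q p.
Proof.
by rewrite !dist_curve; congr inf; apply/seteqP; split=> r; exact: curve_of_length_sym.
Qed.

Lemma dist_refl p : d p p = 0.
Proof. by apply/le_anti; rewrite dist_ge0 (dist_le (curve_of_length_refl p)). Qed.

Lemma dist_lt p q r : rectifiably_joined p q -> d p q < r ->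
  exists2 r', r' < r & curve_of_length p q r'.
Proof.
move=> [r0 pq]; rewrite dist_curve => /inf_lt[|r' pq' r'r]; last by exists r'.
by exists r0.
Qed.

Lemma dist_triangle p q o : rectifiably_joined p q -> rectifiably_joined q o ->
  d p o <= d p q + d q o.
Proof.
move=> pq qo; apply/ler_addgt0Pr => e e0.
have [|r1 r1_lt pq1] := dist_lt (r := d p q + e / 2) pq; first lra.
have [|r2 r2_lt qo2] := dist_lt (r := d q o + e / 2) qo; first lra.
by apply: le_trans (dist_le (curve_of_length_trans pq1 qo2)) _; lra.
Qed.

Lemma dist_split p q r1 r : rectifiably_joined p q -> 0 <= r1 -> d p q < r1 + r -> 0 <= r ->
  exists o, d p o <= r1 /\ d o q <= r.
Proof.
move=> pq r10 dr r0; have [r' r'r pq'] := dist_lt pq dr.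
have [r1r'|/ltW r'r1] := leP r1 r'.
  have [|o [po oq]] := curve_of_length_split (r1 := r1) pq'; first by rewrite r10.
  by exists o; split; [exact: dist_le|apply: le_trans (dist_le oq) _; lra].
by exists q; split; [exact: le_trans (dist_le pq') r'r1|rewrite dist_refl].
Qed.

End Distance.

(** * The Riemannian distance defines the topology *)

Section PositiveDefinite.
Local Open Scope ring_scope.
Variable R : realType.
Implicit Types (v : 'rV[R]_2) (G : 'M[R]_2).

Lemma mxtrace2 G : \tr G = G 0 0 + G 1 1.
Proof.
rewrite /mxtrace !big_ord_recl big_ord0 addr0.
by have -> : lift ord0 (ord0 : 'I_1) = 1 :> 'I_2 by apply/val_inj.
Qed.

Lemma det_mx2 G : \det G = G 0 0 * G 1 1 - G 0 1 * G 1 0.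
Proof.
have l0 : lift (0 : 'I_2) (0 : 'I_1) = 1 by apply/val_inj.
have l1 : lift (1 : 'I_2) (0 : 'I_1) = 0 by apply/val_inj.
rewrite (expand_det_row _ 0) !big_ord_recl big_ord0 /cofactor !det_mx11 !mxE /= l0 l1 /=.
by rewrite expr0 expr1 mul1r mulN1r mulrN addr0.
Qed.

Lemma bilin_le G v : bilin G v v <= 4 * `|G| * `|v| ^+ 2.
Proof.
have entry_le (j k : 'I_2) : v 0 j * G j k * v 0 k <= `|G| * `|v| ^+ 2.
  apply: le_trans (ler_norm _) _; rewrite !normrM expr2 mulrAC mulrC.
  have Gjk := mx_entry_norm_le G j k.
  by apply: ler_pM => //; rewrite ?mulr_ge0 //; apply: ler_pM => //; exact: mx_entry_norm_le.
have := lerD (lerD (entry_le 0 0) (entry_le 1 0)) (lerD (entry_le 0 1) (entry_le 1 1)).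
by rewrite bilin_row2 !(mulrDl (_ * G _ _)); lra.
Qed.

Lemma bilin_ge G v : G^T = G -> 0 < \tr G ->
  \det G / \tr G * (v 0 0 ^+ 2 + v 0 1 ^+ 2) <= bilin G v v.
Proof.
move=> G_sym tr0; have G10 : G 1 0 = G 0 1 by rewrite -[in LHS]G_sym mxE.
rewrite mulrAC ler_pdivrMr // bilin_row2 mxtrace2 det_mx2 G10 -subr_ge0.
(* The difference is the squared norm of [G v]. *)
have -> : ((v 0 0 * G 0 0 + v 0 1 * G 0 1) * v 0 0 + (v 0 0 * G 0 1 + v 0 1 * G 1 1) * v 0 1) *
    (G 0 0 + G 1 1) - (G 0 0 * G 1 1 - G 0 1 * G 0 1) * (v 0 0 ^+ 2 + v 0 1 ^+ 2) =
    (G 0 0 * v 0 0 + G 0 1 * v 0 1) ^+ 2 + (G 0 1 * v 0 0 + G 1 1 * v 0 1) ^+ 2 by ring.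
by rewrite addr_ge0 // sqr_ge0.
Qed.

Lemma sqrt_bilin_ge G v k : 0 <= k -> G^T = G -> 0 < \tr G -> k ^+ 2 <= \det G / \tr G ->
  k * `|v| <= Num.sqrt (bilin G v v).
Proof.
move=> k0 G_sym tr0 k_le.
have entry_le a : a ^+ 2 <= v 0 0 ^+ 2 + v 0 1 ^+ 2 -> k * `|a| <= Num.sqrt (bilin G v v).
  move=> av; rewrite -[k]ger0_norm // -normrM -sqrtr_sqr; apply: ler_wsqrtr.
  apply: le_trans (bilin_ge v G_sym tr0); rewrite exprMn.
  by apply: ler_pM; rewrite ?sqr_ge0.
have [kp|->] : 0 < k \/ k = 0 by lra.
  rewrite mulrC -ler_pdivlMr //; apply: norm_row2_le; rewrite ler_pdivlMr // mulrC;
    by apply: entry_le; rewrite ?lerDl ?lerDr sqr_ge0.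
by rewrite mul0r sqrtr_ge0.
Qed.

Lemma posdef_mxtrace_det G : G^T = G -> (forall v, v != 0 -> 0 < bilin G v v) ->
  0 < \tr G /\ 0 < \det G.
Proof.
move=> G_sym posdef; have G10 : G 1 0 = G 0 1 by rewrite -[in LHS]G_sym mxE.
have row2_neq0 (a b : R) : a != 0 \/ b != 0 -> row2 a b != 0.
  by case=> nz; apply: contra_neq nz => e; rewrite -(row2_0 a b, row2_1 a b) e mxE.
have G00 : 0 < G 0 0.
  have := posdef _ (row2_neq0 1 0 (or_introl (oner_neq0 _))).
  by rewrite bilin_row2 row2_0 row2_1; lra.
have G11 : 0 < G 1 1.
  have := posdef _ (row2_neq0 0 1 (or_intror (oner_neq0 _))).
  by rewrite bilin_row2 row2_0 row2_1; lra.
split; first by rewrite mxtrace2 addr_gt0.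
have := posdef _ (row2_neq0 (- G 0 1) (G 0 0) (or_intror (lt0r_neq0 G00))).
rewrite bilin_row2 row2_0 row2_1 det_mx2 G10.
have -> : (- G 0 1 * G 0 0 + G 0 0 * G 0 1) * - G 0 1 +
  (- G 0 1 * G 0 1 + G 0 0 * G 1 1) * G 0 0 = G 0 0 * (G 0 0 * G 1 1 - G 0 1 * G 0 1) by ring.
by rewrite pmulr_rgt0.
Qed.

End PositiveDefinite.

Section LocalComparison.
Local Open Scope ring_scope.
Variables (R : realType) (M : topologicalType) (A : smooth_atlas R M) (g : riemannian_metric A).

Lemma derive1_line (W : normedModType R) (f : 'rV[R]_2 -> W) (x0 v : 'rV[R]_2) (x : R) :
  derive1 (fun t : R => f (x0 + t *: v)) x = 'D_v f (x0 + x *: v) /\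
  (derivable f (x0 + x *: v) v -> derivable (fun t : R => f (x0 + t *: v)) x 1).
Proof.
have quotientE : (fun h : R => h^-1 *: (((fun t : R => f (x0 + t *: v)) \o shift x) (h *: (1 : R)) -
    f (x0 + x *: v))) =
    (fun h : R => h^-1 *: ((f \o shift (x0 + x *: v)) (h *: v) - f (x0 + x *: v))).
  apply/funext => h /=; congr (_ *: (f _ - _)).
  have -> : h *: (1 : R) = h by rewrite /GRing.scale /= mulr1.
  by rewrite scalerDl addrCA.
by rewrite derive1E /derive /derivable quotientE.
Qed.

Lemma nbhs_chart_domain (i : chart A) p : dom i p -> nbhs (coord i p) (coord i @` dom i).
Proof. by move=> ip; apply: open_nbhs_nbhs; split; [exact: cod_open|exists p]. Qed.

Lemma nbhs_dom (i : chart A) p : dom i p -> nbhs p (dom i).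
Proof. by move=> ip; apply: open_nbhs_nbhs; split=> //; exact: dom_open. Qed.

Lemma nbhs_param (i : chart A) p (U : set M) : dom i p -> nbhs p U ->
  nbhs (coord i p) (param i @^-1` U).
Proof. by move=> ip pU; apply: (param_continuous ip); rewrite coordK. Qed.

Lemma nbhs_overlap (i j : chart A) p : dom i p -> dom j p ->
  nbhs (coord i p) (coord i @` (dom i `&` dom j)).
Proof.
move=> ip jp; apply: filterS2 (nbhs_chart_domain ip) (nbhs_param ip (nbhs_dom jp)) => y.
by move=> [q iq <-]; rewrite /= coordK // => jq; exists q.
Qed.

Lemma gram_continuous (i : chart A) p : dom i p -> {for coord i p, continuous (gram g i)}.
Proof. by move=> ip; apply: (gram_smooth g i 0); exists p. Qed.

Section ChartSegment.
Variables (i : chart A) (x0 v : 'rV[R]_2).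
Hypothesis segment_chart : forall t : R, 0 <= t <= 1 -> (coord i @` dom i) (x0 + t *: v).

Definition chart_segment (t : R) := param i (x0 + t *: v).

Lemma line_continuous : continuous (fun t : R => x0 + t *: v).
Proof.
by move=> t; apply: cvgD; [exact: cvg_cst|apply: cvgZ; [exact: cvg_id|exact: cvg_cst]].
Qed.

Lemma chart_segmentK t : 0 <= t <= 1 ->
  dom i (chart_segment t) /\ coord i (chart_segment t) = x0 + t *: v.
Proof. by move=> /segment_chart[q iq qE]; rewrite /chart_segment -qE coordK. Qed.

Lemma near_segment_overlap t (j : chart A) : 0 <= t <= 1 -> dom j (chart_segment t) ->
  \forall x \near t, (coord i @` (dom i `&` dom j)) (x0 + x *: v).
Proof.
move=> /chart_segmentK[it cE] jt; apply: line_continuous.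
by rewrite -cE; exact: nbhs_overlap.
Qed.

Lemma derive1_chart_segment (j : chart A) t : (coord i @` (dom i `&` dom j)) (x0 + t *: v) ->
  derive1 (coord j \o chart_segment) t = 'D_v (coord j \o param i) (x0 + t *: v) /\
  derivable (coord j \o chart_segment) t 1.
Proof.
move=> overlap; have [cE c_der] := derive1_line (coord j \o param i) x0 v t.
split; first exact: cE.
have [transition_der _] := transition_smooth i j 1.
by apply: c_der; apply: diff_derivable; exact: transition_der.
Qed.

Lemma chart_segment_C1 : piecewise_C1_on A chart_segment 0 1 [::].
Proof.
split=> [|t j t01 _ jt|z t j /has_side_itv t01 jt].
- apply/within_itvP => t t01 U cU; have [it cE] := chart_segmentK t01.
  have := param_continuous it; rewrite cE => /(_ U cU)/line_continuous/nbhs_ballP[e e0 near_t].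
  by exists e => // x _ xt; apply: near_t; rewrite /ball /= distrC.
- have t01' : 0 <= t <= 1 by lra.
  by have [] := derive1_chart_segment (nbhs_singleton (near_segment_overlap t01' jt)).
have near_t := near_segment_overlap t01 jt; have t_overlap := nbhs_singleton near_t.
have [_ derive_cont] := transition_smooth i j 1.
have D_cvg := @continuous_comp _ _ _ (fun x : R => x0 + x *: v)
  (fun y => 'D_v (coord j \o param i) y) t (@line_continuous t) (derive_cont v _ t_overlap).
apply: (near_eq_is_cvg (f := fun x : R => 'D_v (coord j \o param i) (x0 + x *: v))).
  by apply: near_approach; apply: filterS near_t => x /derive1_chart_segment[-> _].
by apply: cvgP; apply: cvg_within_filter D_cvg.
Qed.

Lemma speed_chart_segment t : 0 <= t <= 1 ->
  speed g chart_segment t = Num.sqrt (bilin (gram g i (x0 + t *: v)) v v).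
Proof.
move=> t01; have [it cE] := chart_segmentK t01.
have near_t := near_segment_overlap t01 it.
have [_ c_der] := derive1_chart_segment (nbhs_singleton near_t).
have near_E : \forall x \near t, dom i (chart_segment x) /\
    (coord i \o chart_segment) x = x0 + x *: v.
  by apply: filterS near_t => x [q [iq _] qE]; rewrite /= /chart_segment -qE coordK.
rewrite (speed_chart g (i := i)) //; last by apply: filterS near_E => x [].
have -> : derive1 (coord i \o chart_segment) t = v.
  rewrite (near_eq_derive1 (h := fun x : R => x0 + x *: v)); last by apply: filterS near_E => x [].
  by have [-> _] := derive1_line (@id 'rV[R]_2) x0 v t; rewrite derive_id.
by rewrite cE.
Qed.

Lemma chart_segment_length B :
  (forall t, 0 <= t <= 1 -> bilin (gram g i (x0 + t *: v)) v v <= B ^+ 2) -> 0 <= B ->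
  exists2 r, r <= B & curve_of_length g (param i x0) (param i (x0 + v)) r.
Proof.
move=> gram_le B0; have [L [cL _]] := arclength_exists g chart_segment_C1 ltr01.
exists (L 1 - L 0); last first.
  exists chart_segment, L, 0, 1; split=> //.
    by rewrite /chart_segment scale0r addr0.
  by rewrite /chart_segment scale1r.
have := arclength_le ler01 cL (B := B) _; rewrite subr0 mulr1; apply=> t t01.
have t01' : 0 <= t <= 1 by lra.
rewrite speed_chart_segment // -[leRHS]ger0_norm // -sqrtr_sqr.
by apply: ler_wsqrtr; exact: gram_le.
Qed.

End ChartSegment.

Lemma nbhs_curve_lt p (e : R) : 0 < e ->
  nbhs p [set q | exists2 r, r < e & curve_of_length g p q r].
Proof.
move=> e0; pose i := chart_at A p; have ip : dom i p by exact: chart_atP.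
pose x0 := coord i p; pose B := `|gram g i x0| + 1.
have B1 : 1 <= B by rewrite lerDr.
have B0 : 0 < B := lt_le_trans ltr01 B1.
have near_B : nbhs x0 [set y | `|gram g i y| < B].
  have /cvgr_lt : `|gram g i y| @[y --> x0] --> `|gram g i x0|.
    exact: cvg_norm (gram_continuous ip).
  by apply; rewrite /B ltrDl.
have /nbhs_ballP[r0 r00 ball_r0] : nbhs x0 ((coord i @` dom i) `&` [set y | `|gram g i y| < B]).
  by apply: filterI near_B; exact: nbhs_chart_domain.
have r10 : 0 < Num.min r0 (e / (2 * B)) by rewrite lt_min r00 divr_gt0 // mulr_gt0.
have near_x0 : nbhs x0 (ball x0 (Num.min r0 (e / (2 * B)))) by exact: nbhsx_ballx.
apply: filterS2 (nbhs_dom ip) (coord_continuous ip near_x0) => q iq.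
rewrite /= -ball_normE /= lt_min => /andP[q_r0 q_e].
pose v := coord i q - x0.
have in_ball t : 0 <= t <= 1 -> ball x0 r0 (x0 + t *: v).
  move=> /andP[t0 t1]; rewrite -ball_normE /= opprD addNKr normrN normrZ ger0_norm //.
  by apply: le_lt_trans q_r0; rewrite distrC ler_piMl.
have in_chart t : 0 <= t <= 1 -> (coord i @` dom i) (x0 + t *: v) by move=> /in_ball/ball_r0[].
have [t /in_ball/ball_r0[_ /ltW gB]||r r_le pq] :=
  chart_segment_length in_chart (B := 2 * B * `|v|).
- apply: le_trans (bilin_le _ _) _.
  have -> : (2 * B * `|v|) ^+ 2 = 4 * B ^+ 2 * `|v| ^+ 2 by ring.
  by rewrite ler_wpM2r ?sqr_ge0 // ler_wpM2l // (le_trans gB) // expr2 ler_peMr // ltW.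
- by rewrite !mulr_ge0 // ltW.
exists r; last by move: pq; rewrite coordK // /v addrC subrK coordK.
by apply: le_lt_trans r_le _; rewrite mulrC -ltr_pdivlMr ?mulr_gt0 // distrC.
Qed.

Lemma nbhs_speed_ge (i : chart A) p : dom i p -> exists2 k : R, 0 < k & \forall y \near coord i p,
  forall v, k * `|v| <= Num.sqrt (bilin (gram g i y) v v).
Proof.
move=> ip; pose x0 := coord i p; pose G y := gram g i y.
have posdef y : (coord i @` dom i) y -> [/\ (G y)^T = G y, 0 < \tr (G y) & 0 < \det (G y)].
  move=> [q iq <-]; have [] := posdef_mxtrace_det (gram_sym g iq) (gram_posdef g iq).
  by split=> //; exact: gram_sym.
have [_ tr0 det0] := posdef x0 (nbhs_singleton (nbhs_chart_domain ip)).
have G_cvg (j l : 'I_2) : G y j l @[y --> x0] --> G x0 j l.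
  exact: (cvg_mx_entry (f := G) (gram_continuous ip)).
have near_det : \forall y \near x0, \det (G x0) / 2 < \det (G y).
  have /cvgr_gt : \det (G y) @[y --> x0] --> \det (G x0).
    rewrite det_mx2; under eq_fun do rewrite det_mx2.
    exact: (cvgB (cvgM (G_cvg 0 0) (G_cvg 1 1)) (cvgM (G_cvg 0 1) (G_cvg 1 0))).
  by apply; lra.
have near_tr : \forall y \near x0, \tr (G y) < 2 * \tr (G x0).
  have /cvgr_lt : \tr (G y) @[y --> x0] --> \tr (G x0).
    by rewrite mxtrace2; under eq_fun do rewrite mxtrace2; exact: (cvgD (G_cvg 0 0) (G_cvg 1 1)).
  by apply; lra.
pose k2 := \det (G x0) / 2 / (2 * \tr (G x0)).
have k20 : 0 < k2 by rewrite !divr_gt0 // mulr_gt0.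
exists (Num.sqrt k2); first by rewrite sqrtr_gt0.
apply: filterS3 (nbhs_chart_domain ip) near_det near_tr.
move=> y /posdef[G_sym tr_y det_y] det_ge tr_le v.
apply: sqrt_bilin_ge => //; rewrite sqr_sqrtr ?(ltW k20) // /k2.
rewrite ler_pdivlMr // mulrAC ler_pdivrMr ?mulr_gt0 //; nra.
Qed.

End LocalComparison.

(** * Closed balls of a complete Riemannian plane are bounded *)

Section ChartBall.
Local Open Scope ring_scope.
Variables (R : realType) (M : topologicalType) (A : smooth_atlas R M) (g : riemannian_metric A).
Variables (i : chart A) (x0 : 'rV[R]_2) (r k : R).
Hypothesis M_hausdorff : hausdorff_space M.
Hypothesis k_gt0 : 0 < k.
Hypothesis chart_speed_ge : forall y, `|x0 - y| < r ->
  (coord i @` dom i) y /\ forall v, k * `|v| <= Num.sqrt (bilin (gram g i y) v v).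

Definition chart_ball : set M := [set q | dom i q /\ `|x0 - coord i q| < r].

Lemma nbhs_chart_ball q : chart_ball q -> nbhs q chart_ball.
Proof.
move=> [iq qr]; have ball_q : nbhs (coord i q) (ball x0 r).
  by apply: open_nbhs_nbhs; split; [exact: ball_open|rewrite -ball_normE].
apply: filterS2 (nbhs_dom iq) (coord_continuous iq ball_q) => q' iq'.
by rewrite /= -ball_normE.
Qed.

Lemma chart_ball_closed s : s < r -> closed (param i @` [set y | `|x0 - y| <= s]).
Proof.
move=> sr; apply: compact_closed => //; apply: continuous_compact (@compact_norm_le R x0 s).
apply: continuous_in_subspaceT => y; rewrite inE /= => /le_lt_trans/(_ sr).
by case/chart_speed_ge => -[q iq <-] _; exact: param_continuous.
Qed.

Lemma coord_lipschitz c (L : R -> R) a b : a <= b -> arclength g c L a b ->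
  (forall t, a <= t <= b -> chart_ball (c t)) ->
  `|coord i (c a) - coord i (c b)| <= (L b - L a) / k.
Proof.
move=> ab [L_cont [s [[c_cont c_der _] L_der]]] c_ball.
have entry_cont (j : 'I_2) : {within `[a, b], continuous (fun t => coord i (c t) 0 j)}.
  apply/within_itvP => t tab V tV; have [it _] := c_ball t tab.
  have entry_V : nbhs (c t) [set q | V (coord i q 0 j)].
    exact: (coord_continuous it (@matrix_normedtype.coord_continuous R 1 2 0 j _ V tV)).
  exact: ((within_itvP c a b).1 c_cont t tab _ entry_V).
have entry_le (j : 'I_2) : `|(coord i (c a) - coord i (c b)) 0 j| <= (L b - L a) / k.
  rewrite !mxE mulrC mulrBr.
  apply: (@normB_le_off_finite _ (fun t => coord i (c t) 0 j) (fun t => k^-1 * L t)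
    (fun t => derive1 (coord i \o c) t 0 j) (fun t => k^-1 * speed g c t) s) => //.
    exact: within_itvZ.
  move=> t tab ts; have tab' : a <= t <= b by lra.
  have [it t_ball] := c_ball t tab'; have D := c_der t i tab ts it; have DL := L_der t tab ts.
  split.
  - apply: DeriveDef; first by move/derivable_mxP: D; apply.
    by rewrite derive1E derive_mx // mxE.
  - have -> : (fun t => k^-1 * L t) = k^-1 \*: L by [].
    exact: is_derive_eq.
  rewrite mulrC ler_pdivlMr // mulrC.
  have near_i : \forall x \near t, dom i (c x).
    have t_ab : t \in `]a, b[ by rewrite in_itv.
    apply: filterS2 (near_in_itvoo t_ab) (near_dom c_cont tab' it) => x.
    by rewrite in_itv /= => xab; apply; lra.
  rewrite (speed_chart g near_i D); have [_ speed_ge] := chart_speed_ge t_ball.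
  by apply: le_trans (speed_ge _); rewrite ler_pM2l //; exact: mx_entry_norm_le.
by apply: norm_row2_le; exact: entry_le.
Qed.

Lemma short_curve_in_chart_ball c (L : R -> R) a b : a < b -> arclength g c L a b ->
  dom i (c a) -> coord i (c a) = x0 -> L b - L a < k * r ->
  forall t, a <= t <= b -> chart_ball (c t).
Proof.
move=> ab cL ia ca short; have c_cont : {within `[a, b], continuous c}.
  by have [_ [s [[]]]] := cL.
have L_ndecr x y : a <= x -> x <= y -> y <= b -> L x <= L y.
  by move=> ax xy yb; apply: (arclength_ndecr (g := g) xy); exact: arclength_subset cL.
pose s := (L b - L a) / k; have sr : s < r by rewrite /s ltr_pdivrMr // mulrC.
have s0 : 0 <= s by rewrite divr_ge0 ?(ltW k_gt0) // subr_ge0 L_ndecr // ltW.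
apply: real_induction.
- by split=> //; rewrite ca subrr normr0; lra.
- move=> t tab /nbhs_chart_ball t_ball.
  have [|e e0 near_t] := (within_itvP c a b).1 c_cont t _ _ t_ball; first lra.
  by exists e => // x txe xb; apply: near_t; rewrite ?ltr_norml; lra.
move=> t tab before.
have : (param i @` [set y | `|x0 - y| <= s]) (c t).
  apply: (within_itv_closed_left c_cont tab (chart_ball_closed sr)) => x xat.
  have [ix _] := before x xat; exists (coord i (c x)); last exact: coordK.
  rewrite /= -ca; apply: le_trans (coord_lipschitz (L := L) _ _ _) _.
  - by lra.
  - by apply: arclength_subset cL; lra.
  - by move=> y yax; apply: before; lra.
  by rewrite ler_pM2r ?invr_gt0 // lerD2r L_ndecr //; lra.
move=> [y /= y_s <-]; have yr := le_lt_trans y_s sr.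
by have [[q iq yE] _] := chart_speed_ge yr; rewrite -yE coordK //; split=> //; rewrite yE.
Qed.

End ChartBall.

Section Properness.
Local Open Scope ring_scope.
Variables (R : realType) (M : topologicalType) (A : smooth_atlas R M) (g : riemannian_metric A).
Local Notation d := (riemannian_dist g).
Variables (phi : M -> 'rV[R]_2) (phi' : 'rV[R]_2 -> M).
Hypotheses (phiK : cancel phi phi') (phi'K : cancel phi' phi).
Hypotheses (phi_cont : continuous phi) (phi'_cont : continuous phi').
Implicit Types (p q o w : M) (r s e : R).

Lemma plane_hausdorff : hausdorff_space M.
Proof.
move=> p q pq; apply: (can_inj phiK); apply: (@norm_hausdorff R 'rV[R]_2).
move=> U V pU qV; have [x [Ux Vx]] := pq _ _ (phi_cont pU) (phi_cont qV).
by exists (phi x).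
Qed.

Lemma plane_rectifiably_joined p q : rectifiably_joined g p q.
Proof.
pose c t := phi' (phi p + t *: (phi q - phi p)).
have c_cont : continuous c.
  by move=> t; apply: continuous_comp; [exact: line_continuous|exact: phi'_cont].
have c0 : c 0 = p by rewrite /c scale0r addr0 phiK.
have c1 : c 1 = q by rewrite /c scale1r addrC subrK phiK.
rewrite -c0 -c1.
apply: (@segment_induction R (fun x y => rectifiably_joined g (c x) (c y))) => //.
  move=> t _; have /nbhs_ballP[e e0 near_t] := c_cont t _ (nbhs_curve_lt g (c t) ltr01).
  exists e => // x y xt ty xe ye.
  have [|r1 _ tx] := near_t x; first by rewrite /ball /= ltr_norml; lra.
  have [|r2 _ ty'] := near_t y; first by rewrite /ball /= ltr_norml; lra.
  by exists (r1 + r2); apply: curve_of_length_trans (curve_of_length_sym tx) ty'.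
by move=> x y z _ _ [r1 xy] [r2 yz]; exists (r1 + r2); apply: curve_of_length_trans xy yz.
Qed.

Lemma plane_dist_triangle q p o : d p o <= d p q + d q o.
Proof. by apply: dist_triangle; exact: plane_rectifiably_joined. Qed.

Lemma nbhs_dist_lt p e : 0 < e -> nbhs p [set q | d p q < e].
Proof.
move=> e0; apply: filterS (nbhs_curve_lt g p e0) => q [r re pq].
exact: le_lt_trans (dist_le pq) re.
Qed.

Lemma dist_lt_nbhs p (U : set M) : nbhs p U -> exists2 e, 0 < e & forall q, d p q < e -> U q.
Proof.
move=> pU; pose i := chart_at A p; have ip : dom i p by exact: chart_atP.
have [k k0 near_k] := nbhs_speed_ge g ip.
have /nbhs_ballP[r r0 ball_r] : \forall y \near coord i p, [/\ (coord i @` dom i) y,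
    forall v, k * `|v| <= Num.sqrt (bilin (gram g i y) v v) & U (param i y)].
  by apply: filterS3 (nbhs_chart_domain ip) near_k (nbhs_param ip pU).
have chart_r y : `|coord i p - y| < r -> [/\ (coord i @` dom i) y,
    forall v, k * `|v| <= Num.sqrt (bilin (gram g i y) v v) & U (param i y)].
  by move=> yr; apply: ball_r; rewrite -ball_normE.
exists (k * r) => [|q pq]; first exact: mulr_gt0.
suff [iq qr] : chart_ball i (coord i p) r q by have [_ _] := chart_r _ qr; rewrite coordK.
have [r' r'_lt [c [L [a [b [ab cL ca cb LE]]]]]] := dist_lt (plane_rectifiably_joined p q) pq.
rewrite -cb; apply: (short_curve_in_chart_ball plane_hausdorff k0 _ ab cL); rewrite ?ca ?LE //.
  by move=> y /chart_r[].
by rewrite ltW ?lexx.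
Qed.

Definition bounded_ball p r := exists B : R, forall q, d p q <= r -> `|phi q| <= B.

Lemma bounded_ball_extend p s e : 0 < e -> 0 <= s -> bounded_ball p s ->
  (forall w, d p w <= s + e -> bounded_ball w (4 * e)) -> bounded_ball p (s + 2 * e).
Proof.
move=> e0 s0 [B1 B1_bound] local_bound.
have near_bound (y : 'rV[R]_2) : \forall y' \near y & B \near +oo%R, d p (phi' y') <= s ->
    forall q, d (phi' y') q <= 3 * e -> `|phi q| <= B.
  have near_y := phi'_cont (nbhs_dist_lt (phi' y) e0).
  have [pw|pw] := leP (d p (phi' y)) (s + e); last first.
    near=> y' B; have yy' : d (phi' y) (phi' y') < e by near: y'.
    move=> py'; have := plane_dist_triangle (phi' y') p (phi' y).
    by rewrite (dist_sym g (phi' y')); lra.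
  have [B0 B0_bound] := local_bound _ pw.
  near=> y' B.
  have B0B : B0 <= B by near: B; apply: nbhs_pinfty_ge; exact: num_real.
  have yy' : d (phi' y) (phi' y') < e by near: y'.
  move=> _ q y'q; apply: le_trans B0B; apply: B0_bound.
  by apply: le_trans (plane_dist_triangle (phi' y') _ _) _; lra.
have /pinfty_ex_gt0[B _ B_bound] : \forall B \near +oo%R, forall y, `|0 - y| <= B1 ->
    d p (phi' y) <= s -> forall q, d (phi' y) q <= 3 * e -> `|phi q| <= B.
  have /compact_near_coveringP := @compact_norm_le R 0 B1.
  by apply=> y _; exact: near_bound.
exists B => q pq.
have [||m [pm mq]] := dist_split (r := 3 * e) (plane_rectifiably_joined p q) s0.
- by lra.
- by lra.
by apply: (B_bound (phi m)); rewrite /= ?sub0r ?normrN ?phiK //; exact: B1_bound.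
Unshelve. all: by end_near. Qed.

Lemma unbounded_half p r : 0 < r -> ~ bounded_ball p r ->
  exists q, d p q <= r /\ ~ bounded_ball q (r / 2).
Proof.
move=> r0 unbounded; apply: contrapT => no_q; apply: unbounded.
have local_bound q : d p q <= r -> bounded_ball q (4 * (r / 8)).
  have -> : 4 * (r / 8) = r / 2 by lra.
  by move=> pq; apply: contrapT => unbounded; apply: no_q; exists q.
have half : bounded_ball p (4 * (r / 8)) by apply: local_bound; rewrite dist_refl ltW.
have -> : r = 4 * (r / 8) + 2 * (r / 8) + 2 * (r / 8) by lra.
apply: bounded_ball_extend => [||| w pw]; [lra|lra| |by apply: local_bound; lra].
by apply: bounded_ball_extend => [||| w pw]; [lra|lra| |by apply: local_bound; lra].
Qed.

Lemma expn_half_lt r e : 0 < e -> \forall n \near \oo, r / 2 ^+ n < e.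
Proof.
move=> e0; have r0 : 0 < `|r| + 1 by rewrite ltr_pwDr.
near=> n; have : 1 / 2 ^+ n < e / (`|r| + 1).
  by near: n; exact: (near_infty_natSinv_expn_lt (PosNum (divr_gt0 e0 r0))).
rewrite ltr_pdivlMr // mulrC; apply: le_lt_trans; rewrite div1r.
by rewrite ler_wpM2r ?invr_ge0 ?exprn_ge0 //; have := ler_norm r; lra.
Unshelve. all: by end_near. Qed.

Lemma dist_geometric (X : nat -> M) r N n : (forall m, d (X m) (X m.+1) <= r / 2 ^+ m) ->
  0 <= r -> (N <= n)%N -> d (X N) (X n) <= 2 * (r / 2 ^+ N).
Proof.
move=> X_step r0 Nn.
have telescope m : d (X N) (X (N + m)%N) <= 2 * (r / 2 ^+ N) - 2 * (r / 2 ^+ (N + m)).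
  elim: m => [|m IHm]; first by rewrite addn0 dist_refl subrr.
  rewrite addnS; apply: le_trans (plane_dist_triangle (X (N + m)%N) _ _) _.
  have -> : 2 * (r / 2 ^+ (N + m).+1) = r / 2 ^+ (N + m).
    by rewrite exprS invfM; field; rewrite expf_neq0.
  by have := X_step (N + m)%N; lra.
rewrite -(subnKC Nn); apply: le_trans (telescope _) _.
by rewrite lerBlDr lerDl mulr_ge0 // divr_ge0 // exprn_ge0.
Qed.

Hypothesis d_complete : complete_dist d.

Lemma unbounded_sequence p r : 0 < r -> ~ bounded_ball p r ->
  exists X : nat -> M, forall n, d (X n) (X n.+1) <= r / 2 ^+ n /\
    ~ bounded_ball (X n) (r / 2 ^+ n).
Proof.
move=> r0 p_unbounded.
have /choice[next nextP] : forall ws : M * R, exists q, 0 < ws.2 -> ~ bounded_ball ws.1 ws.2 ->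
    d ws.1 q <= ws.2 /\ ~ bounded_ball q (ws.2 / 2).
  move=> [w s]; have [[s0 ws]|nws] := pselect (0 < s /\ ~ bounded_ball w s).
    by have [q wq] := unbounded_half s0 ws; exists q.
  by exists w => s0 ws; case: nws.
pose X := fix X n := if n is n'.+1 then next (X n', r / 2 ^+ n') else p.
have radius_gt0 n : 0 < r / 2 ^+ n by rewrite divr_gt0 // exprn_gt0.
have X_unbounded n : ~ bounded_ball (X n) (r / 2 ^+ n).
  elim: n => [|n IHn]; first by rewrite expr0 divr1.
  have [_] := nextP (X n, r / 2 ^+ n) (radius_gt0 n) IHn.
  by rewrite /= exprS invfM mulrA mulrAC.
exists X => n; split=> //.
by have [] := nextP (X n, r / 2 ^+ n) (radius_gt0 n) (X_unbounded n).
Qed.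

Lemma plane_bounded_ball p r : bounded_ball p r.
Proof.
suff bounded s : 0 < s -> bounded_ball p s.
  have [|B B_bound] := bounded (Num.max r 1); first by rewrite lt_max ltr01 orbT.
  by exists B => q pq; apply: B_bound; rewrite le_max pq.
move=> s0; apply: contrapT => /(unbounded_sequence s0)[X XP].
have X_step n : d (X n) (X n.+1) <= s / 2 ^+ n by have [] := XP n.
have X_near N n : (N <= n)%N -> d (X N) (X n) <= 2 * (s / 2 ^+ N).
  exact: dist_geometric X_step (ltW s0).
have [e e0|x X_cvg] := d_complete (u := X).
  have [N _ small_tail] := expn_half_lt (4 * s) e0; exists N => m n Nm Nn.
  apply: le_lt_trans (plane_dist_triangle (X N) _ _) _; rewrite (dist_sym g (X m)).
  have := X_near N m Nm; have := X_near N n Nn; have := small_tail N (leqnn N).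
  by rewrite /= -mulrA; lra.
have near_x : nbhs x [set q | `|phi q| < `|phi x| + 1].
  have /cvgr_lt : `|phi q| @[q --> x] --> `|phi x| by apply: cvg_norm; exact: phi_cont.
  by apply; rewrite ltrDl.
have [e e0 ball_e] := dist_lt_nbhs near_x; have e2 : 0 < e / 2 by lra.
have [N1 X_close] := X_cvg _ e2; have [N2 _ small_tail] := expn_half_lt s e2.
pose n := maxn N1 N2; have [_ Xn_unbounded] := XP n.
apply: Xn_unbounded; exists (`|phi x| + 1) => q Xq; apply/ltW/ball_e.
apply: le_lt_trans (plane_dist_triangle (X n) _ _) _; rewrite dist_sym.
have := X_close n (leq_maxl _ _); have := small_tail n (leq_maxr _ _); rewrite /=; lra.
Qed.

End Properness.

(** * Transfer to the square grid *)

Section Grid.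
Local Open Scope ring_scope.
Variables (R : realType) (M : topologicalType) (A : smooth_atlas R M) (g : riemannian_metric A).
Local Notation d := (riemannian_dist g).
Variables (phi : M -> 'rV[R]_2) (phi' : 'rV[R]_2 -> M).
Hypotheses (phiK : cancel phi phi') (phi'K : cancel phi' phi).
Hypotheses (phi_cont : continuous phi) (phi'_cont : continuous phi').
Implicit Types (p q : M) (r e t : R) (u v w : 'rV[R]_2) (z : Z2) (c : R -> M) (L : R -> R).

Let triangle q p o : d p o <= d p q + d q o := plane_dist_triangle g phiK phi'_cont q p o.

Definition unit_modulus r e := forall u v, `|u| <= r -> `|u - v| <= e -> d (phi' u) (phi' v) <= 1.

Lemma unit_modulus_exists r : exists2 e, 0 < e & unit_modulus r e.
Proof.
have local_modulus (w : 'rV[R]_2) : \forall u \near w & e \near 0^'+,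
    forall v, `|u - v| <= e -> d (phi' u) (phi' v) <= 1.
  have half : (0 : R) < 1 / 2 by lra.
  have /nbhs_ballP[rho /= rho0 ball_rho] := phi'_cont (nbhs_dist_lt g (phi' w) half).
  have near_w v : `|w - v| < rho -> d (phi' w) (phi' v) < 1 / 2.
    by move=> wv; apply: ball_rho; rewrite -ball_normE.
  near=> u e; have wu : `|w - u| < rho / 2.
    near: u; apply/nbhs_ballP; exists (rho / 2) => [|v]; first by rewrite /= divr_gt0.
    by rewrite -ball_normE.
  have e_rho : e < rho / 2 by near: e; apply: nbhs_right_lt; rewrite divr_gt0.
  move=> v uv; have wv : `|w - v| <= `|w - u| + e.
    by apply: le_trans (ler_distD u w v) _; rewrite lerD2l.
  have du : d (phi' w) (phi' u) < 1 / 2 by apply: near_w; lra.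
  have dv : d (phi' w) (phi' v) < 1 / 2 by apply: near_w; lra.
  by have := triangle (phi' w) (phi' u) (phi' v); rewrite (dist_sym g (phi' u) (phi' w)); lra.
have : \forall e \near 0^'+, forall u, `|0 - u| <= r ->
    forall v, `|u - v| <= e -> d (phi' u) (phi' v) <= 1.
  have /compact_near_coveringP := @compact_norm_le R 0 r.
  by apply=> w _; exact: local_modulus.
move=> near_0; have [e [e0 e_modulus]] := filter_ex (filterI (nbhs_right_gt (0 : R)) near_0).
by exists e => // u v ur; apply: e_modulus; rewrite sub0r normrN.
Unshelve. all: by end_near. Qed.

(* The admissible [e] grow with the bound [r + e] on [u]: this makes the supremum
   1-Lipschitz in [r]. *)
Definition gauge_set r := [set e | 0 <= e <= 1 /\ unit_modulus (r + e) e].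

Definition gauge r : R := sup (gauge_set r).

Lemma gauge_set_gt0 r : exists2 e, 0 < e & gauge_set r e.
Proof.
have [e e0 e_modulus] := unit_modulus_exists (r + 1).
have min_e : Num.min e 1 <= e by rewrite ge_min lexx.
have min_1 : Num.min e 1 <= 1 by rewrite ge_min lexx orbT.
exists (Num.min e 1); first by rewrite lt_min e0 ltr01.
split; first by rewrite min_1 le_min (ltW e0) ler01.
by move=> u v ur uv; apply: e_modulus; lra.
Qed.

Lemma has_sup_gauge_set r : has_sup (gauge_set r).
Proof. by have [e _ re] := gauge_set_gt0 r; split; [exists e|exists 1 => y [/andP[]]]. Qed.

Lemma gauge_ub r e : gauge_set r e -> e <= gauge r.
Proof. by move=> re; apply: ub_le_sup => //; have [] := has_sup_gauge_set r. Qed.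

Lemma gauge_gt0 r : 0 < gauge r.
Proof. by have [e e0 /gauge_ub] := gauge_set_gt0 r; exact: lt_le_trans. Qed.

Lemma gauge_le1 r : gauge r <= 1.
Proof. by apply: ge_sup; [have [] := has_sup_gauge_set r|move=> y [/andP[]]]. Qed.

Lemma dist_lt_gauge r u v : `|u| <= r -> `|u - v| < gauge r -> d (phi' u) (phi' v) <= 1.
Proof.
move=> ur uv; have [nonempty _] := has_sup_gauge_set r.
have [e [/andP[e0 _] e_modulus] ue] := sup_gt nonempty uv.
by apply: e_modulus; [lra|exact: ltW].
Qed.

Lemma gauge_nincr r r' : r <= r' -> gauge r' <= gauge r.
Proof.
move=> rr'; apply: ge_sup => [|e [e01 e_modulus]]; first by have [] := has_sup_gauge_set r'.
by apply: gauge_ub; split=> // u v ur uv; apply: e_modulus => //; lra.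
Qed.

Lemma gauge_lipschitz r r' : r <= r' -> gauge r <= gauge r' + (r' - r).
Proof.
move=> rr'; apply: ge_sup => [|e [/andP[e0 e1] e_modulus]]; first by have [] := has_sup_gauge_set r.
have g0 := gauge_gt0 r'; have [e_le|le_e] := leP e (r' - r); first lra.
have : e - (r' - r) <= gauge r'; last lra.
apply: gauge_ub; split; first lra.
by move=> u v ur uv; apply: e_modulus; lra.
Qed.

Lemma gauge_continuous : continuous gauge.
Proof.
move=> r; apply/cvgrPdist_lt => e e0; apply/nbhs_ballP; exists e => // r'; rewrite /ball /=.
have [rr'|/ltW rr'] := leP r r'; have := gauge_nincr rr'; have := gauge_lipschitz rr';
  by rewrite !ltr_norml; lra.
Qed.

Definition stretch r : R := 5 / gauge r.

Lemma stretch_ge1 r : 1 <= stretch r.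
Proof. by rewrite /stretch ler_pdivlMr ?gauge_gt0 //; have := gauge_le1 r; lra. Qed.

Lemma stretch_ndecr r r' : r <= r' -> stretch r <= stretch r'.
Proof.
by move=> rr'; rewrite /stretch ler_pM2l ?lef_pV2 ?posrE ?gauge_gt0 //; exact: gauge_nincr.
Qed.

Lemma stretch_continuous : continuous stretch.
Proof.
move=> r; apply: cvgM; first exact: cvg_cst.
by apply: cvgV; [rewrite gt_eqF // gauge_gt0|exact: gauge_continuous].
Qed.

Definition stretch_map u : 'rV[R]_2 := stretch `|u| *: u.

Lemma stretch_map_continuous : continuous stretch_map.
Proof.
have stretch_norm : continuous (stretch \o (fun u : 'rV[R]_2 => `|u|)).
  by move=> u; exact: (continuous_comp (@norm_continuous R _ u) (@stretch_continuous _)).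
by move=> u; exact: (cvgZ (stretch_norm u) (@cvg_id _ (nbhs u))).
Qed.

Lemma norm_stretch_map u : `|stretch_map u| = stretch `|u| * `|u|.
Proof. by rewrite /stretch_map normrZ ger0_norm // (le_trans ler01) // stretch_ge1. Qed.

Lemma dist_stretch_map u v : `|stretch_map u - stretch_map v| <= 2 -> d (phi' u) (phi' v) <= 1.
Proof.
wlog uv : u v / `|u| <= `|v|.
  move=> wlog_uv near_uv; have [/wlog_uv|/ltW/wlog_uv] := leP `|u| `|v|; first exact.
  by rewrite dist_sym; apply; rewrite distrC.
move=> near_uv; apply: (dist_lt_gauge (lexx _)).
have s1 := stretch_ge1 `|u|; have s_ndecr := stretch_ndecr uv; have g0 := gauge_gt0 `|u|.
have splitE : stretch `|u| *: (v - u) =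
    (stretch_map v - stretch_map u) - (stretch `|v| - stretch `|u|) *: v.
  rewrite /stretch_map scalerBr scalerBl; rewrite opprB addrCA -!addrA; congr (_ + _).
  by rewrite [in RHS]addrC addrNK.
have radial_le : `|(stretch `|v| - stretch `|u|) *: v| <= `|stretch_map v - stretch_map u|.
  rewrite normrZ ger0_norm ?subr_ge0 // mulrBl; apply: le_trans (lerB_dist _ _).
  by rewrite !norm_stretch_map lerD2l lerN2 ler_pM2l // (lt_le_trans ltr01).
have : stretch `|u| * `|v - u| <= 4.
  rewrite -[stretch _ in X in X <= _]ger0_norm ?(le_trans ler01) // -normrZ splitE.
  by apply: le_trans (ler_normB _ _) _; rewrite distrC in near_uv; lra.
by rewrite /stretch mulrAC ler_pdivrMr // distrC; lra.
Qed.

Lemma stretch_map_surj w : exists u, stretch_map u = w.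
Proof.
have [||s] := @IVT R (fun s => stretch (s * `|w|) * s) 0 1 1 ler01.
- have mul_cont : continuous (fun s : R => s * `|w|).
    by move=> s; apply: cvgM; [exact: cvg_id|exact: cvg_cst].
  have stretch_cont : continuous (stretch \o (fun s : R => s * `|w|)).
    by move=> s; exact: (continuous_comp (mul_cont s) (@stretch_continuous _)).
  by apply: continuous_subspaceT => s; exact: (cvgM (stretch_cont s) (@cvg_id _ (nbhs s))).
- rewrite mulr0 mul1r mulr1; have s1 := stretch_ge1 `|w|; have s0 := le_trans ler01 s1.
  by rewrite (min_idPl s0) (max_idPr s0) ler01.
rewrite in_itv /= => /andP[s0 _] sE; exists (s *: w).
by rewrite /stretch_map normrZ ger0_norm // scalerA sE scale1r.
Qed.

Definition position p := stretch_map (phi p).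

Lemma position_continuous : continuous position.
Proof. by move=> p; apply: continuous_comp; [exact: phi_cont|exact: stretch_map_continuous]. Qed.

Lemma dist_position p q : `|position p - position q| <= 2 -> d p q <= 1.
Proof. by move/dist_stretch_map; rewrite !phiK. Qed.

Lemma lattice_point_exists z : exists p, position p = lattice R z.
Proof.
by have [u uE] := stretch_map_surj (lattice R z); exists (phi' u); rewrite /position phi'K.
Qed.

Variable grid_point : Z2 -> M.
Hypothesis grid_pointP : forall z, position (grid_point z) = lattice R z.

Definition cell p : Z2 := (Num.floor (position p 0 0), Num.floor (position p 0 1)).

Definition near_lattice p z := `|position p - lattice R z| <= 1.

Definition grid_close z z' := d (grid_point z) (grid_point z') <= 3.

Lemma near_latticeP p z : near_lattice p z <->
  `|position p 0 0 - z.1%:~R| <= 1 /\ `|position p 0 1 - z.2%:~R| <= 1.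
Proof.
have entry0 : (position p - lattice R z) 0 0 = position p 0 0 - z.1%:~R by rewrite !mxE.
have entry1 : (position p - lattice R z) 0 1 = position p 0 1 - z.2%:~R by rewrite !mxE.
rewrite -entry0 -entry1; split=> [pz|[]]; last exact: norm_row2_le.
by split; apply: le_trans pz; exact: mx_entry_norm_le.
Qed.

Lemma floor_dist (x : R) : 0 <= x - (Num.floor x)%:~R < 1.
Proof. by have := floor_itv x; rewrite intrD; lra. Qed.

Lemma near_lattice_cell p : near_lattice p (cell p).
Proof.
have := floor_dist (position p 0 0); have := floor_dist (position p 0 1).
by move=> f1 f0; apply/near_latticeP; rewrite !ler_norml /=; lra.
Qed.

Lemma dist_near_lattice p z : near_lattice p z -> d p (grid_point z) <= 1.
Proof. by move=> pz; apply: dist_position; rewrite grid_pointP; apply: le_trans pz _; lra. Qed.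

Lemma cell_grid_point z : cell (grid_point z) = z.
Proof. by rewrite /cell grid_pointP /lattice row2_0 row2_1 !intrKfloor; case: z. Qed.

Lemma grid_close_refl z : grid_close z z.
Proof. by rewrite /grid_close dist_refl. Qed.

Lemma grid_close_sym z z' : grid_close z z' -> grid_close z' z.
Proof. by rewrite /grid_close dist_sym. Qed.

Lemma grid_adj_close z z' : grid_adj z z' -> grid_close z z'.
Proof.
move=> /grid_adjP[u dir_u ->]; apply: (@le_trans _ _ 1); last lra.
apply: dist_position; rewrite !grid_pointP.
case/unit_dirP: dir_u => ->; apply: norm_row2_le;
  by rewrite !mxE /= intrD ?unit_dirE ler_norml; lra.
Qed.

Lemma near_floor (x : R) (n : int) : `|x - n%:~R| <= 1 ->
  [\/ n = Num.floor x, n = Num.floor x + 1 | Num.floor x = n + 1].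
Proof.
rewrite ler_norml => /andP[x_ge x_le]; have /andP[fl_le fl_gt] := floor_dist x.
have n_lt : (n < Num.floor x + 2)%R by rewrite -(ltr_int R) intrD; lra.
have fl_lt : (Num.floor x < n + 2)%R by rewrite -(ltr_int R) intrD; lra.
have [->|[->|->]] : n = Num.floor x \/ n = Num.floor x + 1 \/ Num.floor x = n + 1 by lia.
- exact: Or31.
- exact: Or32.
- exact: Or33.
Qed.

Lemma near_lattice_joined p z : near_lattice p z -> joined grid_adj (near_lattice p) z (cell p).
Proof.
case: z => m n pz; pose fl0 := Num.floor (position p 0 0).
have /near_latticeP[/= pm pn] := pz; have pc := near_lattice_cell p.
have p_mid : near_lattice p (fl0, n).
  by have /near_latticeP[c0 _] := pc; apply/near_latticeP.
have adj_row (a b : int) : grid_adj (a, b) (a + 1, b).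
  have -> : (a + 1, b) = (a, b) + (1, 0) :> Z2 by congr pair; rewrite addr0.
  exact: grid_adj_add.
have adj_column (a b : int) : grid_adj (a, b) (a, b + 1).
  have -> : (a, b + 1) = (a, b) + (0, 1) :> Z2 by congr pair; rewrite addr0.
  exact: grid_adj_add.
apply: (@joined_trans _ _ _ _ (fl0, n)).
  have [->|mE|flE] := near_floor pm; first exact: joined_refl.
    by apply: joined_adj => //; rewrite mE; apply: grid_adj_sym; exact: adj_row.
  by apply: joined_adj => //; rewrite /fl0 flE.
have [->|nE|flE] := near_floor pn; first exact: joined_refl.
  by apply: joined_adj => //; rewrite nE; apply: grid_adj_sym; exact: adj_column.
by apply: joined_adj => //; rewrite /cell -/fl0 flE.
Qed.

Lemma nbhs_near_cell p : nbhs p [set q | near_lattice q (cell p)].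
Proof.
have entry_near (j : 'I_2) :
    nbhs p [set q | `|position q 0 j - (Num.floor (position p 0 j))%:~R| < 1].
  have position_cvg : position q 0 j @[q --> p] --> position p 0 j.
    exact: (cvg_mx_entry (f := position) (@position_continuous p)).
  have /cvgr_lt : `|position q 0 j - (Num.floor (position p 0 j))%:~R| @[q --> p] -->
      `|position p 0 j - (Num.floor (position p 0 j))%:~R|.
    by apply: cvg_norm; exact: (cvgB position_cvg (cvg_cst _)).
  by apply; rewrite ger0_norm; have := floor_dist (position p 0 j); lra.
apply: filterS2 (entry_near 0) (entry_near 1) => q q0 q1.
by apply/near_latticeP; split; exact: ltW.
Qed.

Definition curve_cells c (a b : R) : set Z2 :=
  [set z | exists2 t, a <= t <= b & near_lattice (c t) z].

Lemma near_lattice_curve_cells c a b t : a <= t <= b -> near_lattice (c t) `<=` curve_cells c a b.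
Proof. by move=> tab z tz; exists t. Qed.

Lemma curve_cells_joined c a b z z' : a <= b -> {within `[a, b], continuous c} ->
  near_lattice (c a) z -> near_lattice (c b) z' -> joined grid_adj (curve_cells c a b) z z'.
Proof.
move=> ab c_cont.
have to_cell t z1 : a <= t <= b -> near_lattice (c t) z1 ->
    joined grid_adj (curve_cells c a b) z1 (cell (c t)).
  by move=> tab tz1; exact: joined_subset (near_lattice_curve_cells tab) (near_lattice_joined tz1).
suff cells_joined : joined grid_adj (curve_cells c a b) (cell (c a)) (cell (c b)).
  move=> az bz'; apply: joined_trans (to_cell a z _ az) _; first by rewrite lexx.
  apply: joined_trans cells_joined (joined_sym grid_adj_sym (to_cell b z' _ bz')).
  by rewrite lexx ab.
apply: (@segment_induction R
  (fun x y => joined grid_adj (curve_cells c a b) (cell (c x)) (cell (c y)))).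
- exact: ab.
- move=> t tab; have [e e0 near_t] := (within_itvP c a b).1 c_cont t tab _ (nbhs_near_cell (c t)).
  have to_t x : a <= x <= b -> `|x - t| < e ->
      joined grid_adj (curve_cells c a b) (cell (c t)) (cell (c x)).
    by move=> xab xt; apply: to_cell => //; exact: near_t.
  exists e => // x y axt tyb xe ye; apply: joined_trans (to_t y _ _); rewrite ?ltr_norml; try lra.
  by apply: (joined_sym grid_adj_sym); apply: to_t; rewrite ?ltr_norml; lra.
- by move=> x y w _ _; exact: joined_trans.
Qed.

Lemma curve_cells_connected c a b : {within `[a, b], continuous c} ->
  connected_set grid_adj (curve_cells c a b).
Proof.
move=> c_cont.
have ordered s t z z' : a <= s -> s <= t -> t <= b -> near_lattice (c s) z ->
    near_lattice (c t) z' -> joined grid_adj (curve_cells c a b) z z'.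
  move=> as_ st tb sz tz'; apply: (@joined_subset _ _ (curve_cells c s t)).
    by move=> w [x xst xw]; exists x => //; lra.
  by apply: curve_cells_joined => //; exact: within_itv_subset c_cont.
move=> z z' [s /andP[as_ sb] sz] [t /andP[at_ tb] tz'].
have [st|/ltW ts] := leP s t; first exact: ordered sz tz'.
by apply: (joined_sym grid_adj_sym); exact: ordered tz' sz.
Qed.

Lemma arclength_dist c L a b s t : arclength g c L a b -> a <= s <= b -> a <= t <= b ->
  d (c s) (c t) <= L b - L a.
Proof.
move=> cL; wlog st : s t / s <= t.
  move=> wlog_st sab tab; have [/wlog_st|/ltW/wlog_st ts] := leP s t; first exact.
  by rewrite dist_sym; exact: ts.
move=> /andP[as_ sb] /andP[at_ tb].
have L_ndecr x y : a <= x -> x <= y -> y <= b -> L x <= L y.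
  by move=> ax xy yb; apply: (arclength_ndecr (g := g) xy); exact: arclength_subset cL.
have La := L_ndecr a s (lexx a) as_ sb; have Lb := L_ndecr t b at_ tb (lexx b).
have Lst := L_ndecr s t as_ st tb.
move: st; rewrite le_eqVlt => /orP[/eqP->|st]; first by rewrite dist_refl; lra.
apply: (@le_trans _ _ (L t - L s)); last lra.
by apply: dist_le; exists c, L, s, t; split=> //; exact: arclength_subset cL.
Qed.

Lemma curve_cells_close c L a b z z' : arclength g c L a b -> L b - L a <= 1 ->
  curve_cells c a b z -> curve_cells c a b z' -> grid_close z z'.
Proof.
move=> cL short [s sab sz] [t tab tz']; rewrite /grid_close.
have := triangle (c s) (grid_point z) (grid_point z').
have := triangle (c t) (c s) (grid_point z').
have := dist_near_lattice sz; have := dist_near_lattice tz'.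
by have := arclength_dist cL sab tab; rewrite (dist_sym g (grid_point z) (c s)); lra.
Qed.

Lemma short_curve_small p q r : r <= 1 -> curve_of_length g p q r ->
  exists K : set Z2, [/\ small grid_adj grid_close K, K (cell p) & K (cell q)].
Proof.
move=> r1 [c [L [a [b [ab cL <- <- LE]]]]]; have [_ [s [[c_cont _ _] _]]] := cL.
exists (curve_cells c a b); split; last 2 first.
- by exists a; [rewrite lexx ltW|exact: near_lattice_cell].
- by exists b; [rewrite lexx ltW|exact: near_lattice_cell].
split; first exact: curve_cells_connected.
by move=> z z'; apply: curve_cells_close cL _; rewrite LE.
Qed.

Section CurveHops.
Variables (center : Z2 -> Z2) (hop_bound : nat).
Hypothesis small_hops : forall K z z', small grid_adj grid_close K -> K z -> K z' ->
  hops grid_adj center hop_bound z z'.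

Lemma curve_hops n p q r : curve_of_length g p q r -> r <= n.+1%:R ->
  hops grid_adj center (hop_bound * n.+1) (cell p) (cell q).
Proof.
have short_hops p' q' r' : r' <= 1 -> curve_of_length g p' q' r' ->
    hops grid_adj center hop_bound (cell p') (cell q').
  by move=> r'1 /(short_curve_small r'1)[K [K_small Kp' Kq']]; exact: small_hops K_small Kp' Kq'.
elim: n p q r => [|n IHn] p q r pq r_le; first by rewrite muln1; exact: short_hops pq.
have [r1|/ltW r1] := leP r 1.
  by apply: hops_leq (short_hops p q r r1 pq); rewrite leq_pmulr.
have [|o [po oq]] := curve_of_length_split (r1 := 1) pq; first by rewrite ler01.
rewrite mulnS; apply: hops_trans (short_hops p o 1 (lexx 1) po) (IHn o q _ oq _).
by rewrite lerBlDr natr1.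
Qed.

Lemma dist_hops p q n : d p q < n%:R -> hops grid_adj center (hop_bound * n) (cell p) (cell q).
Proof.
case: n => [|n]; first by rewrite ltNge dist_ge0.
move/(dist_lt (plane_rectifiably_joined g phiK phi'_cont p q)) => [r /ltW r_le pq].
exact: curve_hops pq r_le.
Qed.

End CurveHops.

Hypothesis d_complete : complete_dist d.

Lemma box_finite (N : nat) : finite_set [set z : Z2 | `|z.1| <= N%:Z /\ `|z.2| <= N%:Z].
Proof.
pose coords := [seq i%:Z - N%:Z | i <- iota 0 (2 * N).+1].
have coordsP (x : int) : `|x| <= N%:Z -> x \in coords.
  move=> xN; apply/mapP; exists `|(x + N%:Z)%R|%N; last by lia.
  by rewrite mem_iota; lia.
apply: sub_finite_set (finite_seq [seq (x, y) | x <- coords, y <- coords]) => -[x y] [/= xN yN].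
suff : (x, y) \in [seq (x, y) | x <- coords, y <- coords] by [].
by apply/allpairsP; exists (x, y); rewrite !coordsP.
Qed.

Lemma grid_close_finite z : finite_set [set z' | grid_close z z'].
Proof.
have [B B_bound] := plane_bounded_ball phiK phi_cont phi'_cont d_complete (grid_point z) 3.
pose C := stretch `|B| * `|B|; pose N := Num.bound `|C|.
apply: sub_finite_set (box_finite N) => z' /B_bound/le_trans/(_ (ler_norm B)) phi_le.
have : `|position (grid_point z')| <= C.
  rewrite norm_stretch_map; apply: ler_pM => //; last exact: stretch_ndecr.
  by rewrite (le_trans ler01) // stretch_ge1.
rewrite grid_pointP => lattice_le.
have C_lt : C < N%:R by apply: le_lt_trans (ler_norm _) (archi_boundP (normr_ge0 _)).
have entry_le (j : 'I_2) (n : int) : lattice R z' 0 j = n%:~R -> `|n| <= N%:Z.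
  move=> nE; have := mx_entry_norm_le (lattice R z') 0 j; rewrite nE -intr_norm => n_le.
  by rewrite -(ler_int R); apply: le_trans n_le (le_trans lattice_le (ltW C_lt)).
by split; [apply: (entry_le 0)|apply: (entry_le 1)]; rewrite ?row2_0 ?row2_1.
Qed.

End Grid.

(** * The cluster graph is quasi-isometric to the plane *)

Section Walks.
Local Open Scope ring_scope.
Variables (R : realType) (G : graph).
Implicit Types u v w : vertex G.

Lemma walk0 u v : walk 0 u v -> u = v.
Proof. by move=> [f [<- <-]]. Qed.

Lemma walk_step n u v w : walk n u v -> adj v w -> walk n.+1 u w.
Proof.
move=> [f [f0 fn f_adj]] vw; exists (fun k => if (k <= n)%N then f k else w).
split=> //; first by rewrite ltnn.
move=> k; rewrite ltnS => kn; rewrite kn; case: ltngtP kn => // [kn _|-> _]; first exact: f_adj.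
by rewrite fn.
Qed.

Lemma walk_last n u w : walk n.+1 u w -> exists2 v, walk n u v & adj v w.
Proof.
move=> [f [f0 fn f_adj]]; exists (f n); last by rewrite -fn; exact: f_adj.
by exists f; split=> // k kn; apply: f_adj; exact: ltnW.
Qed.

Lemma graph_dist_le n u v : walk n u v -> graph_dist R u v <= n%:R.
Proof.
move=> uv; apply: ge_inf; last by exists n.
by exists 0 => _ [m _ <-]; exact: ler0n.
Qed.

Lemma graph_dist_ge u v (a : R) : (exists n, walk n u v) ->
  (forall n, walk n u v -> a <= n%:R) -> a <= graph_dist R u v.
Proof.
move=> [n uv] walk_ge; apply: lb_le_inf; first by exists n%:R, n.
by move=> _ [m uv' <-]; exact: walk_ge.
Qed.

End Walks.

Section ClusterGraphGeometry.
Local Open Scope ring_scope.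
Variables (R : realType) (X : Type) (d : X -> X -> R) (point : Z2 -> X) (cell : X -> Z2).
Hypothesis d_ge0 : forall p q, 0 <= d p q.
Hypothesis d_refl : forall p, d p p = 0.
Hypothesis d_sym : forall p q, d p q = d q p.
Hypothesis d_triangle : forall q p o, d p o <= d p q + d q o.
Hypothesis cell_point : forall z, cell (point z) = z.
Hypothesis dist_cell : forall p, d p (point (cell p)) <= 1.
Local Notation close := (fun z z' => d (point z) (point z') <= 3).
Hypothesis adj_close : forall z z', grid_adj z z' -> close z z'.
Hypothesis close_finite : forall z, finite_set [set z' | close z z'].
Variables (center : Z2 -> Z2) (radius hop_bound : nat).
Hypothesis center_idem : forall z, center (center z) = center z.
Hypothesis center_chain : forall z, chain grid_adj close setT radius (center z) z.
Hypothesis dist_hops : forall p q (n : nat), d p q < n%:R ->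
  hops grid_adj center (hop_bound * n) (cell p) (cell q).

Local Notation G := (cluster_graph center).

Definition cluster_of z : vertex G := exist _ (center z) (introT eqP (center_idem z)).

Lemma cluster_of_val (v : vertex G) : cluster_of (val v) = v.
Proof. by apply: val_inj; apply/eqP; exact: (valP v). Qed.

Lemma hops_walk n x y : hops grid_adj center n x y ->
  exists2 m, (m <= n)%N & walk m (cluster_of x) (cluster_of y).
Proof.
elim: n y => [y /= xy|n IHn y [z /IHn[m mn xz] zy]].
  by exists 0%N => //; exists (fun=> cluster_of x); split=> //; exact: val_inj.
have [zyE|zyN] := pselect (center z = center y).
  have -> : cluster_of y = cluster_of z by exact: val_inj.
  by exists m => //; exact: leqW.
exists m.+1 => //; apply: walk_step xz _.
by case: zy => [/zyN//|[x' [y' [x'z y'y x'y']]]]; split=> //; exists x', y'.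
Qed.

Lemma cluster_walk p q : exists2 m, walk m (cluster_of (cell p)) (cluster_of (cell q)) &
  m%:R <= hop_bound%:R * (d p q + 1).
Proof.
have /andP[trunc_le trunc_gt] := truncn_itv (d_ge0 p q).
have [m m_le pq] := hops_walk (dist_hops trunc_gt); exists m => //.
apply: (@le_trans _ _ (hop_bound * (Num.truncn (d p q)).+1)%:R); first by rewrite ler_nat.
by rewrite natrM ler_wpM2l // -natr1 lerD2r.
Qed.

Lemma cluster_graph_connected : connected_graph G.
Proof.
move=> u v; have [m uv _] := cluster_walk (point (val u)) (point (val v)).
by exists m; move: uv; rewrite !cell_point !cluster_of_val.
Qed.

Lemma cluster_graph_locally_finite : locally_finite_graph G.
Proof.
move=> v; have fin : finite_set (center @` [set y | chain grid_adj close setT radius.+1 (val v) y]).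
  by apply: finite_image; exact: chain_finite.
apply: sub_finite_set (finite_preimage _ fin : finite_set (val @^-1` _)); last first.
  by move=> x y _ _; exact: val_inj.
move=> w [_ [x [y [xv yw xy]]]]; exists y => //=.
apply: (@chain_step _ _ _ _ _ _ x); first by rewrite -xv; exact: center_chain.
have close_refl z : close z z by rewrite d_refl.
have close_sym z z' : close z z' -> close z' z by rewrite d_sym.
exact: (small_step_adj close_refl grid_adj_sym close_sym adj_close).
Qed.

Lemma chain_dist n x y : chain grid_adj close setT n x y -> d (point x) (point y) <= 3 * n%:R.
Proof.
elim: n y => [y /= <-|n IHn y [z /IHn xz /small_step_close zy]]; first by rewrite d_refl mulr0.
by apply: le_trans (d_triangle (point z) _ _) _; rewrite -[n.+1%:R]natr1 mulrDr mulr1 lerD.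
Qed.

Lemma dist_center z : d (point (center z)) (point z) <= 3 * radius%:R.
Proof. exact: chain_dist (center_chain z). Qed.

Lemma adj_dist (u v : vertex G) : adj u v ->
  d (point (val u)) (point (val v)) <= 6 * radius%:R + 3.
Proof.
move=> [_ [x [y [<- <- /adj_close xy]]]].
have := d_triangle (point x) (point (center x)) (point (center y)).
have := d_triangle (point y) (point x) (point (center y)).
have := dist_center x; have := dist_center y; rewrite (d_sym (point y)); lra.
Qed.

Lemma walk_dist n (u v : vertex G) : walk n u v ->
  d (point (val u)) (point (val v)) <= (6 * radius%:R + 3) * n%:R.
Proof.
elim: n v => [v /walk0->|n IHn v /walk_last[w /IHn uw /adj_dist wv]].
  by rewrite d_refl mulr0.
by apply: le_trans (d_triangle (point (val w)) _ _) _; rewrite -[n.+1%:R]natr1 mulrDr mulr1 lerD.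
Qed.

Lemma dist_cluster p : d p (point (center (cell p))) <= 3 * radius%:R + 1.
Proof.
have := d_triangle (point (cell p)) p (point (center (cell p))).
by have := dist_center (cell p); have := dist_cell p; rewrite (d_sym (point (cell p))); lra.
Qed.

Lemma dist_le_walk n p q : walk n (cluster_of (cell p)) (cluster_of (cell q)) ->
  d p q <= (6 * radius%:R + 3) * n%:R + (6 * radius%:R + 2).
Proof.
move=> /walk_dist /=.
have := d_triangle (point (center (cell p))) p q.
have := d_triangle (point (center (cell q))) (point (center (cell p))) q.
by have := dist_cluster p; have := dist_cluster q; rewrite (d_sym q); lra.
Qed.

Lemma quasi_isometric_cluster_graph : quasi_isometric d (@graph_dist R G).
Proof.
pose A : R := (hop_bound + (6 * radius + 3))%:R; pose B : R := (hop_bound + (6 * radius + 2))%:R.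
have AE : A = hop_bound%:R + (6 * radius%:R + 3) by rewrite /A natrD natrD natrM.
have BE : B = hop_bound%:R + (6 * radius%:R + 2) by rewrite /B natrD natrD natrM.
have hop0 : 0 <= hop_bound%:R :> R := ler0n _ _; have radius0 : 0 <= radius%:R :> R := ler0n _ _.
have A1 : 1 <= A by lra.
have B0 : 0 <= B by lra.
exists (fun p => cluster_of (cell p)), A, B, 0; split=> // [p q|v].
  have [m pq m_le] := cluster_walk p q; have d0 := d_ge0 p q; apply/andP; split; last first.
    by apply: le_trans (graph_dist_le R pq) (le_trans m_le _); rewrite AE BE; nra.
  apply: graph_dist_ge => [|n /dist_le_walk pq_le]; first by exists m.
  have n0 : 0 <= n%:R :> R := ler0n _ _.
  by rewrite lerBlDr mulrC ler_pdivrMr ?(lt_le_trans ltr01) //; nra.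
exists (point (val v)); rewrite cell_point cluster_of_val -[leRHS](_ : 0%:R = 0) //.
by apply: graph_dist_le; exists (fun=> v).
Qed.

End ClusterGraphGeometry.

Lemma infinite_Z2 : infinite_set [set: Z2].
Proof.
move=> /(finite_image (fun z => `|z.1|%N)) fin; apply: infinite_nat.
by apply: sub_finite_set fin => n _; exists (Posz n, 0%R).
Qed.

Local Open Scope ring_scope.

Theorem theorem1p7 (R : realType) (M : topologicalType)
    (A : smooth_atlas R M) (g : riemannian_metric A)
    (M_plane : homeomorphic M 'rV[R]_2)
    (g_complete : complete_dist (riemannian_dist g)) :
  exists G : graph,
    [/\ connected_graph G, locally_finite_graph G, planar_graph R G &
        quasi_isometric (riemannian_dist g) (@graph_dist R G)].
Proof.
have [phi [phi' [phiK phi'K phi_cont phi'_cont]]] := M_plane.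
have /choice[point pointP] := lattice_point_exists g phiK phi'K phi'_cont.
have close_finite := grid_close_finite phiK phi_cont phi'_cont pointP g_complete.
have adj_close := grid_adj_close phiK phi'_cont pointP.
have [center [radius [hop_bound [center_idem center_joined center_chain small_hops]]]] :=
  cluster_decomposition grid_adj_sym (@grid_close_refl _ _ _ g point)
    (@grid_close_sym _ _ _ g point) adj_close close_finite grid_K5_minor_free infinite_Z2.
have hops_le := dist_hops phiK phi_cont phi'_cont pointP small_hops.
have cell_dist p := dist_near_lattice phiK phi'_cont pointP (near_lattice_cell g phi phi' p).
have cellK := cell_grid_point pointP.
exists (cluster_graph center); split.
- exact: (cluster_graph_connected (dist_ge0 g) cellK center_idem hops_le).
- exact: (cluster_graph_locally_finite (dist_refl g) (dist_sym g) adj_close close_finite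
    center_chain).
- exact: (planar_cluster_graph center_joined R).
- exact: (quasi_isometric_cluster_graph (dist_ge0 g) (dist_refl g) (dist_sym g)
    (plane_dist_triangle g phiK phi'_cont) cellK cell_dist adj_close center_idem center_chain
    hops_le).
Qed.
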